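(* Let $\lambda\in(-\pi/2,\pi/2)$. For every $\varepsilon\in(0,4)$ there exists a $\lambda$-spirallike function $f$ on the unit disk $\mathbb{D}=\{z\in\mathbb{C}:|z|<1\}$ such that $$\liminf_{r\to 1^-}\frac{L(r,f)}{M(r,f)\log\frac{1+r}{1-r}}\ge (4-\varepsilon)\cos\lambda.$$
   Context: For $\lambda\in(-\pi/2,\pi/2)$ and $w\in\mathbb{C}$, the $\lambda$-spiral segment joining $w$ and $0$ is $[0,w]_\lambda=\{w\exp(te^{i\lambda}):-\infty<t\le 0\}\cup\{0\}$. A domain $\Omega\subset\mathbb{C}$ with $0\in\Omega$ is called $\lambda$-spirallike with respect to the origin if $[0,w]_\lambda\subset\Omega$ whenever $w\in\Omega$. A holomorphic function $f$ on $\mathbb{D}$ is called $\lambda$-spirallike if $f(0)=0$ and $f$ maps $\mathbb{D}$ univalently (injectively) onto a domain that is $\lambda$-spirallike with respect to the origin. For $0<r<1$, $L(r,f)=\int_0^{2\pi}r|f'(re^{i\theta})|\,d\theta$ and $M(r,f)=\max_{|z|=r}|f(z)|$. *)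

(* Defs.v *)
From Stdlib Require Import Reals.
From Coquelicot Require Import Coquelicot.
Open Scope R_scope.

Definition Cexp (z : C) : C := (exp (Re z) * cos (Im z), exp (Re z) * sin (Im z)).

Definition unit_disk (z : C) : Prop := Cmod z < 1.

Definition image (f : C -> C) (D : C -> Prop) (w : C) : Prop :=
  exists z : C, D z /\ f z = w.

Definition connected (D : C -> Prop) : Prop :=
  forall U V : C -> Prop,
    open (T := C_UniformSpace) U -> open (T := C_UniformSpace) V ->
    (forall z, D z -> U z \/ V z) ->
    (exists z, D z /\ U z) -> (exists z, D z /\ V z) ->
    exists z, D z /\ U z /\ V z.

Definition domain (D : C -> Prop) : Prop :=
  (exists z, D z) /\ open (T := C_UniformSpace) D /\ connected D.

Definition spiral_segment (lam : R) (w u : C) : Prop :=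
  (exists t : R, t <= 0 /\ u = (w * Cexp (RtoC t * Cexp (Ci * RtoC lam)))%C)
  \/ u = RtoC 0.

Definition spirallike_domain (lam : R) (D : C -> Prop) : Prop :=
  domain D /\ D (RtoC 0) /\
  forall w, D w -> forall u, spiral_segment lam w u -> D u.

Definition holomorphic_on (D : C -> Prop) (f : C -> C) : Prop :=
  forall z, D z -> ex_derive (K := C_AbsRing) (V := C_NormedModule) f z.

Definition injective_on (D : C -> Prop) (f : C -> C) : Prop :=
  forall z1 z2, D z1 -> D z2 -> f z1 = f z2 -> z1 = z2.

(* [f] is a total function on [C]; only its values on the unit disk matter. *)
Definition spirallike (lam : R) (f : C -> C) : Prop :=
  holomorphic_on unit_disk f /\
  f (RtoC 0) = RtoC 0 /\
  injective_on unit_disk f /\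
  spirallike_domain lam (image f unit_disk).

Definition curve_length (r : R) (f : C -> C) : R :=
  RInt (fun theta : R =>
          r * Cmod (C_derive f (RtoC r * Cexp (Ci * RtoC theta))%C))
       0 (2 * PI).

(* The least upper bound of |f| on the circle |z| = r. For f continuous on the
   circle this is the maximum; a set of values that is unbounded above would
   give the default value 0. *)
Definition max_modulus (r : R) (f : C -> C) : R :=
  real (Lub_Rbar (fun m : R => exists z : C, Cmod z = r /\ m = Cmod (f z))).

(* The supremum over all sets P of the filter F of the infimum of u on P. For
   F = at_left a, this is the lower limit of u x as x tends to a from below. *)
Definition LimInf {T : Type} (F : (T -> Prop) -> Prop) (u : T -> R) : Rbar :=
  Rbar_lub (fun m : Rbar =>
    exists P : T -> Prop, F P /\
      m = Rbar_glb (fun y : Rbar => exists x : T, P x /\ y = Finite (u x))).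

(* Main.v *)
Require Import Defs.
From Stdlib Require Import Reals Ranalysis5 Lra Lia Classical.
From Coquelicot Require Import Coquelicot.
Open Scope R_scope.

(** Let [mu] be a probability measure on a Cantor set of tiny dimension on the unit circle,
    [P] its Herglotz integral and [Q] the primitive of [(P - 1) / z] vanishing at [0], which is
    bounded because [mu] has bounded logarithmic potential. The function
    [f z = z exp (e^(i lam) cos lam Q(z^N) / N)] satisfies
    [e^(- i lam) z f' / f = cos lam P(z^N) - i sin lam], which has positive real part, so [f] is
    [lam]-spirallike; and [|f / z|] is as close to [1] as desired once [N] is large. Hence [L/M] is
    essentially [cos lam] times the integral of [|P|] over the circle [|z| = s], with [s = r^N].

    Put [h = log P], so that [|Im h| <= pi/2]. By Cauchy's formula the integral of [Im P Im h] over
    [|z| = s] equals [2 pi] times the [mu]-average of [log |P(s^2 zeta)|], hence the integral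
    of [|P|] is at least [4] times this average. Every point [zeta] of the Cantor set lies in an arc
    of length [1 - s] and mass [(1 - s)^alpha], [alpha] being the dimension, so
    [|P(s^2 zeta)|] is at least of order [(1 - s)^(alpha - 1)], which gives
    [4 (1 - alpha) log (1 / (1 - s))]. *)

(** The measure has to reconcile two demands. A point mass already gives circle means of |P| growing
    like 4 log (1 / (1 - s)), but then Q has a logarithmic singularity, |f| grows like a power of 1
    / (1 - r), and M spoils the quotient. A Cantor measure of small dimension loses only a small
    part of the factor 4, while its potential stays bounded. The substitution z^N then divides the
    oscillation of log |f / z| by N, and since 1 - r^N <= N (1 - r) it costs only an additive log N
    in the logarithm.

    No measure is constructed: the integrals are limits of averages over 2^k points, with error
    O(rho^k) for Lipschitz integrands. The constant in this rate blows up as |z| tends to 1. Hence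
    bounds are proved at level k up to an error geometric in k, and only then passed to the limit,
    for a fixed point or a fixed circle, by [le_of_geometric]; the uniform bounds survive although
    the rate is not uniform. *)

Notation continuous_CC := (continuous (T := C_UniformSpace) (U := C_UniformSpace)).
Notation continuous_RC := (continuous (T := R_UniformSpace) (U := C_UniformSpace)).
Notation continuous_RR := (continuous (T := R_UniformSpace) (U := R_UniformSpace)).

(** * Complex derivatives *)

Lemma Cmod_minus_sym (a b : C) : Cmod (a - b) = Cmod (b - a).
Proof. rewrite <- Cmod_opp. f_equal. ring. Qed.

Lemma im_le_Cmod (c : C) : Rabs (Im c) <= Cmod c.
Proof. eapply Rle_trans; [apply Rmax_r | apply Rmax_Cmod]. Qed.

Lemma Cmod_le_sum (c : C) : Cmod c <= Rabs (Re c) + Rabs (Im c).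
Proof.
  unfold Cmod. fold (Re c) (Im c).
  pose proof (Rabs_pos (Re c)). pose proof (Rabs_pos (Im c)).
  rewrite <- (sqrt_pow2 (Rabs (Re c) + Rabs (Im c))) by lra.
  apply sqrt_le_1_alt. rewrite <- (pow2_abs (Re c)), <- (pow2_abs (Im c)). nra.
Qed.

Lemma Cmod_triangle_inv (a b : C) : Cmod a - Cmod b <= Cmod (a - b).
Proof.
  assert (H := Cmod_triangle (a - b) b).
  replace (a - b + b)%C with a in H by ring. lra.
Qed.

Lemma Cmod_triangle_minus (a b : C) : Cmod (a - b) <= Cmod a + Cmod b.
Proof. unfold Cminus. rewrite <- (Cmod_opp b). apply Cmod_triangle. Qed.

Lemma Cmod_sq (c : C) : Cmod c * Cmod c = Re c * Re c + Im c * Im c.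
Proof. pose proof (Cmod2_alt c). simpl in H. lra. Qed.

(** The balls of [C_UniformSpace] are squares, so the comparison with Euclidean discs costs the
    factor [sqrt 2]. *)
Lemma C_continuous_eps (f : C -> C) (z : C) :
  continuous_CC f z <->
  forall eps : R, 0 < eps -> exists del : R, 0 < del /\
    forall w, Cmod (w - z) < del -> Cmod (f w - f z) < eps.
Proof.
  split.
  - intros H eps Heps.
    assert (Hs : 0 < eps / sqrt 2) by (apply Rdiv_lt_0_compat; [easy | apply Rlt_sqrt2_0]).
    destruct (proj1 (filterlim_locally f (f z)) H (mkposreal _ Hs)) as [d Hd].
    exists d. split. apply cond_pos.
    intros w Hw.
    assert (Hb : ball (M := C_UniformSpace) z d w)
      by (apply C_NormedModule_mixin_compat1; exact Hw).
    specialize (Hd w Hb).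
    apply C_NormedModule_mixin_compat2 in Hd. simpl in Hd.
    replace (sqrt 2 * (eps / sqrt 2)) with eps in Hd. exact Hd.
    field. apply Rgt_not_eq, Rlt_sqrt2_0.
  - intros H. apply filterlim_locally. intros eps.
    destruct (H eps (cond_pos eps)) as [d [Hd Hf]].
    assert (Hs : 0 < d / sqrt 2) by (apply Rdiv_lt_0_compat; [easy | apply Rlt_sqrt2_0]).
    exists (mkposreal _ Hs). intros w Hw.
    apply C_NormedModule_mixin_compat1. apply Hf.
    apply C_NormedModule_mixin_compat2 in Hw. simpl in Hw.
    replace (sqrt 2 * (d / sqrt 2)) with d in Hw. exact Hw.
    field. apply Rgt_not_eq, Rlt_sqrt2_0.
Qed.

Lemma open_C_eps (D : C -> Prop) :
  open (T := C_UniformSpace) D <->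
  forall z, D z -> exists del : R, 0 < del /\ forall w, Cmod (w - z) < del -> D w.
Proof.
  split.
  - intros H z Hz. destruct (H z Hz) as [d Hd].
    exists d. split. apply cond_pos. intros w Hw. apply Hd.
    apply C_NormedModule_mixin_compat1. exact Hw.
  - intros H z Hz. destruct (H z Hz) as [d [Hd Hw]].
    assert (Hs : 0 < d / sqrt 2) by (apply Rdiv_lt_0_compat; [easy | apply Rlt_sqrt2_0]).
    exists (mkposreal _ Hs). intros w Hb. apply Hw.
    apply C_NormedModule_mixin_compat2 in Hb. simpl in Hb.
    replace (sqrt 2 * (d / sqrt 2)) with d in Hb. exact Hb.
    field. apply Rgt_not_eq, Rlt_sqrt2_0.
Qed.

(* Coquelicot's [is_derive] over [C] has few calculus rules; [cderiv] is its
   epsilon-delta form. *)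
Definition cderiv (f : C -> C) (z l : C) : Prop :=
  forall eps : R, 0 < eps -> exists del : R, 0 < del /\
    forall w, Cmod (w - z) < del ->
      Cmod (f w - f z - l * (w - z)) <= eps * Cmod (w - z).

Lemma cderiv_is_derive (f : C -> C) (z l : C) :
  cderiv f z l -> is_derive (K := C_AbsRing) (V := C_NormedModule) f z l.
Proof.
  intros H. split.
  - apply is_linear_scal_l.
  - intros x Hx.
    replace x with z by
      apply (is_filter_lim_locally_unique (V := AbsRing_NormedModule C_AbsRing) z x Hx).
    intros eps. destruct (H eps (cond_pos eps)) as [d [Hd Hf]].
    exists (mkposreal _ Hd). intros w Hw.
    (* These balls are those of the absolute ring [C_AbsRing], already Euclidean discs, so no factor
       [sqrt 2] appears. *)
    assert (Hb : Cmod (w - z) < d) by exact Hw.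
    specialize (Hf w Hb).
    change (Cmod ((f w - f z) - (w - z) * l) <= eps * Cmod (w - z)).
    now rewrite (Cmult_comm (w - z)).
Qed.

Lemma cderiv_continuous (f : C -> C) (z l : C) :
  cderiv f z l -> continuous_CC f z.
Proof.
  intros H. apply C_continuous_eps. intros eps Heps.
  destruct (H 1 Rlt_0_1) as [d [Hd Hf]].
  assert (Hm := Cmod_ge_0 l).
  exists (Rmin d (eps / (2 + Cmod l))). split.
  { apply Rmin_pos; [easy | apply Rdiv_lt_0_compat; lra]. }
  intros w Hw.
  assert (H1 : Cmod (w - z) < d) by (eapply Rlt_le_trans; [apply Hw | apply Rmin_l]).
  assert (H2 : Cmod (w - z) < eps / (2 + Cmod l))
    by (eapply Rlt_le_trans; [apply Hw | apply Rmin_r]).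
  specialize (Hf w H1).
  assert (H3 := Cmod_triangle_inv (f w - f z) (l * (w - z))).
  rewrite Cmod_mult in H3.
  assert (H4 := Cmod_ge_0 (w - z)).
  apply Rle_lt_trans with ((1 + Cmod l) * Cmod (w - z)). lra.
  apply Rle_lt_trans with ((2 + Cmod l) * Cmod (w - z)). nra.
  apply Rlt_le_trans with ((2 + Cmod l) * (eps / (2 + Cmod l))).
  apply Rmult_lt_compat_l; lra. right. field. lra.
Qed.

Lemma cderiv_ext_loc (f g : C -> C) (z l : C) (d : R) :
  0 < d -> (forall w, Cmod (w - z) < d -> f w = g w) -> cderiv f z l -> cderiv g z l.
Proof.
  intros Hd Hfg H eps Heps. destruct (H eps Heps) as [e [He Hf]].
  exists (Rmin d e). split. now apply Rmin_pos.
  intros w Hw.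
  rewrite <- !Hfg. apply Hf.
  eapply Rlt_le_trans; [apply Hw | apply Rmin_r].
  replace (z - z)%C with (RtoC 0) by ring. rewrite Cmod_0. easy.
  eapply Rlt_le_trans; [apply Hw | apply Rmin_l].
Qed.

Lemma cderiv_eq (f : C -> C) (z l l' : C) : l = l' -> cderiv f z l -> cderiv f z l'.
Proof. now intros ->. Qed.

Lemma cderiv_ext (f g : C -> C) (z l : C) :
  (forall w, f w = g w) -> cderiv f z l -> cderiv g z l.
Proof. intros H. apply cderiv_ext_loc with 1. lra. intros; apply H. Qed.

Lemma cderiv_const (c z : C) : cderiv (fun _ => c) z 0.
Proof.
  intros eps Heps. exists 1. split. lra. intros w _.
  replace (c - c - 0 * (w - z))%C with (RtoC 0) by ring. rewrite Cmod_0.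
  apply Rmult_le_pos. lra. apply Cmod_ge_0.
Qed.

Lemma cderiv_id (z : C) : cderiv (fun w => w) z 1.
Proof.
  intros eps Heps. exists 1. split. lra. intros w _.
  replace (w - z - 1 * (w - z))%C with (RtoC 0) by ring. rewrite Cmod_0.
  apply Rmult_le_pos. lra. apply Cmod_ge_0.
Qed.

Lemma cderiv_plus (f g : C -> C) (z l m : C) :
  cderiv f z l -> cderiv g z m -> cderiv (fun w => f w + g w)%C z (l + m)%C.
Proof.
  intros Hf Hg eps Heps.
  destruct (Hf (eps / 2)) as [d [Hd H1]]. lra.
  destruct (Hg (eps / 2)) as [e [He H2]]. lra.
  exists (Rmin d e). split. now apply Rmin_pos.
  intros w Hw.
  specialize (H1 w). specialize (H2 w).
  pose proof (Rmin_l d e). pose proof (Rmin_r d e).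
  replace (f w + g w - (f z + g z) - (l + m) * (w - z))%C with
    ((f w - f z - l * (w - z)) + (g w - g z - m * (w - z)))%C by ring.
  eapply Rle_trans. apply Cmod_triangle. lra.
Qed.

Lemma cderiv_comp (f g : C -> C) (z l m : C) :
  cderiv f z l -> cderiv g (f z) m -> cderiv (fun w => g (f w)) z (m * l)%C.
Proof.
  intros Hf Hg eps Heps.
  assert (Hl := Cmod_ge_0 l). assert (Hm := Cmod_ge_0 m).
  (* The entry 1 bounds |f w - f z| by a multiple of |w - z|; the other entry and [e2] leave eps / 2
     each for the inner and the outer remainder. *)
  set (e1 := Rmin 1 (eps / (2 * (1 + Cmod m)))).
  assert (He1 : 0 < e1).
  { apply Rmin_pos. lra. apply Rdiv_lt_0_compat; lra. }
  assert (He1' : e1 <= 1) by apply Rmin_l.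
  assert (He1'' : Cmod m * e1 <= eps / 2).
  { apply Rle_trans with ((1 + Cmod m) * (eps / (2 * (1 + Cmod m)))).
    apply Rmult_le_compat; try lra. apply Rmin_r. right. field. lra. }
  set (e2 := eps / (2 * (2 + Cmod l))).
  assert (He2 : 0 < e2) by (apply Rdiv_lt_0_compat; lra).
  destruct (Hf e1 He1) as [d [Hd H1]].
  destruct (Hg e2 He2) as [e [He H2]].
  destruct (proj1 (C_continuous_eps f z) (cderiv_continuous _ _ _ Hf) e He) as [d' [Hd' H3]].
  exists (Rmin d d'). split. now apply Rmin_pos.
  intros w Hw.
  pose proof (Rmin_l d d'). pose proof (Rmin_r d d').
  specialize (H1 w). specialize (H3 w). specialize (H2 (f w)).
  assert (H1' := H1 ltac:(lra)). assert (H2' := H2 (H3 ltac:(lra))).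
  assert (Hw0 := Cmod_ge_0 (w - z)).
  assert (H4 : Cmod (f w - f z) <= (2 + Cmod l) * Cmod (w - z)).
  { assert (H5 := Cmod_triangle_inv (f w - f z) (l * (w - z))).
    rewrite Cmod_mult in H5. nra. }
  replace (g (f w) - g (f z) - m * l * (w - z))%C with
    ((g (f w) - g (f z) - m * (f w - f z)) + m * (f w - f z - l * (w - z)))%C by ring.
  eapply Rle_trans. apply Cmod_triangle. rewrite Cmod_mult.
  assert (e2 * Cmod (f w - f z) <= eps / 2 * Cmod (w - z)).
  { apply Rle_trans with (e2 * ((2 + Cmod l) * Cmod (w - z))).
    apply Rmult_le_compat_l; lra.
    right. unfold e2. field. lra. }
  assert (Cmod m * Cmod (f w - f z - l * (w - z)) <= eps / 2 * Cmod (w - z)).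
  { apply Rle_trans with (Cmod m * (e1 * Cmod (w - z))).
    apply Rmult_le_compat_l; lra. rewrite <- Rmult_assoc.
    apply Rmult_le_compat_r; lra. }
  lra.
Qed.

Lemma cderiv_scal (c : C) (f : C -> C) (z l : C) :
  cderiv f z l -> cderiv (fun w => c * f w)%C z (c * l)%C.
Proof.
  intros H. apply (cderiv_comp f (fun w => c * w)%C z l c H).
  intros eps Heps. exists 1. split. lra. intros w _.
  replace (c * w - c * f z - c * (w - f z))%C with (RtoC 0) by ring. rewrite Cmod_0.
  apply Rmult_le_pos. lra. apply Cmod_ge_0.
Qed.

Lemma cderiv_minus (f g : C -> C) (z l m : C) :
  cderiv f z l -> cderiv g z m -> cderiv (fun w => f w - g w)%C z (l - m)%C.
Proof.
  intros Hf Hg.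
  apply (cderiv_eq _ _ (l + (-(1)) * m)%C). ring.
  apply cderiv_ext with (fun w => f w + (-(1)) * g w)%C. intros; ring.
  apply cderiv_plus; [easy | now apply cderiv_scal].
Qed.

Lemma cderiv_sqr (z : C) : cderiv (fun w => w * w)%C z (2 * z)%C.
Proof.
  intros eps Heps. exists eps. split. easy. intros w Hw.
  replace (w * w - z * z - 2 * z * (w - z))%C with ((w - z) * (w - z))%C by ring.
  rewrite Cmod_mult. apply Rmult_le_compat_r. apply Cmod_ge_0. lra.
Qed.

(* Polarization reduces products to squares. *)
Lemma cderiv_mult (f g : C -> C) (z l m : C) :
  cderiv f z l -> cderiv g z m ->
  cderiv (fun w => f w * g w)%C z (l * g z + f z * m)%C.
Proof.
  intros Hf Hg.
  assert (H4 : (RtoC 4 <> 0)%C) by (intros H; apply RtoC_inj in H; lra).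
  apply (cderiv_eq _ _ (/ 4 * (2 * (f z + g z) * (l + m) - 2 * (f z - g z) * (l - m)))%C).
  field; exact H4.
  apply cderiv_ext with
    (fun w => / 4 * ((f w + g w) * (f w + g w) - (f w - g w) * (f w - g w)))%C.
  intros; field; exact H4.
  apply cderiv_scal, cderiv_minus.
  - apply (cderiv_comp (fun w => f w + g w)%C (fun w => w * w)%C).
    now apply cderiv_plus. apply cderiv_sqr.
  - apply (cderiv_comp (fun w => f w - g w)%C (fun w => w * w)%C).
    now apply cderiv_minus. apply cderiv_sqr.
Qed.

Lemma cderiv_Cinv (z : C) : z <> 0 -> cderiv Cinv z (- (/ (z * z)))%C.
Proof.
  intros Hz eps Heps.
  assert (Hm := proj1 (Cmod_gt_0 z) Hz).
  set (K := Cmod z * Cmod z * (Cmod z / 2)).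
  assert (HK : 0 < K) by (unfold K; repeat apply Rmult_lt_0_compat; lra).
  exists (Rmin (Cmod z / 2) (eps * K)). split.
  apply Rmin_pos. lra. now apply Rmult_lt_0_compat.
  intros w Hw.
  pose proof (Rmin_l (Cmod z / 2) (eps * K)). pose proof (Rmin_r (Cmod z / 2) (eps * K)).
  assert (Hw' : Cmod z / 2 <= Cmod w).
  { assert (H1 := Cmod_triangle_inv z w). rewrite Cmod_minus_sym in H1. lra. }
  assert (Hw0 : w <> 0) by (apply Cmod_gt_0; lra).
  replace (/ w - / z - - / (z * z) * (w - z))%C with
    ((w - z) * (w - z) / (z * z * w))%C by (field; split; assumption).
  assert (Hzz : (z * z * w <> 0)%C) by (repeat apply Cmult_neq_0; assumption).
  rewrite Cmod_div by assumption. rewrite !Cmod_mult.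
  assert (Hk : K <= Cmod z * Cmod z * Cmod w).
  { unfold K. apply Rmult_le_compat_l. nra. exact Hw'. }
  pose proof (Cmod_ge_0 (w - z)).
  apply Rle_div_l. lra.
  apply Rle_trans with (eps * Cmod (w - z) * K). 2: apply Rmult_le_compat_l; nra.
  nra.
Qed.

Lemma cderiv_inv (f : C -> C) (z l : C) :
  f z <> 0 -> cderiv f z l -> cderiv (fun w => / f w)%C z (- l / (f z * f z))%C.
Proof.
  intros Hz H.
  apply (cderiv_eq _ _ (- (/ (f z * f z)) * l)%C).
  field; exact Hz.
  apply (cderiv_comp f Cinv). exact H. now apply cderiv_Cinv.
Qed.

Lemma cderiv_pow (n : nat) (z : C) :
  cderiv (fun w => w ^ n)%C z (INR n * z ^ (n - 1))%C.
Proof.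
  induction n as [|n IH].
  - apply (cderiv_eq _ _ 0). simpl. ring. apply (cderiv_const 1).
  - apply cderiv_ext with (fun w => w * w ^ n)%C. reflexivity.
    eapply cderiv_eq. 2: apply cderiv_mult; [apply cderiv_id | apply IH].
    replace (S n - 1)%nat with n by lia. rewrite S_INR, RtoC_plus.
    destruct n. simpl. ring.
    replace (S n - 1)%nat with n by lia. rewrite Cpow_S. ring.
Qed.

(** The componentwise form gives access to [auto_derive], the real mean value theorem and the real
    integral; [is_derive_RC_eps] is the norm form that the chain rule needs. *)
Definition is_derive_RC (g : R -> C) (t : R) (d : C) : Prop :=
  is_derive (fun s => Re (g s)) t (Re d) /\ is_derive (fun s => Im (g s)) t (Im d).

Lemma is_derive_eps (f : R -> R) (x l : R) :
  is_derive f x l <->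
  forall eps : R, 0 < eps -> exists del : R, 0 < del /\
    forall y, Rabs (y - x) < del -> Rabs (f y - f x - l * (y - x)) <= eps * Rabs (y - x).
Proof.
  split.
  - intros [_ H] eps Heps.
    specialize (H x (fun P HP => HP) (mkposreal _ Heps)).
    destruct H as [d Hd]. exists d. split. apply cond_pos.
    intros y Hy. specialize (Hd y Hy). simpl in Hd.
    change (Rabs ((f y - f x) - (y - x) * l) <= eps * Rabs (y - x)) in Hd.
    rewrite (Rmult_comm l). exact Hd.
  - intros H. split. apply is_linear_scal_l.
    intros x' Hx'.
    replace x' with x by apply (is_filter_lim_locally_unique x x' Hx').
    intros eps. destruct (H eps (cond_pos eps)) as [d [Hd Hf]].
    exists (mkposreal _ Hd). intros y Hy. specialize (Hf y Hy).
    change (Rabs ((f y - f x) - (y - x) * l) <= eps * Rabs (y - x)).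
    rewrite (Rmult_comm _ l). exact Hf.
Qed.

Lemma is_derive_RC_eps (g : R -> C) (t : R) (d : C) :
  is_derive_RC g t d <->
  forall eps : R, 0 < eps -> exists del : R, 0 < del /\
    forall s, Rabs (s - t) < del ->
      Cmod (g s - g t - d * RtoC (s - t)) <= eps * Rabs (s - t).
Proof.
  assert (ReE : forall s, Re (g s - g t - d * RtoC (s - t)) = Re (g s) - Re (g t) - Re d * (s - t))
    by (intros; unfold Re, Im; simpl; ring).
  assert (ImE : forall s, Im (g s - g t - d * RtoC (s - t)) = Im (g s) - Im (g t) - Im d * (s - t))
    by (intros; unfold Re, Im; simpl; ring).
  split.
  - intros [H1 H2] eps Heps.
    destruct (proj1 (is_derive_eps _ _ _) H1 (eps / 2)) as [d1 [Hd1 F1]]. lra.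
    destruct (proj1 (is_derive_eps _ _ _) H2 (eps / 2)) as [d2 [Hd2 F2]]. lra.
    exists (Rmin d1 d2). split. now apply Rmin_pos.
    intros s Hs. pose proof (Rmin_l d1 d2). pose proof (Rmin_r d1 d2).
    specialize (F1 s ltac:(lra)). specialize (F2 s ltac:(lra)).
    eapply Rle_trans. apply Cmod_le_sum. rewrite ReE, ImE. lra.
  - intros H. split; apply is_derive_eps; intros eps Heps;
      destruct (H eps Heps) as [e [He F]]; exists e; (split; [easy|]); intros s Hs.
    + rewrite <- ReE. eapply Rle_trans. apply re_le_Cmod. now apply F.
    + rewrite <- ImE. eapply Rle_trans. apply im_le_Cmod. now apply F.
Qed.

Lemma cderiv_comp_RC (f : C -> C) (g : R -> C) (t : R) (l d : C) :
  is_derive_RC g t d -> cderiv f (g t) l -> is_derive_RC (fun s => f (g s)) t (l * d)%C.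
Proof.
  intros Hg Hf. apply is_derive_RC_eps. intros eps Heps.
  rewrite is_derive_RC_eps in Hg.
  assert (Hl := Cmod_ge_0 l). assert (Hd := Cmod_ge_0 d).
  set (e1 := Rmin 1 (eps / (2 * (1 + Cmod l)))).
  assert (He1 : 0 < e1).
  { apply Rmin_pos. lra. apply Rdiv_lt_0_compat; lra. }
  assert (He1' : e1 <= 1) by apply Rmin_l.
  assert (He1'' : Cmod l * e1 <= eps / 2).
  { apply Rle_trans with ((1 + Cmod l) * (eps / (2 * (1 + Cmod l)))).
    apply Rmult_le_compat; try lra. apply Rmin_r. right. field. lra. }
  set (e2 := eps / (2 * (2 + Cmod d))).
  assert (He2 : 0 < e2) by (apply Rdiv_lt_0_compat; lra).
  destruct (Hg e1 He1) as [r [Hr H1]].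
  destruct (Hf e2 He2) as [e [He H2]].
  set (r' := Rmin r (e / (2 + Cmod d))).
  assert (Hr' : 0 < r') by (apply Rmin_pos; [easy | apply Rdiv_lt_0_compat; lra]).
  exists r'. split. easy. intros s Hs.
  pose proof (Rmin_l r (e / (2 + Cmod d))). pose proof (Rmin_r r (e / (2 + Cmod d))).
  fold r' in H, H0.
  specialize (H1 s ltac:(lra)).
  pose proof (Rabs_pos (s - t)).
  assert (H4 : Cmod (g s - g t) <= (1 + Cmod d) * Rabs (s - t)).
  { assert (H5 := Cmod_triangle_inv (g s - g t) (d * RtoC (s - t))).
    rewrite Cmod_mult, Cmod_R in H5. nra. }
  assert (H6 : Cmod (g s - g t) < e).
  { apply Rle_lt_trans with ((2 + Cmod d) * Rabs (s - t)). nra.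
    apply Rlt_le_trans with ((2 + Cmod d) * (e / (2 + Cmod d))).
    apply Rmult_lt_compat_l; lra. right. field. lra. }
  specialize (H2 (g s) H6).
  replace (f (g s) - f (g t) - l * d * RtoC (s - t))%C with
    ((f (g s) - f (g t) - l * (g s - g t)) + l * (g s - g t - d * RtoC (s - t)))%C by ring.
  eapply Rle_trans. apply Cmod_triangle. rewrite Cmod_mult.
  assert (e2 * Cmod (g s - g t) <= eps / 2 * Rabs (s - t)).
  { apply Rle_trans with (e2 * ((2 + Cmod d) * Rabs (s - t))).
    apply Rmult_le_compat_l; nra.
    right. unfold e2. field. lra. }
  assert (Cmod l * Cmod (g s - g t - d * RtoC (s - t)) <= eps / 2 * Rabs (s - t)).
  { apply Rle_trans with (Cmod l * (e1 * Rabs (s - t))).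
    apply Rmult_le_compat_l; lra. rewrite <- Rmult_assoc.
    apply Rmult_le_compat_r; lra. }
  lra.
Qed.

Lemma is_derive_RC_line (a b : C) (t : R) :
  is_derive_RC (fun s => a + RtoC s * b)%C t b.
Proof.
  apply is_derive_RC_eps. intros eps Heps. exists 1. split. lra. intros s _.
  replace (a + RtoC s * b - (a + RtoC t * b) - b * RtoC (s - t))%C with (RtoC 0).
  rewrite Cmod_0. apply Rmult_le_pos. lra. apply Rabs_pos.
  rewrite RtoC_minus. ring.
Qed.

(** An exact mean value point need not exist for complex values, so the real theorem is applied to
    the component of [g] in the direction of its total increment [K]. *)
Lemma mean_value_RC (g dg : R -> C) (B : R) :
  (forall t, 0 <= t <= 1 -> is_derive_RC g t (dg t)) ->
  (forall t, 0 <= t <= 1 -> Cmod (dg t) <= B) ->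
  Cmod (g 1 - g 0) <= B.
Proof.
  intros Hg HB. set (K := (g 1 - g 0)%C).
  destruct (Req_dec (Cmod K) 0) as [H0|H0].
  { rewrite H0. eapply Rle_trans. 2: apply (HB 0); lra. apply Cmod_ge_0. }
  assert (HK : 0 < Cmod K) by (pose proof (Cmod_ge_0 K); lra).
  set (phi := fun t => Re K * Re (g t) + Im K * Im (g t)).
  set (dphi := fun t => Re K * Re (dg t) + Im K * Im (dg t)).
  assert (Hphi : forall t, 0 <= t <= 1 -> is_derive phi t (dphi t)).
  { intros t Ht. destruct (Hg t Ht) as [H1 H2].
    apply (is_derive_plus (fun t => Re K * Re (g t)) (fun t => Im K * Im (g t)));
      apply is_derive_scal; assumption. }
  destruct (MVT_gen phi 0 1 dphi) as [c [Hc Hm]].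
  - intros x Hx. rewrite Rmin_left, Rmax_right in Hx by lra. apply Hphi. lra.
  - intros x Hx. rewrite Rmin_left, Rmax_right in Hx by lra.
    apply continuity_pt_filterlim. apply (ex_derive_continuous phi x).
    exists (dphi x). apply Hphi. lra.
  - rewrite Rmin_left, Rmax_right in Hc by lra.
    specialize (HB c Hc).
    assert (E : phi 1 - phi 0 = Cmod K * Cmod K).
    { rewrite Cmod_sq. unfold phi, K. unfold Re, Im; simpl. ring. }
    assert (F : dphi c <= Cmod K * Cmod (dg c)).
    { unfold dphi.
      replace (Re K * Re (dg c) + Im K * Im (dg c)) with (Re (Cconj K * dg c))
        by (unfold Re, Im; simpl; ring).
      rewrite <- (Cmod_conj K), <- Cmod_mult.
      eapply Rle_trans. apply Rle_abs. apply re_le_Cmod. }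
    apply Rmult_le_reg_l with (Cmod K). easy. nra.
Qed.

Lemma mean_value_segment (f df : C -> C) (a b : C) (B : R) :
  (forall t, 0 <= t <= 1 -> cderiv f (a + RtoC t * (b - a))%C (df (a + RtoC t * (b - a))%C)) ->
  (forall t, 0 <= t <= 1 -> Cmod (df (a + RtoC t * (b - a))%C) <= B) ->
  Cmod (f b - f a) <= B * Cmod (b - a).
Proof.
  intros Hf HB.
  assert (H := mean_value_RC (fun t => f (a + RtoC t * (b - a))%C)
    (fun t => df (a + RtoC t * (b - a)) * (b - a))%C (B * Cmod (b - a))).
  simpl in H.
  replace (a + 1 * (b - a))%C with b in H by ring.
  replace (a + 0 * (b - a))%C with a in H by ring.
  apply H.
  - intros t Ht. apply cderiv_comp_RC. apply is_derive_RC_line. now apply Hf.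
  - intros t Ht. rewrite Cmod_mult. apply Rmult_le_compat_r. apply Cmod_ge_0. now apply HB.
Qed.

(** * Complex exponential and logarithm *)

Lemma Cexp_plus (a b : C) : Cexp (a + b) = (Cexp a * Cexp b)%C.
Proof.
  unfold Cexp, Cmult, Re, Im; simpl. rewrite exp_plus, cos_plus, sin_plus. f_equal; ring.
Qed.

Lemma Cexp_0 : Cexp 0 = 1.
Proof. unfold Cexp, Re, Im; simpl. rewrite exp_0, cos_0, sin_0. unfold RtoC. f_equal; ring. Qed.

Lemma Cmod_Cexp (z : C) : Cmod (Cexp z) = exp (Re z).
Proof.
  unfold Cmod, Cexp; cbn [fst snd].
  replace ((exp (Re z) * cos (Im z)) ^ 2 + (exp (Re z) * sin (Im z)) ^ 2)
    with (exp (Re z) ^ 2 * ((sin (Im z))² + (cos (Im z))²)) by (unfold Rsqr; ring).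
  rewrite sin2_cos2, Rmult_1_r. apply sqrt_pow2. left. apply exp_pos.
Qed.

Lemma Cexp_neq_0 (z : C) : Cexp z <> 0.
Proof. apply Cmod_gt_0. rewrite Cmod_Cexp. apply exp_pos. Qed.

Lemma Cexp_opp (z : C) : Cexp (- z) = (/ Cexp z)%C.
Proof.
  assert (H := Cexp_neq_0 z).
  assert (H1 : (Cexp (- z) * Cexp z)%C = 1).
  { rewrite <- Cexp_plus. rewrite <- Cexp_0. f_equal. ring. }
  transitivity (Cexp (- z) * Cexp z * / Cexp z)%C. field. exact H. rewrite H1. ring.
Qed.

Lemma Cexp_pow (z : C) (n : nat) : (Cexp z ^ n)%C = Cexp (INR n * z).
Proof.
  induction n as [|n IH].
  - simpl. rewrite <- Cexp_0. f_equal. ring.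
  - rewrite Cpow_S, IH, <- Cexp_plus. f_equal. rewrite S_INR, RtoC_plus. ring.
Qed.

Lemma is_derive_RC_Cexp_ray (w : C) (t : R) :
  is_derive_RC (fun s => Cexp (RtoC s * w)) t (w * Cexp (RtoC t * w))%C.
Proof.
  destruct w as [a b].
  split; unfold Cexp, Cmult, RtoC, Re, Im; simpl; auto_derive; trivial; unfold Rminus; ring.
Qed.

Lemma exp_mult_le (t x y : R) : 0 <= t <= 1 -> x <= y -> 0 <= y -> exp (t * x) <= exp y.
Proof.
  intros Ht Hxy Hy. destruct (Rle_lt_or_eq_dec (t * x) y) as [H|H].
  nra. left. now apply exp_increasing. right. now rewrite H.
Qed.

Lemma Re_scal (t : R) (w : C) : Re (RtoC t * w) = t * Re w.
Proof. unfold Re; simpl. ring. Qed.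

Lemma Cexp_minus_1 (w : C) : Cmod (Cexp w - 1) <= Cmod w * exp (Cmod w).
Proof.
  assert (H := mean_value_RC (fun s => Cexp (RtoC s * w)) (fun t => w * Cexp (RtoC t * w))%C
    (Cmod w * exp (Cmod w))).
  simpl in H. rewrite Cmult_1_l, Cmult_0_l, Cexp_0 in H. apply H.
  - intros t _. apply is_derive_RC_Cexp_ray.
  - intros t Ht. rewrite Cmod_mult, Cmod_Cexp, Re_scal.
    apply Rmult_le_compat_l. apply Cmod_ge_0. apply exp_mult_le; try easy.
    eapply Rle_trans. apply Rle_abs. apply re_le_Cmod. apply Cmod_ge_0.
Qed.

(** The derivative w (Cexp (s w) - 1) of Cexp (s w) - s w is again controlled by [Cexp_minus_1]; the
    factor 1/2 of Taylor's formula is given up. *)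
Lemma Cexp_taylor (w : C) : Cmod (Cexp w - 1 - w) <= Cmod w * Cmod w * exp (Cmod w).
Proof.
  assert (H := mean_value_RC (fun s => Cexp (RtoC s * w) - RtoC s * w)%C
    (fun t => w * (Cexp (RtoC t * w) - 1))%C (Cmod w * Cmod w * exp (Cmod w))).
  simpl in H. rewrite Cmult_1_l, Cmult_0_l, Cexp_0 in H.
  replace (Cexp w - 1 - w)%C with (Cexp w - w - (1 - 0))%C by ring. apply H.
  - intros t _. destruct (is_derive_RC_Cexp_ray w t) as [H1 H2].
    split.
    + replace (Re (w * (Cexp (t * w) - 1))) with (Re (w * Cexp (t * w)) - Re w)
        by (unfold Re; simpl; ring).
      apply (is_derive_minus (fun s => Re (Cexp (RtoC s * w))) (fun s => Re (RtoC s * w))).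
      exact H1. unfold Re; simpl. auto_derive; trivial. ring.
    + replace (Im (w * (Cexp (t * w) - 1))) with (Im (w * Cexp (t * w)) - Im w)
        by (unfold Im; simpl; ring).
      apply (is_derive_minus (fun s => Im (Cexp (RtoC s * w))) (fun s => Im (RtoC s * w))).
      exact H2. unfold Im; simpl. auto_derive; trivial. ring.
  - intros t Ht. rewrite Cmod_mult, Rmult_assoc.
    apply Rmult_le_compat_l. apply Cmod_ge_0.
    eapply Rle_trans. apply Cexp_minus_1. rewrite Cmod_mult, Cmod_R, Rabs_pos_eq by easy.
    pose proof (Cmod_ge_0 w).
    apply Rmult_le_compat; try nra. left; apply exp_pos. apply exp_mult_le; lra.
Qed.

Lemma cderiv_Cexp (z : C) : cderiv Cexp z (Cexp z).
Proof.
  intros eps Heps.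
  assert (Hz := proj1 (Cmod_gt_0 _) (Cexp_neq_0 z)).
  set (d := Rmin 1 (eps / (Cmod (Cexp z) * exp 1))).
  assert (He := exp_pos 1).
  exists d. split. apply Rmin_pos. lra. apply Rdiv_lt_0_compat. easy. now apply Rmult_lt_0_compat.
  intros w Hw.
  pose proof (Rmin_l 1 (eps / (Cmod (Cexp z) * exp 1))).
  pose proof (Rmin_r 1 (eps / (Cmod (Cexp z) * exp 1))). fold d in H, H0.
  replace (Cexp w - Cexp z - Cexp z * (w - z))%C with
    (Cexp z * (Cexp (w - z) - 1 - (w - z)))%C.
  2:{ replace (Cexp w) with (Cexp (z + (w - z))) by (f_equal; ring).
      rewrite Cexp_plus. ring. }
  rewrite Cmod_mult.
  assert (H1 := Cexp_taylor (w - z)). assert (H2 := Cmod_ge_0 (w - z)).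
  apply Rle_trans with (Cmod (Cexp z) * (Cmod (w - z) * Cmod (w - z) * exp 1)).
  { apply Rmult_le_compat_l. lra. eapply Rle_trans. apply H1.
    apply Rmult_le_compat_l. nra.
    replace (Cmod (w - z)) with (1 * Cmod (w - z)) by ring. apply exp_mult_le; lra. }
  replace (Cmod (Cexp z) * (Cmod (w - z) * Cmod (w - z) * exp 1)) with
    (Cmod (Cexp z) * exp 1 * Cmod (w - z) * Cmod (w - z)) by ring.
  apply Rmult_le_compat_r. lra.
  apply Rle_trans with (Cmod (Cexp z) * exp 1 * (eps / (Cmod (Cexp z) * exp 1))).
  apply Rmult_le_compat_l. nra. lra. right. field. split; lra.
Qed.

(** The [atan] formula is the principal branch on the right half-plane only. That suffices: the
    arguments will be 1 - w with |w| < 1, functions of positive real part, or points near 1. It also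
    makes the bound PI / 2 on the imaginary part unconditional. *)
Definition Clog (z : C) : C := (ln (Cmod z), atan (Im z / Re z)).

Lemma Cmod_Re_pos (z : C) : 0 < Re z -> 0 < Cmod z.
Proof. intros H. eapply Rlt_le_trans. apply H. eapply Rle_trans. apply Rle_abs. apply re_le_Cmod. Qed.

Lemma Cexp_Clog (z : C) : 0 < Re z -> Cexp (Clog z) = z.
Proof.
  intros Hz. assert (Hm := Cmod_Re_pos z Hz).
  assert (Hq : sqrt (1 + (Im z / Re z)²) = Cmod z / Re z).
  { replace (1 + (Im z / Re z)²) with ((Cmod z / Re z) * (Cmod z / Re z)).
    apply sqrt_square. apply Rdiv_le_0_compat; lra.
    replace (Cmod z / Re z * (Cmod z / Re z)) with (Cmod z * Cmod z / (Re z * Re z)) by (field; lra).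
    rewrite Cmod_sq. unfold Rsqr. field. lra. }
  change (Cexp (Clog z)) with (exp (ln (Cmod z)) * cos (atan (Im z / Re z)),
    exp (ln (Cmod z)) * sin (atan (Im z / Re z))).
  rewrite exp_ln by easy. rewrite cos_atan, sin_atan, Hq.
  destruct z as [x y]. unfold Re, Im in *; cbn [fst snd] in *. f_equal; field; split; lra.
Qed.

Lemma Re_Clog (z : C) : Re (Clog z) = ln (Cmod z).
Proof. reflexivity. Qed.

Lemma Im_Clog_bound (z : C) : Rabs (Im (Clog z)) <= PI / 2.
Proof.
  unfold Clog, Im at 1; cbn [snd]. destruct (atan_bound (Im z / Re z)). apply Rabs_le. lra.
Qed.

Lemma Clog_1 : Clog 1 = 0.
Proof.
  unfold Clog. rewrite Cmod_1, ln_1. unfold Re, Im; simpl.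
  replace (0 / 1) with 0 by field. now rewrite atan_0.
Qed.

Lemma continuous_Re (z : C) : continuous (T := C_UniformSpace) (U := R_UniformSpace) Re z.
Proof. apply continuous_fst. Qed.

Lemma continuous_Im (z : C) : continuous (T := C_UniformSpace) (U := R_UniformSpace) Im z.
Proof. apply continuous_snd. Qed.

Lemma continuous_Cmod (z : C) : continuous (T := C_UniformSpace) (U := R_UniformSpace) Cmod z.
Proof.
  apply filterlim_locally. intros eps.
  assert (Hs : 0 < eps / sqrt 2) by (apply Rdiv_lt_0_compat; [apply cond_pos | apply Rlt_sqrt2_0]).
  exists (mkposreal _ Hs). intros w Hb.
  apply C_NormedModule_mixin_compat2 in Hb. simpl in Hb.
  replace (sqrt 2 * (eps / sqrt 2)) with (pos eps) in Hb
    by (field; apply Rgt_not_eq, Rlt_sqrt2_0).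
  change (Cmod (w - z) < eps) in Hb.
  change (Rabs (Cmod w - Cmod z) < eps).
  apply Rle_lt_trans with (2 := Hb). apply Rabs_le.
  pose proof (Cmod_triangle_inv w z). pose proof (Cmod_triangle_inv z w).
  rewrite (Cmod_minus_sym z w) in H0. lra.
Qed.

Lemma continuous_Clog (z : C) :
  0 < Re z -> continuous_CC Clog z.
Proof.
  intros Hz. assert (Hm := Cmod_Re_pos z Hz).
  apply (continuous_comp_2 (U := C_UniformSpace) (V := R_UniformSpace) (W := R_UniformSpace)
    (X := C_UniformSpace) (fun w => ln (Cmod w)) (fun w => atan (Im w / Re w)) (fun x y => (x, y))).
  - apply (continuous_comp (U := C_UniformSpace) Cmod ln). apply continuous_Cmod.
    apply (ex_derive_continuous ln). now auto_derive.
  - apply (continuous_comp (U := C_UniformSpace) (fun w => Im w / Re w) atan).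
    + apply (continuous_mult (U := C_UniformSpace) (K := R_AbsRing) Im (fun w => / Re w)).
      apply continuous_Im.
      apply (continuous_comp (U := C_UniformSpace) Re Rinv). apply continuous_Re.
      apply continuity_pt_filterlim, continuity_pt_inv. apply continuity_pt_id. lra.
    + apply continuity_pt_filterlim. apply derivable_continuous_pt, derivable_pt_atan.
  - apply (continuous_ext (fun p => p)). now intros []. apply continuous_id.
Qed.

(** Write w = z Cexp L with L = Clog w - Clog z. Continuity of [Clog] makes L small, and the Taylor
    bound of [Cexp] at 0 then yields the one for its inverse. *)
Lemma cderiv_Clog (z : C) : 0 < Re z -> cderiv Clog z (/ z)%C.
Proof.
  intros Hz eps Heps. assert (Hm := Cmod_Re_pos z Hz).
  assert (Hz0 : z <> 0) by now apply Cmod_gt_0.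
  assert (He := exp_pos 1).
  set (K := Cmod z * Cmod z / (4 * exp 1)).
  assert (HK : 0 < K) by (unfold K; apply Rdiv_lt_0_compat; nra).
  (* For |L| < [d1] the Taylor remainder |L|^2 exp 1 is at most |L| / 2, whence |L| <= 2 |Cexp L -
     1|. *)
  set (d1 := / (2 * exp 1)).
  assert (Hd1 : 0 < d1) by (apply Rinv_0_lt_compat; lra).
  assert (Hd1' : d1 * exp 1 = / 2) by (unfold d1; field; lra).
  assert (He2 : 2 < exp 1) by (pose proof (exp_ineq1 1); lra).
  destruct (proj1 (C_continuous_eps _ _) (continuous_Clog z Hz) d1 Hd1) as [r [Hr Hc]].
  exists (Rmin r (Rmin (Re z) (eps * K))). split.
  { repeat apply Rmin_pos; try easy. now apply Rmult_lt_0_compat. }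
  intros w Hw.
  pose proof (Rmin_l r (Rmin (Re z) (eps * K))). pose proof (Rmin_r r (Rmin (Re z) (eps * K))).
  pose proof (Rmin_l (Re z) (eps * K)). pose proof (Rmin_r (Re z) (eps * K)).
  assert (Hwr : 0 < Re w).
  { assert (G := re_le_Cmod (z - w)). rewrite Cmod_minus_sym in G.
    assert (G2 := Rle_abs (Re (z - w))).
    replace (Re (z - w)) with (Re z - Re w) in G2 at 1 by (unfold Re; simpl; ring). lra. }
  specialize (Hc w ltac:(lra)).
  set (L := (Clog w - Clog z)%C) in *.
  assert (EL : w = (z * Cexp L)%C).
  { rewrite <- (Cexp_Clog w Hwr), <- (Cexp_Clog z Hz) at 1. rewrite <- Cexp_plus. f_equal.
    unfold L. ring. }
  assert (HL := Cmod_ge_0 L).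
  assert (T : Cmod (Cexp L - 1 - L) <= Cmod L * Cmod L * exp 1).
  { eapply Rle_trans. apply Cexp_taylor. apply Rmult_le_compat_l. nra.
    left. apply exp_increasing. nra. }
  assert (T2 : Cmod L <= 2 * (Cmod (w - z) / Cmod z)).
  { rewrite <- Cmod_div by easy.
    replace ((w - z) / z)%C with (Cexp L - 1)%C by (rewrite EL; field; easy).
    assert (G := Cmod_triangle_inv L (- (Cexp L - 1 - L))%C).
    rewrite Cmod_opp in G.
    replace (L - - (Cexp L - 1 - L))%C with (Cexp L - 1)%C in G by ring. nra. }
  replace (L - / z * (w - z))%C with (- (Cexp L - 1 - L))%C
    by (rewrite EL; field; easy).
  rewrite Cmod_opp. eapply Rle_trans. apply T.
  assert (Hw0 := Cmod_ge_0 (w - z)).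
  apply Rle_trans with ((2 * (Cmod (w - z) / Cmod z)) * (2 * (Cmod (w - z) / Cmod z)) * exp 1).
  apply Rmult_le_compat_r. lra. apply Rmult_le_compat; lra.
  replace (2 * (Cmod (w - z) / Cmod z) * (2 * (Cmod (w - z) / Cmod z)) * exp 1) with
    (Cmod (w - z) / K * Cmod (w - z)) by (unfold K; field; lra).
  apply Rmult_le_compat_r. easy.
  apply Rle_div_l. easy. lra.
Qed.

Definition cis (t : R) : C := (cos t, sin t).

Lemma Cexp_Ci (t : R) : Cexp (Ci * RtoC t) = cis t.
Proof.
  unfold Cexp, cis, Re, Im; simpl.
  replace (0 * t - 1 * 0) with 0 by ring. replace (0 * 0 + 1 * t) with t by ring.
  rewrite exp_0. f_equal; ring.
Qed.

Lemma Cmod_cis (t : R) : Cmod (cis t) = 1.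
Proof.
  rewrite <- Cexp_Ci, Cmod_Cexp. unfold Re; simpl.
  replace (0 * t - 1 * 0) with 0 by ring. apply exp_0.
Qed.

Lemma cis_plus (a b : R) : cis (a + b) = (cis a * cis b)%C.
Proof. unfold cis, Cmult; simpl. rewrite cos_plus, sin_plus. f_equal; ring. Qed.

Lemma cis_0 : cis 0 = 1.
Proof. unfold cis. now rewrite cos_0, sin_0. Qed.

Lemma cis_2PI (t : R) : cis (t + 2 * PI) = cis t.
Proof.
  unfold cis. rewrite cos_plus, sin_plus, cos_2PI, sin_2PI. f_equal; ring.
Qed.

Lemma is_derive_RC_cis (t : R) : is_derive_RC cis t (Ci * cis t)%C.
Proof. split; unfold cis, Re, Im; simpl; auto_derive; trivial; ring. Qed.

Lemma cis_lipschitz (a b : R) : Cmod (cis a - cis b) <= Rabs (a - b).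
Proof.
  assert (E : (cis a - cis b)%C = (cis b * (Cexp (Ci * RtoC (a - b)) - 1))%C).
  { rewrite Cexp_Ci. replace (cis a) with (cis (b + (a - b))) by (f_equal; ring).
    rewrite cis_plus. ring. }
  rewrite E, Cmod_mult, Cmod_cis, Rmult_1_l.
  assert (H := mean_value_RC (fun s => Cexp (RtoC s * (Ci * RtoC (a - b))))
    (fun t => (Ci * RtoC (a - b)) * Cexp (RtoC t * (Ci * RtoC (a - b))))%C (Rabs (a - b))).
  simpl in H. rewrite Cmult_1_l, Cmult_0_l, Cexp_0 in H. apply H.
  - intros t _. apply is_derive_RC_Cexp_ray.
  - intros t _. rewrite !Cmod_mult, Cmod_Ci, Cmod_R, Cmod_Cexp.
    replace (Re (t * (Ci * RtoC (a - b)))) with 0 by (unfold Re; simpl; ring).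
    rewrite exp_0. lra.
Qed.

(** * Cauchy's formula on circles *)

Lemma continuous_C_pair {T : UniformSpace} (f : T -> C) (x : T) :
  continuous (U := R_UniformSpace) (fun t => Re (f t)) x ->
  continuous (U := R_UniformSpace) (fun t => Im (f t)) x ->
  continuous (U := C_UniformSpace) f x.
Proof.
  intros H1 H2.
  apply (continuous_ext (U := C_UniformSpace) (fun t => (Re (f t), Im (f t)))).
  { intros t. now destruct (f t). }
  apply (continuous_comp_2 (V := R_UniformSpace) (W := R_UniformSpace) (X := C_UniformSpace)
    (fun t => Re (f t)) (fun t => Im (f t)) (fun x y => (x, y))); try assumption.
  apply (continuous_ext (fun p => p)). now intros []. apply continuous_id.
Qed.

Lemma continuous_Re_comp {T : UniformSpace} (f : T -> C) (x : T) :
  continuous (U := C_UniformSpace) f x -> continuous (U := R_UniformSpace) (fun t => Re (f t)) x.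
Proof. intros H. apply (continuous_comp (V := C_UniformSpace) f Re). exact H. apply continuous_Re. Qed.

Lemma continuous_Im_comp {T : UniformSpace} (f : T -> C) (x : T) :
  continuous (U := C_UniformSpace) f x -> continuous (U := R_UniformSpace) (fun t => Im (f t)) x.
Proof. intros H. apply (continuous_comp (V := C_UniformSpace) f Im). exact H. apply continuous_Im. Qed.

Lemma continuous_Cmult {T : UniformSpace} (f g : T -> C) (x : T) :
  continuous (U := C_UniformSpace) f x -> continuous (U := C_UniformSpace) g x ->
  continuous (U := C_UniformSpace) (fun t => f t * g t)%C x.
Proof.
  intros Hf Hg.
  assert (H1 := continuous_Re_comp f x Hf). assert (H2 := continuous_Im_comp f x Hf).
  assert (H3 := continuous_Re_comp g x Hg). assert (H4 := continuous_Im_comp g x Hg).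
  apply continuous_C_pair.
  - apply (continuous_minus (V := R_NormedModule)
      (fun t => Re (f t) * Re (g t)) (fun t => Im (f t) * Im (g t)));
      apply (continuous_mult (K := R_AbsRing)); assumption.
  - apply (continuous_plus (V := R_NormedModule)
      (fun t => Re (f t) * Im (g t)) (fun t => Im (f t) * Re (g t)));
      apply (continuous_mult (K := R_AbsRing)); assumption.
Qed.

Lemma continuous_Cplus {T : UniformSpace} (f g : T -> C) (x : T) :
  continuous (U := C_UniformSpace) f x -> continuous (U := C_UniformSpace) g x ->
  continuous (U := C_UniformSpace) (fun t => f t + g t)%C x.
Proof.
  intros Hf Hg.
  assert (H1 := continuous_Re_comp f x Hf). assert (H2 := continuous_Im_comp f x Hf).
  assert (H3 := continuous_Re_comp g x Hg). assert (H4 := continuous_Im_comp g x Hg).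
  apply continuous_C_pair.
  - apply (continuous_plus (V := R_NormedModule) (fun t => Re (f t)) (fun t => Re (g t))); assumption.
  - apply (continuous_plus (V := R_NormedModule) (fun t => Im (f t)) (fun t => Im (g t))); assumption.
Qed.

Lemma continuous_Cinv (z : C) :
  z <> 0 -> continuous_CC Cinv z.
Proof. intros H. eapply cderiv_continuous, cderiv_Cinv, H. Qed.

Lemma is_derive_RC_continuous (g : R -> C) (t : R) (d : C) :
  is_derive_RC g t d -> continuous_RC g t.
Proof.
  intros [H1 H2]. apply continuous_C_pair; apply (ex_derive_continuous (V := R_NormedModule)); eexists; eassumption.
Qed.

Lemma continuous_cis (t : R) : continuous_RC cis t.
Proof. eapply is_derive_RC_continuous, is_derive_RC_cis. Qed.

Lemma continuous_circle (r t : R) :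
  continuous_RC (fun s => RtoC r * cis s)%C t.
Proof. apply continuous_Cmult. apply continuous_const. apply continuous_cis. Qed.

Lemma is_derive_RC_circle (r t : R) :
  is_derive_RC (fun s => RtoC r * cis s)%C t (Ci * (RtoC r * cis t))%C.
Proof. split; unfold cis, Re, Im; simpl; auto_derive; trivial; ring. Qed.

Lemma Cmod_circle (r t : R) : 0 <= r -> Cmod (RtoC r * cis t) = r.
Proof. intros H. rewrite Cmod_mult, Cmod_cis, Cmod_R, Rabs_pos_eq; lra. Qed.

Lemma ex_RInt_continuous_all (f : R -> R) (a b : R) :
  (forall t, continuous_RR f t) -> ex_RInt f a b.
Proof. intros H. apply (ex_RInt_continuous (V := R_CompleteNormedModule)). intros; apply H. Qed.

(** Real integrals suffice for contour integrals: differentiating along the circle brings out a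
    factor [Ci], so the real parts to be integrated are imaginary parts of derivatives of periodic
    functions. *)
Lemma RInt_Im_derive_periodic (g dg : R -> C) :
  (forall t, is_derive_RC g t (dg t)) ->
  (forall t, continuous_RC dg t) ->
  g (2 * PI) = g 0 ->
  RInt (fun t => Im (dg t)) 0 (2 * PI) = 0.
Proof.
  intros Hd Hc Hp.
  rewrite (is_RInt_unique (V := R_CompleteNormedModule) _ _ _ (minus (Im (g (2 * PI))) (Im (g 0)))).
  rewrite Hp. apply Rminus_diag_eq. reflexivity.
  apply (is_RInt_derive (V := R_CompleteNormedModule) (fun t => Im (g t))).
  - intros x _. apply Hd.
  - intros x _. apply continuous_Im_comp, Hc.
Qed.

Lemma circle_period (r : R) : (RtoC r * cis (2 * PI) = RtoC r * cis 0)%C.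
Proof. replace (2 * PI) with (0 + 2 * PI) by ring. now rewrite cis_2PI. Qed.

(** * Cauchy's formula by contracting the circle to the point [a] *)

Section Cauchy.

Variables (h dh : C -> C) (r : R) (a : C).
Hypothesis Hh : forall z, Cmod z < 1 -> cderiv h z (dh z).
Hypothesis Hdh : forall z, Cmod z < 1 ->
  continuous_CC dh z.
Hypothesis Har : Cmod a < r.
Hypothesis Hr : r < 1.

Let z (t : R) : C := (RtoC r * cis t)%C.
Let pt (s t : R) : C := (a + RtoC s * (z t - a))%C.

Lemma cauchy_z_mod (t : R) : Cmod (z t) = r.
Proof. apply Cmod_circle. pose proof (Cmod_ge_0 a). lra. Qed.

Lemma cauchy_za (t : R) : (z t - a <> 0)%C.
Proof.
  apply Cmod_gt_0. pose proof (Cmod_triangle_inv (z t) a). rewrite cauchy_z_mod in H. lra.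
Qed.

(** Differentiating under the integral needs a neighbourhood of each s0 in [0, 1], the ends
    included. As |z - a| < 2 and the segment from a to z stays in |w| <= r, a margin (1 - r) / 2 in
    s does not leave the disk. *)
Lemma cauchy_pt_mod (s0 s t : R) :
  0 <= s0 <= 1 -> Rabs (s - s0) < (1 - r) / 2 -> Cmod (pt s t) < 1.
Proof.
  intros Hs0 Hs.
  assert (E : pt s t = (RtoC (1 - s0) * a + RtoC s0 * z t + RtoC (s - s0) * (z t - a))%C).
  { unfold pt. rewrite !RtoC_minus. ring. }
  rewrite E. assert (Hz := cauchy_z_mod t). pose proof (Cmod_ge_0 a).
  eapply Rle_lt_trans. apply Cmod_triangle.
  assert (H1 : Cmod (RtoC (1 - s0) * a + RtoC s0 * z t) <= r).
  { eapply Rle_trans. apply Cmod_triangle.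
    rewrite !Cmod_mult, !Cmod_R, !Rabs_pos_eq by lra. rewrite Hz. nra. }
  rewrite Cmod_mult, Cmod_R.
  assert (H2 := Cmod_triangle_minus (z t) a). rewrite Hz in H2.
  pose proof (Rabs_pos (s - s0)). pose proof (Cmod_ge_0 (z t - a)). nra.
Qed.

Lemma cauchy_pt_mod' (s t : R) : 0 <= s <= 1 -> Cmod (pt s t) < 1.
Proof.
  intros Hs. apply (cauchy_pt_mod s); try easy.
  replace (s - s) with 0 by ring. rewrite Rabs_R0. lra.
Qed.

Lemma cauchy_pt_continuous (s t : R) :
  continuous (T := prod_UniformSpace R_UniformSpace R_UniformSpace) (U := C_UniformSpace)
    (fun p => pt (fst p) (snd p)) (s, t).
Proof.
  unfold pt. apply continuous_Cplus. apply continuous_const.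
  apply continuous_Cmult.
  - apply (continuous_comp (V := R_UniformSpace) (fun p : R * R => fst p) RtoC).
    apply continuous_fst.
    apply continuous_C_pair. apply continuous_id. apply continuous_const.
  - apply continuous_Cplus. 2: apply continuous_const.
    apply (continuous_comp (V := R_UniformSpace) (fun p : R * R => snd p) z).
    apply continuous_snd. apply continuous_circle.
Qed.

Lemma is_derive_RC_pt_t (s t : R) : is_derive_RC (pt s) t (RtoC s * (Ci * z t))%C.
Proof.
  assert (H : cderiv (fun w => a + RtoC s * (w - a))%C (z t) (0 + RtoC s * (1 - 0))%C).
  { apply cderiv_plus. apply cderiv_const. apply cderiv_scal. apply cderiv_minus.
    apply cderiv_id. apply cderiv_const. }
  assert (H2 := cderiv_comp_RC _ _ _ _ _ (is_derive_RC_circle r t) H).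
  replace (RtoC s * (Ci * z t))%C with ((0 + RtoC s * (1 - 0)) * (Ci * (RtoC r * cis t)))%C.
  exact H2. unfold z. ring.
Qed.

Lemma cauchy_continuous_t (s t : R) :
  0 <= s <= 1 ->
  continuous_RC (fun t => dh (pt s t)) t.
Proof.
  intros Hs. apply (continuous_comp (V := C_UniformSpace) (pt s) dh).
  eapply is_derive_RC_continuous, is_derive_RC_pt_t.
  apply Hdh. now apply cauchy_pt_mod'.
Qed.

(** Up to the factor s, the integrand is the t-derivative of the periodic function h (pt s t). At s
    = 0 this factor cannot be removed, but there [dh] is frozen at [a] and dh a * z t has the
    primitive required. *)
Lemma cauchy_inner_zero (s : R) :
  0 <= s <= 1 -> RInt (fun t => Re (dh (pt s t) * z t)) 0 (2 * PI) = 0.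
Proof.
  intros Hs. destruct (Req_dec s 0) as [->|H0].
  - transitivity (RInt (fun t => Im (dh a * (Ci * z t))) 0 (2 * PI)).
    2: apply (RInt_Im_derive_periodic (fun t => dh a * z t)%C).
    + apply RInt_ext. intros t _. replace (pt 0 t) with a by (unfold pt; ring).
      unfold Re, Im; simpl. ring.
    + intros t. apply (cderiv_comp_RC (fun w => dh a * w)%C). apply is_derive_RC_circle.
      apply (cderiv_eq _ _ (dh a * 1)%C). ring. apply cderiv_scal, cderiv_id.
    + intros t. apply continuous_Cmult. apply continuous_const.
      apply continuous_Cmult. apply continuous_const. apply continuous_circle.
    + unfold z. now rewrite circle_period.
  - assert (E : RInt (fun t => Im (dh (pt s t) * (RtoC s * (Ci * z t)))) 0 (2 * PI) = 0).
    { apply (RInt_Im_derive_periodic (fun t => h (pt s t))).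
      - intros t. apply cderiv_comp_RC. apply is_derive_RC_pt_t.
        apply Hh. now apply cauchy_pt_mod'.
      - intros t. apply continuous_Cmult. now apply cauchy_continuous_t.
        apply continuous_Cmult. apply continuous_const.
        apply continuous_Cmult. apply continuous_const. apply continuous_circle.
      - unfold pt, z. now rewrite circle_period. }
    apply Rmult_eq_reg_l with s. 2: easy. rewrite Rmult_0_r. apply eq_trans with (2 := E).
    change (scal s (RInt (fun t => Re (dh (pt s t) * z t)) 0 (2 * PI)) =
      RInt (fun t => Im (dh (pt s t) * (RtoC s * (Ci * z t)))) 0 (2 * PI)).
    rewrite <- (RInt_scal (V := R_CompleteNormedModule)).
    + apply RInt_ext. intros t _. unfold scal; simpl. unfold mult; simpl.
      unfold Re, Im; simpl. ring.
    + apply ex_RInt_continuous_all. intros t. apply continuous_Re_comp, continuous_Cmult.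
      now apply cauchy_continuous_t. apply continuous_circle.
Qed.

Let F (s t : R) : R := Re (h (pt s t) * (z t / (z t - a))).

(** The kernel z / (z - a) cancels the speed z - a of the contraction, which leaves an integrand
    without a pole. *)
Lemma cauchy_F_derive (s0 s t : R) :
  0 <= s0 <= 1 -> Rabs (s - s0) < (1 - r) / 2 ->
  is_derive (fun u => F u t) s (Re (dh (pt s t) * z t)).
Proof.
  intros Hs0 Hs. assert (Hza := cauchy_za t).
  assert (H1 := cderiv_comp_RC h (fun u => pt u t) s _ _
    (is_derive_RC_line a (z t - a) s) (Hh _ (cauchy_pt_mod _ _ t Hs0 Hs))).
  assert (H2 := cderiv_comp_RC (fun w => (z t / (z t - a)) * w)%C _ s _ _ H1
    (cderiv_scal _ _ _ _ (cderiv_id _))).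
  destruct H2 as [H2 _].
  replace (Re (dh (pt s t) * z t)) with
    (Re (z t / (z t - a) * 1 * (dh (pt s t) * (z t - a)))).
  2: { f_equal. field. exact Hza. }
  apply is_derive_ext with (2 := H2). intros u. unfold F. f_equal. apply Cmult_comm.
Qed.

(** By [cauchy_F_derive] and [cauchy_inner_zero] the integral has zero derivative in s, so [h] on
    the circle may be replaced by its value at [a]. *)
Lemma cauchy_homotopy : RInt (F 1) 0 (2 * PI) = RInt (F 0) 0 (2 * PI).
Proof.
  assert (Hr0 : 0 < (1 - r) / 2) by lra.
  assert (HG : forall s, 0 <= s <= 1 -> is_derive (fun s => RInt (F s) 0 (2 * PI)) s 0).
  { intros s Hs.
    assert (E : RInt (fun t => Derive (fun u => F u t) s) 0 (2 * PI) = 0).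
    { apply eq_trans with (2 := cauchy_inner_zero s Hs). apply RInt_ext.
      intros t _. apply is_derive_unique. apply (cauchy_F_derive s); try easy.
      replace (s - s) with 0 by ring. rewrite Rabs_R0. lra. }
    apply (eq_ind _ (is_derive (fun s => RInt (F s) 0 (2 * PI)) s)) with (2 := E).
    apply is_derive_RInt_param.
    - exists (mkposreal _ Hr0). intros u Hu t _. eexists. apply (cauchy_F_derive s).
      easy. exact Hu.
    - intros t _.
      apply (continuity_2d_pt_ext_loc (fun u v => Re (dh (pt u v) * z v))).
      { exists (mkposreal _ Hr0). intros u v Hu _. symmetry. apply is_derive_unique.
        now apply (cauchy_F_derive s). }
      apply continuity_2d_pt_filterlim.
      apply (continuous_Re_comp (T := prod_UniformSpace R_UniformSpace R_UniformSpace)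
        (fun p => dh (pt (fst p) (snd p)) * z (snd p))%C (s, t)).
      apply continuous_Cmult.
      + apply (continuous_comp (V := C_UniformSpace) (fun p => pt (fst p) (snd p)) dh).
        apply cauchy_pt_continuous. apply Hdh. now apply cauchy_pt_mod'.
      + apply (continuous_comp (V := R_UniformSpace) (fun p : R * R => snd p) z).
        apply continuous_snd. apply continuous_circle.
    - exists (mkposreal _ Hr0). intros u Hu.
      apply ex_RInt_continuous_all. intros t.
      apply continuous_Re_comp, continuous_Cmult.
      + apply (continuous_comp (V := C_UniformSpace) (pt u) h).
        eapply is_derive_RC_continuous, is_derive_RC_pt_t.
        eapply cderiv_continuous, Hh. now apply (cauchy_pt_mod s).
      + apply continuous_Cmult. apply continuous_circle.
        apply (continuous_comp (V := C_UniformSpace) (fun t => z t - a)%C Cinv).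
        apply continuous_Cplus. apply continuous_circle. apply continuous_const.
        apply continuous_Cinv, cauchy_za. }
  destruct (MVT_gen (fun s => RInt (F s) 0 (2 * PI)) 0 1 (fun _ => 0)) as [c [_ Hc]].
  - intros s Hs. rewrite Rmin_left, Rmax_right in Hs by lra. apply HG. lra.
  - intros s Hs. rewrite Rmin_left, Rmax_right in Hs by lra.
    apply continuity_pt_filterlim.
    apply (ex_derive_continuous (fun s => RInt (F s) 0 (2 * PI)) s). eexists. now apply HG.
  - lra.
Qed.

Lemma cauchy_Clog_arg (t : R) : 0 < Re (1 - a * / z t).
Proof.
  assert (Hz := cauchy_z_mod t). pose proof (Cmod_ge_0 a).
  assert (z t <> 0) by (apply Cmod_gt_0; lra).
  assert (H1 : Cmod (a * / z t) < 1).
  { rewrite Cmod_mult, Cmod_inv, Hz by easy.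
    apply Rmult_lt_reg_r with r. lra. rewrite Rmult_assoc, Rinv_l; lra. }
  assert (H2 := re_le_Cmod (a * / z t)). assert (H3 := Rle_abs (Re (a * / z t))).
  replace (Re (1 - a * / z t)) with (1 - Re (a * / z t)). lra. unfold Re; simpl; ring.
Qed.

(* [a / (z - a)] integrates to zero because [Ci * a / (z - a)] is the derivative along the
   circle of the single-valued function [Clog (1 - a / z)]. *)
Lemma cauchy_kernel : RInt (F 0) 0 (2 * PI) = 2 * PI * Re (h a).
Proof.
  set (c := h a).
  assert (Hz0 : forall t, z t <> 0).
  { intros t. apply Cmod_gt_0. rewrite cauchy_z_mod. pose proof (Cmod_ge_0 a). lra. }
  assert (Hcont : forall t, continuous_RC
    (fun t => c * (Ci * (a / (z t - a))))%C t).
  { intros t. apply continuous_Cmult. apply continuous_const.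
    apply continuous_Cmult. apply continuous_const.
    apply continuous_Cmult. apply continuous_const.
    apply (continuous_comp (V := C_UniformSpace) (fun t => z t - a)%C Cinv).
    apply continuous_Cplus. apply continuous_circle. apply continuous_const.
    apply continuous_Cinv, cauchy_za. }
  assert (E : RInt (fun t => Im (c * (Ci * (a / (z t - a))))) 0 (2 * PI) = 0).
  { apply (RInt_Im_derive_periodic (fun t => c * Clog (1 - a * / z t))%C).
    - intros t. assert (Hza := cauchy_za t). specialize (Hz0 t).
      assert (H1 : cderiv (fun w => 1 - a * / w)%C (z t) (0 - a * (- (/ (z t * z t))))%C).
      { apply cderiv_minus. apply cderiv_const. apply cderiv_scal. now apply cderiv_Cinv. }
      assert (H2 := cderiv_comp _ Clog _ _ _ H1 (cderiv_Clog _ (cauchy_Clog_arg t))).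
      assert (H3 := cderiv_scal c _ _ _ H2).
      assert (H4 := cderiv_comp_RC _ _ _ _ _ (is_derive_RC_circle r t) H3).
      match type of H4 with is_derive_RC _ _ ?D =>
        replace (c * (Ci * (a / (z t - a))))%C with D; [exact H4|] end.
      fold (z t). field.
      split; easy.
    - exact Hcont.
    - unfold z. now rewrite circle_period. }
  rewrite (RInt_ext _ (fun t => plus (Re c) (Im (c * (Ci * (a / (z t - a))))))).
  - rewrite (RInt_plus (V := R_CompleteNormedModule)).
    + rewrite E, RInt_const. unfold plus, scal; simpl. unfold mult; simpl. ring.
    + apply ex_RInt_const.
    + apply ex_RInt_continuous_all. intros t. apply continuous_Im_comp, Hcont.
  - intros t _. unfold F. replace (pt 0 t) with a by (unfold pt; ring). fold c.
    replace (z t / (z t - a))%C with (1 + a / (z t - a))%C by (field; apply cauchy_za).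
    unfold plus; simpl. unfold Re, Im; simpl. ring.
Qed.

Lemma cauchy_formula :
  RInt (fun t => Re (h (RtoC r * cis t) * ((RtoC r * cis t) / (RtoC r * cis t - a))))
    0 (2 * PI) = 2 * PI * Re (h a).
Proof.
  rewrite <- cauchy_kernel, <- cauchy_homotopy. apply RInt_ext. intros t _.
  unfold F. replace (pt 1 t) with (z t) by (unfold pt; ring). reflexivity.
Qed.

End Cauchy.

Lemma mean_value_circle (h dh : C -> C) (r : R) :
  0 < r < 1 ->
  (forall z, Cmod z < 1 -> cderiv h z (dh z)) ->
  (forall z, Cmod z < 1 -> continuous_CC dh z) ->
  RInt (fun t => Re (h (RtoC r * cis t)%C)) 0 (2 * PI) = 2 * PI * Re (h 0).
Proof.
  intros Hr Hh Hdh.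
  rewrite <- (cauchy_formula h dh r 0 Hh Hdh). 3: lra. 2: rewrite Cmod_0; lra.
  apply RInt_ext. intros t _. f_equal.
  assert (Hw : (RtoC r * cis t)%C <> 0) by (apply Cmod_gt_0; rewrite Cmod_circle; lra).
  revert Hw. generalize (RtoC r * cis t)%C. intros w Hw. field. easy.
Qed.

(** * The Herglotz kernel and its pairing with a holomorphic function *)

Lemma Cmult_cancel_r (a b c : C) : c <> 0 -> (a * c = b * c)%C -> a = b.
Proof.
  intros Hc H. replace a with (a * c * / c)%C by (field; exact Hc). rewrite H. field. exact Hc.
Qed.

Definition herglotz (phi : R) (z : C) : C := ((1 + cis (- phi) * z) / (1 - cis (- phi) * z))%C.

Lemma herglotz_den (phi : R) (z : C) : 1 - Cmod z <= Cmod (1 - cis (- phi) * z).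
Proof.
  assert (H := Cmod_triangle_inv 1 (cis (- phi) * z)).
  rewrite Cmod_mult, Cmod_cis, Cmod_1 in H. lra.
Qed.

Lemma herglotz_den_neq_0 (phi : R) (z : C) : Cmod z < 1 -> (1 - cis (- phi) * z <> 0)%C.
Proof. intros H. apply Cmod_gt_0. pose proof (herglotz_den phi z). lra. Qed.

Definition dherglotz (phi : R) (z : C) : C :=
  (2 * cis (- phi) / ((1 - cis (- phi) * z) * (1 - cis (- phi) * z)))%C.

Lemma cderiv_herglotz_den (phi : R) (z : C) :
  cderiv (fun w => 1 - cis (- phi) * w)%C z (- cis (- phi))%C.
Proof.
  apply (cderiv_eq _ _ (0 - cis (- phi) * 1)%C). ring.
  apply cderiv_minus. apply cderiv_const. apply cderiv_scal, cderiv_id.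
Qed.

Lemma cderiv_herglotz (phi : R) (z : C) :
  Cmod z < 1 -> cderiv (herglotz phi) z (dherglotz phi z).
Proof.
  intros Hz. assert (Hd := herglotz_den_neq_0 phi z Hz).
  eapply cderiv_eq.
  2: { apply cderiv_mult.
       apply cderiv_plus. apply cderiv_const. apply cderiv_scal, cderiv_id.
       apply cderiv_inv. exact Hd. apply cderiv_herglotz_den. }
  unfold dherglotz. field. exact Hd.
Qed.

Lemma continuous_dherglotz (phi : R) (z : C) :
  Cmod z < 1 -> continuous_CC (dherglotz phi) z.
Proof.
  intros Hz. assert (Hd := herglotz_den_neq_0 phi z Hz).
  apply continuous_Cmult. apply continuous_const.
  apply (continuous_comp (V := C_UniformSpace)
    (fun w => (1 - cis (- phi) * w) * (1 - cis (- phi) * w))%C Cinv).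
  - apply continuous_Cmult; eapply cderiv_continuous, cderiv_herglotz_den.
  - apply continuous_Cinv. now apply Cmult_neq_0.
Qed.

Lemma cis_opp_mult (phi : R) : (cis (- phi) * cis phi)%C = 1.
Proof. rewrite <- cis_plus, <- cis_0. f_equal. ring. Qed.

Lemma Cconj_cis (t : R) : Cconj (cis t) = cis (- t).
Proof. unfold cis, Cconj; simpl. now rewrite cos_neg, sin_neg. Qed.

(* Turns pairings with the conjugate Herglotz kernel into Cauchy integrals at [r^2 cis phi]. *)
Lemma Cconj_herglotz (phi r t : R) :
  0 < r < 1 ->
  Cconj (herglotz phi (RtoC r * cis t)) =
  (2 * ((RtoC r * cis t) / (RtoC r * cis t - RtoC (r * r) * cis phi)) - 1)%C.
Proof.
  intros Hr.
  assert (Hd : (RtoC r * cis t - RtoC (r * r) * cis phi <> 0)%C).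
  { apply Cmod_gt_0.
    assert (H := Cmod_triangle_inv (RtoC r * cis t) (RtoC (r * r) * cis phi)).
    rewrite !Cmod_circle in H by nra. nra. }
  assert (Hd2 := herglotz_den_neq_0 phi (RtoC r * cis t)).
  rewrite Cmod_circle in Hd2 by lra. specialize (Hd2 (proj2 Hr)).
  assert (Hd3 : Cconj (1 - cis (- phi) * (RtoC r * cis t)) <> 0).
  { apply Cmod_gt_0. rewrite Cmod_conj. now apply Cmod_gt_0. }
  assert (Hc : Cconj (1 - cis (- phi) * (RtoC r * cis t)) = (1 - RtoC r * cis phi * cis (- t))%C).
  { rewrite <- (Ropp_involutive phi) at 2. rewrite <- !Cconj_cis.
    unfold Cconj, RtoC, Cmult, Cminus, Cplus, Copp; simpl. f_equal; ring. }
  assert (Hn : Cconj (1 + cis (- phi) * (RtoC r * cis t)) = (1 + RtoC r * cis phi * cis (- t))%C).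
  { rewrite <- (Ropp_involutive phi) at 2. rewrite <- !Cconj_cis.
    unfold Cconj, RtoC, Cmult, Cminus, Cplus, Copp; simpl. f_equal; ring. }
  assert (E : Cconj (herglotz phi (RtoC r * cis t)) =
    ((1 + RtoC r * cis phi * cis (- t)) / (1 - RtoC r * cis phi * cis (- t)))%C).
  { unfold herglotz, Cdiv. rewrite Cmult_conj, Cinv_conj by exact Hd2. now rewrite Hc, Hn. }
  rewrite E. rewrite Hc in Hd3. assert (H1 := cis_opp_mult t).
  apply (Cmult_cancel_r _ _ (1 - RtoC r * cis phi * cis (- t))%C Hd3).
  replace ((1 + RtoC r * cis phi * cis (- t)) / (1 - RtoC r * cis phi * cis (- t)) *
    (1 - RtoC r * cis phi * cis (- t)))%C with (1 + RtoC r * cis phi * cis (- t))%C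
    by (field; exact Hd3).
  apply (Cmult_cancel_r _ _ (RtoC r * cis t - RtoC (r * r) * cis phi)%C Hd).
  transitivity ((1 - RtoC r * cis phi * cis (- t)) *
    (RtoC r * cis t + RtoC (r * r) * cis phi))%C.
  2: field; exact Hd.
  rewrite RtoC_mult.
  transitivity (RtoC r * cis t - RtoC r * RtoC r * cis phi + (cis (-t) * cis t) * RtoC r * RtoC r * cis phi
    - RtoC r * RtoC r * RtoC r * cis (- t) * cis phi * cis phi)%C. ring.
  transitivity (RtoC r * cis t + RtoC r * RtoC r * cis phi - (cis (-t) * cis t) * RtoC r * RtoC r * cis phi
    - RtoC r * RtoC r * RtoC r * cis (- t) * cis phi * cis phi)%C. 2: ring.
  rewrite H1. ring.
Qed.

Lemma herglotz_0 (phi : R) : herglotz phi 0 = 1.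
Proof. unfold herglotz. field. Qed.

(** With p the kernel, Im p * Im h is half of Re (h * conj p) - Re (h * p). The second term is
    governed by the mean value property and p(0) = 1; [Cconj_herglotz] turns the first into a Cauchy
    integral minus a mean value. *)
Lemma RInt_Im_herglotz (h dh : C -> C) (phi r : R) :
  0 < r < 1 ->
  (forall z, Cmod z < 1 -> cderiv h z (dh z)) ->
  (forall z, Cmod z < 1 -> continuous_CC dh z) ->
  RInt (fun t => Im (herglotz phi (RtoC r * cis t)) * Im (h (RtoC r * cis t)%C)) 0 (2 * PI) =
  2 * PI * (Re (h (RtoC (r * r) * cis phi)%C) - Re (h 0)).
Proof.
  intros Hr Hh Hdh.
  set (z := fun t => (RtoC r * cis t)%C).
  set (a := (RtoC (r * r) * cis phi)%C).
  assert (Hz : forall t, Cmod (z t) < 1) by (intros; unfold z; rewrite Cmod_circle; lra).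
  assert (Ha : Cmod a < r) by (unfold a; rewrite Cmod_circle; nra).
  assert (C1 := cauchy_formula h dh r a Hh Hdh Ha (proj2 Hr)).
  assert (C2 := mean_value_circle h dh r Hr Hh Hdh).
  assert (C3 := mean_value_circle (fun w => herglotz phi w * h w)%C
    (fun w => dherglotz phi w * h w + herglotz phi w * dh w)%C r Hr).
  cbv beta in C3. rewrite herglotz_0, Cmult_1_l in C3.
  specialize (C3 ltac:(intros; apply cderiv_mult; [now apply cderiv_herglotz | now apply Hh])).
  assert (C3' : forall w, Cmod w < 1 -> continuous_CC
    (fun w => dherglotz phi w * h w + herglotz phi w * dh w)%C w).
  { intros w Hw. apply continuous_Cplus; apply continuous_Cmult.
    now apply continuous_dherglotz. eapply cderiv_continuous, Hh, Hw.
    eapply cderiv_continuous, cderiv_herglotz, Hw. now apply Hdh. }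
  specialize (C3 C3').
  assert (Hcz : forall t, continuous_RC (fun s => h (z s)) t).
  { intros t. apply (continuous_comp (V := C_UniformSpace) z h). apply continuous_circle.
    eapply cderiv_continuous, Hh, Hz. }
  assert (Hch : forall t, continuous_RC (fun s => herglotz phi (z s)) t).
  { intros t. apply (continuous_comp (V := C_UniformSpace) z (herglotz phi)). apply continuous_circle.
    eapply cderiv_continuous, cderiv_herglotz, Hz. }
  assert (Hck : forall t, continuous_RC (fun s => z s / (z s - a))%C t).
  { intros t. apply continuous_Cmult. apply continuous_circle.
    apply (continuous_comp (V := C_UniformSpace) (fun s => z s - a)%C Cinv).
    apply continuous_Cplus. apply continuous_circle. apply continuous_const.
    apply continuous_Cinv. now apply (cauchy_za r a). }
  change (RInt (fun t => Re (h (z t) * (z t / (z t - a)))) 0 (2 * PI) = 2 * PI * Re (h a)) in C1.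
  change (RInt (fun t => Re (h (z t))) 0 (2 * PI) = 2 * PI * Re (h 0)) in C2.
  change (RInt (fun t => Re (herglotz phi (z t) * h (z t))) 0 (2 * PI) = 2 * PI * Re (h 0)) in C3.
  rewrite (RInt_ext _ (fun t => minus (minus (Re (h (z t) * (z t / (z t - a))))
    (scal (/ 2) (Re (h (z t))))) (scal (/ 2) (Re (herglotz phi (z t) * h (z t)))))).
  - rewrite (RInt_minus (V := R_CompleteNormedModule)), (RInt_minus (V := R_CompleteNormedModule)),
      !(RInt_scal (V := R_CompleteNormedModule)).
    + rewrite C1, C2, C3.
      change (2 * PI * Re (h a) - / 2 * (2 * PI * Re (h 0)) - / 2 * (2 * PI * Re (h 0)) =
        2 * PI * (Re (h a) - Re (h 0))). field.
    + apply ex_RInt_continuous_all; intros; apply continuous_Re_comp, continuous_Cmult; auto.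
    + apply ex_RInt_continuous_all; intros; apply continuous_Re_comp; auto.
    + apply ex_RInt_continuous_all; intros; apply continuous_Re_comp, continuous_Cmult; auto.
    + apply (ex_RInt_scal (V := R_NormedModule)).
      apply ex_RInt_continuous_all; intros; apply continuous_Re_comp; auto.
    + apply (ex_RInt_minus (V := R_NormedModule)).
      apply ex_RInt_continuous_all; intros; apply continuous_Re_comp, continuous_Cmult; auto.
      apply (ex_RInt_scal (V := R_NormedModule)).
      apply ex_RInt_continuous_all; intros; apply continuous_Re_comp; auto.
    + apply (ex_RInt_scal (V := R_NormedModule)).
      apply ex_RInt_continuous_all; intros; apply continuous_Re_comp, continuous_Cmult; auto.
  - intros t _.
    change (Im (herglotz phi (z t)) * Im (h (z t)) = Re (h (z t) * (z t / (z t - a)))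
      - / 2 * Re (h (z t)) - / 2 * Re (herglotz phi (z t) * h (z t))).
    assert (E := Cconj_herglotz phi r t Hr). fold (z t) a in E.
    assert (E2 : (z t / (z t - a))%C = (/ 2 * (Cconj (herglotz phi (z t)) + 1))%C).
    { rewrite E. field. apply (cauchy_za r a Ha). }
    rewrite E2. generalize (herglotz phi (z t)) (h (z t)). intros [p q] [u v]. unfold Cconj, Re, Im, RtoC; simpl. field.
Qed.

(** * Averages over Cantor sets *)

(* [cantor_avg rho k m G phi] averages [G] over the [2^k] points
   [phi + sum_(m <= j < m + k) s_j rho^j] with digits [s_j] in [{0, 1}], which are the
   [psi] with [cantor_pt rho k m phi psi]. *)
Fixpoint cantor_avg (rho : R) (k m : nat) (G : R -> R) (phi : R) : R :=
  match k with
  | O => G phi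
  | S k' => (cantor_avg rho k' (S m) G phi + cantor_avg rho k' (S m) G (phi + rho ^ m)) / 2
  end.

Fixpoint cantor_pt (rho : R) (k m : nat) (phi psi : R) : Prop :=
  match k with
  | O => psi = phi
  | S k' => cantor_pt rho k' (S m) phi psi \/ cantor_pt rho k' (S m) (phi + rho ^ m) psi
  end.

Definition cantor_avgC (rho : R) (k m : nat) (G : R -> C) (phi : R) : C :=
  (cantor_avg rho k m (fun x => Re (G x)) phi, cantor_avg rho k m (fun x => Im (G x)) phi).

Lemma cantor_avg_le_pt (rho : R) (k m : nat) (G H : R -> R) (phi : R) :
  (forall psi, cantor_pt rho k m phi psi -> G psi <= H psi) ->
  cantor_avg rho k m G phi <= cantor_avg rho k m H phi.
Proof.
  revert m phi. induction k as [|k IH]; simpl; intros m phi HG. now apply HG.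
  assert (H1 := IH (S m) phi (fun psi Hp => HG psi (or_introl Hp))).
  assert (H2 := IH (S m) (phi + rho ^ m) (fun psi Hp => HG psi (or_intror Hp))). lra.
Qed.

Lemma cantor_avg_ext (rho : R) (k m : nat) (G H : R -> R) (phi : R) :
  (forall psi, G psi = H psi) -> cantor_avg rho k m G phi = cantor_avg rho k m H phi.
Proof. intros E. apply Rle_antisym; apply cantor_avg_le_pt; intros; rewrite E; lra. Qed.

Lemma cantor_avg_const (rho : R) (k m : nat) (c phi : R) :
  cantor_avg rho k m (fun _ => c) phi = c.
Proof. revert m phi. induction k as [|k IH]; simpl; intros. easy. rewrite !IH. field. Qed.

Lemma cantor_avg_scal (rho : R) (k m : nat) (a : R) (G : R -> R) (phi : R) :
  cantor_avg rho k m (fun x => a * G x) phi = a * cantor_avg rho k m G phi.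
Proof. revert m phi. induction k as [|k IH]; simpl; intros. easy. rewrite !IH. field. Qed.

Lemma cantor_avgC_ext (rho : R) (k m : nat) (G H : R -> C) (phi : R) :
  (forall psi, G psi = H psi) -> cantor_avgC rho k m G phi = cantor_avgC rho k m H phi.
Proof. intros E. unfold cantor_avgC. f_equal; apply cantor_avg_ext; intros; now rewrite E. Qed.

Lemma cantor_avgC_S (rho : R) (k m : nat) (G : R -> C) (phi : R) :
  cantor_avgC rho (S k) m G phi =
  (/ 2 * (cantor_avgC rho k (S m) G phi + cantor_avgC rho k (S m) G (phi + rho ^ m)%R))%C.
Proof.
  unfold cantor_avgC, Cmult, Cplus, RtoC, Cinv; simpl. f_equal; field.
Qed.

Lemma cantor_avgC_const (rho : R) (k m : nat) (c : C) (phi : R) :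
  cantor_avgC rho k m (fun _ => c) phi = c.
Proof. unfold cantor_avgC. rewrite !cantor_avg_const. now destruct c. Qed.

Lemma cantor_avgC_lin (rho : R) (k m : nat) (a b : C) (G H : R -> C) (phi : R) :
  cantor_avgC rho k m (fun x => a * G x + b * H x)%C phi =
  (a * cantor_avgC rho k m G phi + b * cantor_avgC rho k m H phi)%C.
Proof.
  revert m phi. induction k as [|k IH]; intros m phi.
  - unfold cantor_avgC, Re, Im; simpl. now destruct (a * G phi + b * H phi)%C eqn:E, (G phi), (H phi).
  - rewrite !cantor_avgC_S, !IH. ring.
Qed.

Lemma Cmod_cantor_avgC (rho : R) (k m : nat) (G : R -> C) (phi : R) :
  Cmod (cantor_avgC rho k m G phi) <= cantor_avg rho k m (fun x => Cmod (G x)) phi.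
Proof.
  revert m phi. induction k as [|k IH]; intros m phi.
  - unfold cantor_avgC; simpl. now destruct (G phi) as [a b]; right.
  - rewrite cantor_avgC_S, Cmod_mult. simpl cantor_avg.
    assert (E : Cmod (/ 2) = / 2) by (rewrite <- RtoC_inv, Cmod_R, Rabs_pos_eq; lra).
    rewrite E.
    pose proof (Cmod_triangle (cantor_avgC rho k (S m) G phi) (cantor_avgC rho k (S m) G (phi + rho ^ m))).
    specialize (IH (S m)). pose proof (IH phi). pose proof (IH (phi + rho ^ m)). lra.
Qed.

Lemma Cmod_cantor_avgC_le (rho : R) (k m : nat) (G : R -> C) (phi B : R) :
  (forall psi, Cmod (G psi) <= B) -> Cmod (cantor_avgC rho k m G phi) <= B.
Proof.
  intros H. eapply Rle_trans. apply Cmod_cantor_avgC.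
  rewrite <- (cantor_avg_const rho k m B phi). apply cantor_avg_le_pt. intros; apply H.
Qed.

Lemma cderiv_cantor_avgC (rho : R) (k m : nat) (g : R -> C -> C) (dg : R -> C) (z : C) (phi : R) :
  (forall psi, cderiv (g psi) z (dg psi)) ->
  cderiv (fun w => cantor_avgC rho k m (fun psi => g psi w) phi) z (cantor_avgC rho k m dg phi).
Proof.
  intros H. revert m phi. induction k as [|k IH]; intros m phi.
  - unfold cantor_avgC; simpl.
    apply cderiv_ext with (g phi). intros w. now destruct (g phi w).
    apply (cderiv_eq _ _ (dg phi)). now destruct (dg phi). apply H.
  - rewrite cantor_avgC_S.
    eapply cderiv_ext. intros w. symmetry. apply cantor_avgC_S.
    apply cderiv_scal, cderiv_plus; apply IH.
Qed.

Lemma continuous_cantor_avg (T : UniformSpace) (rho : R) (k m : nat) (g : R -> T -> R) (t : T) (phi : R) :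
  (forall psi, continuous (T := T) (U := R_UniformSpace) (g psi) t) ->
  continuous (T := T) (U := R_UniformSpace) (fun w => cantor_avg rho k m (fun psi => g psi w) phi) t.
Proof.
  intros H. revert m phi. induction k as [|k IH]; intros m phi; simpl. apply H.
  apply (continuous_mult (K := R_AbsRing) (fun w => _ + _) (fun _ => / 2)).
  apply (continuous_plus (V := R_NormedModule)); apply IH. apply continuous_const.
Qed.

Lemma RInt_cantor_avg (rho : R) (k m : nat) (g : R -> R -> R) (a b phi : R) :
  (forall psi t, continuous_RR (g psi) t) ->
  RInt (fun t => cantor_avg rho k m (fun psi => g psi t) phi) a b =
  cantor_avg rho k m (fun psi => RInt (g psi) a b) phi.
Proof.
  intros H. revert m phi. induction k as [|k IH]; intros m phi; simpl. reflexivity.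
  rewrite <- !IH.
  assert (Hc : forall phi, ex_RInt (fun t => cantor_avg rho k (S m) (fun psi => g psi t) phi) a b).
  { intros. apply ex_RInt_continuous_all. intros t.
    apply (continuous_cantor_avg R_UniformSpace). intros; apply H. }
  rewrite (RInt_ext _ (fun t => scal (/ 2)
    (plus (cantor_avg rho k (S m) (fun psi => g psi t) phi)
      (cantor_avg rho k (S m) (fun psi => g psi t) (phi + rho ^ m))))).
  - rewrite (RInt_scal (V := R_CompleteNormedModule)), (RInt_plus (V := R_CompleteNormedModule)).
    apply Rmult_comm. apply Hc. apply Hc.
    apply (ex_RInt_plus (V := R_NormedModule)); apply Hc.
  - intros t _. apply Rmult_comm.
Qed.

Lemma pow_le_1_compat (rho : R) (n : nat) : 0 < rho <= 1 -> 0 < rho ^ n <= 1.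
Proof.
  intros H. split. apply pow_lt. lra. rewrite <- (pow1 n). apply pow_incr. lra.
Qed.

(** For rho <= 1/2 the tail rho^m + rho^(m+1) + ... is at most 2 rho^m. *)
Lemma cantor_pt_bounds (rho : R) (k m : nat) (phi psi : R) :
  0 < rho <= / 2 -> cantor_pt rho k m phi psi -> phi <= psi <= phi + 2 * rho ^ m.
Proof.
  intros Hr. revert m phi. induction k as [|k IH]; simpl; intros m phi Hp.
  - subst. pose proof (pow_le_1_compat rho m ltac:(lra)). lra.
  - pose proof (pow_le_1_compat rho m ltac:(lra)) as H0.
    destruct Hp as [Hp|Hp]; apply IH in Hp; simpl in Hp; nra.
Qed.

(** One more level splits each point psi into psi and psi + rho^(m + k), a displacement by the last
    digit only. *)
Lemma cantor_avg_step (rho : R) (k m : nat) (G : R -> R) (L phi : R) :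
  0 < rho -> (forall x y, Rabs (G x - G y) <= L * Rabs (x - y)) ->
  Rabs (cantor_avg rho (S k) m G phi - cantor_avg rho k m G phi) <= L * rho ^ (m + k).
Proof.
  intros Hr HG. revert m phi. induction k as [|k IH]; intros m phi.
  - simpl. replace ((G phi + G (phi + rho ^ m)) / 2 - G phi)
      with (/ 2 * (G (phi + rho ^ m) - G phi)) by field.
    rewrite Rabs_mult, (Rabs_pos_eq (/ 2)) by lra.
    specialize (HG (phi + rho ^ m) phi).
    replace (phi + rho ^ m - phi) with (rho ^ m) in HG by ring.
    rewrite (Rabs_pos_eq (rho ^ m)) in HG by (left; now apply pow_lt).
    rewrite Nat.add_0_r. pose proof (Rabs_pos (G (phi + rho ^ m) - G phi)). lra.
  - assert (H1 := IH (S m) phi). assert (H2 := IH (S m) (phi + rho ^ m)).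
    replace (S m + k)%nat with (m + S k)%nat in H1, H2 by lia.
    change (cantor_avg rho (S (S k)) m G phi) with
      ((cantor_avg rho (S k) (S m) G phi + cantor_avg rho (S k) (S m) G (phi + rho ^ m)) / 2).
    change (cantor_avg rho (S k) m G phi) with
      ((cantor_avg rho k (S m) G phi + cantor_avg rho k (S m) G (phi + rho ^ m)) / 2).
    apply Rabs_le_between in H1. apply Rabs_le_between in H2. apply Rabs_le_between. lra.
Qed.

Lemma cantor_avg_nonneg (rho : R) (k m : nat) (G : R -> R) (phi : R) :
  (forall x, 0 <= G x) -> 0 <= cantor_avg rho k m G phi.
Proof.
  intros H. rewrite <- (cantor_avg_const rho k m 0 phi). apply cantor_avg_le_pt. intros; apply H.
Qed.

(** Nonnegativity allows discarding everything outside the cylinder of the points that share the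
    first n digits of psi; it has mass (1/2)^n and lies within 2 rho^(m + n) of psi. *)
Lemma cantor_avg_lower (rho : R) (n k m : nat) (G : R -> R) (phi psi B : R) :
  0 < rho <= / 2 -> (n <= k)%nat -> (forall x, 0 <= G x) ->
  cantor_pt rho k m phi psi ->
  (forall x, Rabs (x - psi) <= 2 * rho ^ (m + n) -> B <= G x) ->
  (/ 2) ^ n * B <= cantor_avg rho k m G phi.
Proof.
  intros Hr. revert k m phi. induction n as [|n IH]; intros k m phi Hk HG Hp HB.
  - simpl. rewrite Rmult_1_l, <- (cantor_avg_const rho k m B phi).
    apply cantor_avg_le_pt. intros x Hx. apply HB.
    apply cantor_pt_bounds in Hx; try easy. apply cantor_pt_bounds in Hp; try easy.
    rewrite Nat.add_0_r. apply Rabs_le. lra.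
  - destruct k as [|k]. lia.
    assert (HB' : forall x, Rabs (x - psi) <= 2 * rho ^ (S m + n) -> B <= G x).
    { intros x. replace (S m + n)%nat with (m + S n)%nat by lia. apply HB. }
    pose proof (cantor_avg_nonneg rho k (S m) G phi HG).
    pose proof (cantor_avg_nonneg rho k (S m) G (phi + rho ^ m) HG).
    simpl in Hp |- *. destruct Hp as [Hp|Hp];
      specialize (IH k (S m) _ ltac:(lia) HG Hp HB'); lra.
Qed.

(** * Limits of Cantor averages, with geometric rate *)

Definition Clim (u : nat -> C) : C :=
  (real (Lim_seq (fun k => Re (u k))), real (Lim_seq (fun k => Im (u k)))).

Lemma Lim_seq_geometric (u : nat -> R) (L rho : R) :
  0 < rho <= / 2 -> (forall k, Rabs (u (S k) - u k) <= L * rho ^ k) ->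
  forall k, Rabs (real (Lim_seq u) - u k) <= 2 * L * rho ^ k.
Proof.
  intros Hr Hu.
  assert (HL : 0 <= L).
  { specialize (Hu O). simpl in Hu. pose proof (Rabs_pos (u 1%nat - u O)). lra. }
  (* The difference of powers makes the bound telescope: L rho^i <= 2 L (rho^i - rho^(i+1)) because
     rho <= 1/2. *)
  assert (Hp : forall k j, Rabs (u (k + j)%nat - u k) <= 2 * L * (rho ^ k - rho ^ (k + j))).
  { intros k. induction j as [|j IH].
    - rewrite Nat.add_0_r. replace (u k - u k) with 0 by ring. rewrite Rabs_R0. lra.
    - replace (k + S j)%nat with (S (k + j)) by lia. specialize (Hu (k + j)%nat).
      apply Rabs_le_between in IH. apply Rabs_le_between in Hu. apply Rabs_le_between.
      assert (0 <= L * rho ^ (k + j)).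
      { apply Rmult_le_pos. easy. left. apply pow_lt. lra. }
      simpl. assert (L * rho ^ (k + j) * rho <= L * rho ^ (k + j) * / 2)
        by (apply Rmult_le_compat_l; lra). lra. }
  assert (Hp' : forall k n, (k <= n)%nat -> Rabs (u n - u k) <= 2 * L * rho ^ k).
  { intros k n Hn. specialize (Hp k (n - k)%nat). replace (k + (n - k))%nat with n in Hp by lia.
    eapply Rle_trans. apply Hp. apply Rmult_le_compat_l. lra.
    assert (0 < rho ^ n) by (apply pow_lt; lra). lra. }
  assert (Hex : ex_finite_lim_seq u).
  { apply ex_lim_seq_cauchy_corr. intros eps.
    assert (Hg : is_lim_seq (fun k => 2 * L * rho ^ k) 0).
    { replace (Finite 0) with (Rbar_mult (2 * L) 0) by (simpl; f_equal; ring).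
      apply is_lim_seq_scal_l. apply is_lim_seq_geom. rewrite Rabs_pos_eq; lra. }
    assert (He : 0 < eps / 2) by (pose proof (cond_pos eps); lra).
    apply is_lim_seq_spec in Hg. destruct (Hg (mkposreal _ He)) as [N HN].
    exists N. intros n n' Hn Hn'.
    specialize (HN N (le_n N)). simpl in HN.
    assert (G1 := Hp' N n Hn). assert (G2 := Hp' N n' Hn').
    assert (G3 : 2 * L * rho ^ N < eps / 2).
    { eapply Rle_lt_trans. apply Rle_abs. replace (2 * L * rho ^ N) with (2 * L * rho ^ N - 0) by ring.
      exact HN. }
    replace (u n - u n') with ((u n - u N) - (u n' - u N)) by ring.
    eapply Rle_lt_trans. apply Rabs_triang. rewrite Rabs_Ropp. lra. }
  destruct Hex as [l Hl]. rewrite (is_lim_seq_unique _ _ Hl). simpl.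
  intros k. apply Rnot_lt_le. intros Hc.
  apply is_lim_seq_spec in Hl.
  destruct (Hl (mkposreal _ (proj2 (Rlt_0_minus _ _) Hc))) as [N HN].
  specialize (HN (max N k) (Nat.le_max_l _ _)). simpl in HN.
  specialize (Hp' k (max N k) (Nat.le_max_r _ _)).
  assert (G := Rabs_triang (l - u (max N k)) (u (max N k) - u k)).
  replace (l - u (max N k) + (u (max N k) - u k)) with (l - u k) in G by ring.
  rewrite Rabs_minus_sym in HN. lra.
Qed.

Lemma Clim_geometric (u : nat -> C) (L rho : R) :
  0 < rho <= / 2 -> (forall k, Cmod (u (S k) - u k) <= L * rho ^ k) ->
  forall k, Cmod (Clim u - u k) <= 4 * L * rho ^ k.
Proof.
  intros Hr Hu k.
  eapply Rle_trans. apply Cmod_le_sum.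
  assert (H1 := Lim_seq_geometric (fun k => Re (u k)) L rho Hr).
  assert (H2 := Lim_seq_geometric (fun k => Im (u k)) L rho Hr).
  assert (E1 : Rabs (Re (Clim u - u k)) <= 2 * L * rho ^ k).
  { apply H1. intros j. eapply Rle_trans. 2: apply Hu. apply (re_le_Cmod (u (S j) - u j)). }
  assert (E2 : Rabs (Im (Clim u - u k)) <= 2 * L * rho ^ k).
  { apply H2. intros j. eapply Rle_trans. 2: apply Hu. apply (im_le_Cmod (u (S j) - u j)). }
  lra.
Qed.

Lemma cantor_avgC_step (rho : R) (k m : nat) (G : R -> C) (L phi : R) :
  0 < rho -> (forall x y, Cmod (G x - G y) <= L * Rabs (x - y)) ->
  Cmod (cantor_avgC rho (S k) m G phi - cantor_avgC rho k m G phi) <= 2 * L * rho ^ (m + k).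
Proof.
  intros Hr HG. eapply Rle_trans. apply Cmod_le_sum.
  assert (H1 := cantor_avg_step rho k m (fun x => Re (G x)) L phi Hr).
  assert (H2 := cantor_avg_step rho k m (fun x => Im (G x)) L phi Hr).
  assert (E1 := H1 ltac:(intros x y; eapply Rle_trans; [apply (re_le_Cmod (G x - G y)) | apply HG])).
  assert (E2 := H2 ltac:(intros x y; eapply Rle_trans; [apply (im_le_Cmod (G x - G y)) | apply HG])).
  replace (2 * L * rho ^ (m + k)) with (L * rho ^ (m + k) + L * rho ^ (m + k)) by ring.
  apply Rplus_le_compat; assumption.
Qed.

(** The integral of [G] against the Cantor measure, defined for every [G] through the totality of
    [Lim_seq] and shown to be a true limit for Lipschitz [G] by [cantor_lim_approx]. Digits start at
    exponent 1, so that the Cantor set lies in [0, 2 rho], a short arc when rho is small. *)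
Definition cantor_lim (rho : R) (G : R -> C) : C := Clim (fun k => cantor_avgC rho k 1 G 0).

Lemma cantor_lim_approx (rho : R) (G : R -> C) (L : R) :
  0 < rho <= / 2 -> (forall x y, Cmod (G x - G y) <= L * Rabs (x - y)) ->
  forall k, Cmod (cantor_lim rho G - cantor_avgC rho k 1 G 0) <= 8 * L * rho ^ k.
Proof.
  intros Hr HG k. replace (8 * L) with (4 * (2 * L)) by ring.
  apply (Clim_geometric (fun k => cantor_avgC rho k 1 G 0)). easy.
  intros j. eapply Rle_trans. apply cantor_avgC_step with (2 := HG). lra.
  assert (HL : 0 <= L).
  { specialize (HG 1 0). replace (1 - 0) with 1 in HG by ring. rewrite Rabs_R1 in HG.
    pose proof (Cmod_ge_0 (G 1 - G 0)). lra. }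
  assert (0 < rho ^ j) by (apply pow_lt; lra). simpl.
  replace (2 * L * (rho * rho ^ j)) with (2 * L * rho ^ j * rho) by ring.
  assert (0 <= 2 * L * rho ^ j) by (apply Rmult_le_pos; lra). nra.
Qed.

(** Passes a bound from finite levels to the limit; [K] may depend on everything but k. *)
Lemma le_of_geometric (x y K rho : R) :
  0 < rho <= / 2 -> (forall k : nat, x <= y + K * rho ^ k) -> x <= y.
Proof.
  intros Hr H. apply Rnot_lt_le. intros Hc.
  assert (Hg : is_lim_seq (fun k => K * rho ^ k) 0).
  { replace (Finite 0) with (Rbar_mult K 0) by (simpl; f_equal; ring).
    apply is_lim_seq_scal_l. apply is_lim_seq_geom. rewrite Rabs_pos_eq; lra. }
  apply is_lim_seq_spec in Hg.
  destruct (Hg (mkposreal _ (proj2 (Rlt_0_minus _ _) Hc))) as [N HN].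
  specialize (HN N (le_n N)). specialize (H N). simpl in HN.
  pose proof (Rle_abs (K * rho ^ N - 0)). lra.
Qed.

(** The three-term shape fits a first-order Taylor remainder, with c = w - z, and with c = 0 also a
    plain difference. A bound uniform in the angle passes to the limit whatever the Lipschitz
    constants are. *)
Lemma cantor_lim_lin_bound (rho : R) (G H J : R -> C) (c : C) (L M N B : R) :
  0 < rho <= / 2 ->
  (forall x y, Cmod (G x - G y) <= L * Rabs (x - y)) ->
  (forall x y, Cmod (H x - H y) <= M * Rabs (x - y)) ->
  (forall x y, Cmod (J x - J y) <= N * Rabs (x - y)) ->
  (forall x, Cmod (G x - H x - c * J x) <= B) ->
  Cmod (cantor_lim rho G - cantor_lim rho H - c * cantor_lim rho J) <= B.
Proof.
  intros Hr HG HH HJ HB.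
  apply le_of_geometric with (K := 8 * L + 8 * M + Cmod c * (8 * N)) (rho := rho). easy.
  intros k.
  assert (E1 := cantor_lim_approx rho G L Hr HG k).
  assert (E2 := cantor_lim_approx rho H M Hr HH k).
  assert (E3 := cantor_lim_approx rho J N Hr HJ k).
  set (g := cantor_avgC rho k 1 G 0) in *. set (h := cantor_avgC rho k 1 H 0) in *.
  set (j := cantor_avgC rho k 1 J 0) in *.
  assert (E4 : Cmod (g - h - c * j) <= B).
  { replace (g - h - c * j)%C with (cantor_avgC rho k 1 (fun x => G x - H x - c * J x)%C 0).
    now apply Cmod_cantor_avgC_le.
    rewrite (cantor_avgC_ext _ _ _ _ (fun x => 1 * (1 * G x + (-(1)) * H x) + (- c) * J x)%C)
      by (intros; ring).
    rewrite !cantor_avgC_lin. unfold g, h, j. ring. }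
  replace (cantor_lim rho G - cantor_lim rho H - c * cantor_lim rho J)%C with
    ((g - h - c * j) + ((cantor_lim rho G - g) - (cantor_lim rho H - h)
      - c * (cantor_lim rho J - j)))%C by ring.
  eapply Rle_trans. apply Cmod_triangle.
  assert (E5 := Cmod_triangle_minus (cantor_lim rho G - g - (cantor_lim rho H - h))
    (c * (cantor_lim rho J - j))).
  assert (E6 := Cmod_triangle_minus (cantor_lim rho G - g) (cantor_lim rho H - h)).
  rewrite Cmod_mult in E5.
  assert (E7 : Cmod c * Cmod (cantor_lim rho J - j) <= Cmod c * (8 * N * rho ^ k))
    by (apply Rmult_le_compat_l; [apply Cmod_ge_0 | easy]).
  lra.
Qed.

(** * The Herglotz integral of the Cantor measure *)

(** This is (p - 1) / z for the Herglotz kernel p, written without the division by z; [kernelQ] is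
    its primitive vanishing at 0. *)
Definition kernelD (phi : R) (z : C) : C := (2 * cis (- phi) / (1 - cis (- phi) * z))%C.

Definition kernelQ (phi : R) (z : C) : C := (- (2) * Clog (1 - cis (- phi) * z))%C.

Lemma Cmod_2 : Cmod 2 = 2.
Proof. rewrite Cmod_R. apply Rabs_pos_eq. lra. Qed.

Lemma cis_opp_lipschitz (x y : R) : Cmod (cis (- x) - cis (- y)) <= Rabs (x - y).
Proof.
  eapply Rle_trans. apply cis_lipschitz.
  replace (- x - - y) with (- (x - y)) by ring. rewrite Rabs_Ropp. lra.
Qed.

Lemma kernelD_lipschitz_phi (z : C) (x y : R) :
  Cmod z < 1 -> Cmod (kernelD x z - kernelD y z) <= 2 / ((1 - Cmod z) * (1 - Cmod z)) * Rabs (x - y).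
Proof.
  intros Hz. assert (Hx := herglotz_den_neq_0 x z Hz). assert (Hy := herglotz_den_neq_0 y z Hz).
  replace (kernelD x z - kernelD y z)%C with
    (2 * (cis (- x) - cis (- y)) / ((1 - cis (- x) * z) * (1 - cis (- y) * z)))%C
    by (unfold kernelD; field; split; assumption).
  rewrite Cmod_div by now apply Cmult_neq_0.
  rewrite !Cmod_mult, Cmod_2.
  assert (H1 := herglotz_den x z). assert (H2 := herglotz_den y z).
  assert (H3 := cis_opp_lipschitz x y). pose proof (Rabs_pos (x - y)).
  apply Rle_trans with (2 * Rabs (x - y) / ((1 - Cmod z) * (1 - Cmod z))).
  2: right; field; lra.
  unfold Rdiv. pose proof (Cmod_ge_0 (cis (- x) - cis (- y))).
  apply Rmult_le_compat; try nra.
  left. apply Rinv_0_lt_compat. nra.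
  apply Rinv_le_contravar; nra.
Qed.

Lemma Re_one_minus_pos (z : C) : Cmod z < 1 -> 0 < Re (1 - z).
Proof.
  intros Hz. assert (H := re_le_Cmod z). pose proof (Rle_abs (Re z)).
  replace (Re (1 - z)) with (1 - Re z) by (unfold Re; simpl; ring). lra.
Qed.

Lemma Cmod_segment (a b : C) (t r : R) :
  0 <= t <= 1 -> Cmod a <= r -> Cmod b <= r -> Cmod (a + RtoC t * (b - a)) <= r.
Proof.
  intros Ht Ha Hb.
  replace (a + RtoC t * (b - a))%C with (RtoC (1 - t) * a + RtoC t * b)%C
    by (rewrite RtoC_minus; ring).
  eapply Rle_trans. apply Cmod_triangle.
  rewrite !Cmod_mult, !Cmod_R, !Rabs_pos_eq by lra. nra.
Qed.

Lemma one_minus_den (z : C) : 1 - Cmod z <= Cmod (1 - z).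
Proof. pose proof (Cmod_triangle_inv 1 z). rewrite Cmod_1 in H. lra. Qed.

Lemma cderiv_Clog_one_minus (z : C) :
  Cmod z < 1 -> cderiv (fun w => Clog (1 - w))%C z (- / (1 - z))%C.
Proof.
  intros Hz. apply (cderiv_eq _ _ (/ (1 - z) * (0 - 1))%C). ring.
  apply (cderiv_comp (fun w => 1 - w)%C Clog).
  apply cderiv_minus. apply cderiv_const. apply cderiv_id.
  apply cderiv_Clog. now apply Re_one_minus_pos.
Qed.

Lemma one_minus_neq_0 (z : C) : Cmod z < 1 -> (1 - z <> 0)%C.
Proof. intros H. apply Cmod_gt_0. pose proof (one_minus_den z). lra. Qed.

Lemma Clog_lipschitz (a b : C) (r : R) :
  r < 1 -> Cmod a <= r -> Cmod b <= r ->
  Cmod (Clog (1 - a) - Clog (1 - b)) <= / (1 - r) * Cmod (a - b).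
Proof.
  intros Hr Ha Hb.
  apply (mean_value_segment (fun w => Clog (1 - w))%C (fun w => - / (1 - w))%C b a).
  - intros t Ht. apply cderiv_Clog_one_minus.
    eapply Rle_lt_trans. apply (Cmod_segment b a t r); assumption. easy.
  - intros t Ht. assert (H := Cmod_segment b a t r Ht Hb Ha).
    rewrite Cmod_opp, Cmod_inv by (apply one_minus_neq_0; lra).
    apply Rinv_le_contravar. lra. pose proof (one_minus_den (b + RtoC t * (a - b))). lra.
Qed.

(** The mean value bound is applied to Clog (1 - w) + w / (1 - a), whose derivative is a multiple of
    w - a and hence small along the segment. *)
Lemma Clog_taylor (a b : C) (r : R) :
  r < 1 -> Cmod a <= r -> Cmod b <= r ->
  Cmod (Clog (1 - b) - Clog (1 - a) + (b - a) / (1 - a)) <=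
  / ((1 - r) * (1 - r)) * Cmod (b - a) * Cmod (b - a).
Proof.
  intros Hr Ha Hb. assert (Ha' := one_minus_neq_0 a ltac:(lra)).
  replace (Clog (1 - b) - Clog (1 - a) + (b - a) / (1 - a))%C with
    ((Clog (1 - b) + / (1 - a) * b) - (Clog (1 - a) + / (1 - a) * a))%C by (field; exact Ha').
  apply (mean_value_segment (fun w => Clog (1 - w) + / (1 - a) * w)%C
    (fun w => - / (1 - w) + / (1 - a) * 1)%C a b).
  - intros t Ht. apply cderiv_plus. 2: apply cderiv_scal, cderiv_id.
    apply cderiv_Clog_one_minus.
    eapply Rle_lt_trans. apply (Cmod_segment a b t r); assumption. easy.
  - intros t Ht. assert (H := Cmod_segment a b t r Ht Ha Hb).
    set (w := (a + RtoC t * (b - a))%C) in *.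
    assert (Hw := one_minus_neq_0 w ltac:(lra)).
    replace (- / (1 - w) + / (1 - a) * 1)%C with (- (RtoC t * (b - a)) / ((1 - w) * (1 - a)))%C.
    2: { replace (RtoC t * (b - a))%C with (w - a)%C by (unfold w; ring). field. split; assumption. }
    rewrite Cmod_div by now apply Cmult_neq_0.
    rewrite Cmod_opp, !Cmod_mult, Cmod_R, Rabs_pos_eq by easy.
    pose proof (one_minus_den w). pose proof (one_minus_den a). pose proof (Cmod_ge_0 (b - a)).
    unfold Rdiv. rewrite (Rmult_comm (/ ((1 - r) * (1 - r)))).
    apply Rmult_le_compat; try nra.
    left. apply Rinv_0_lt_compat. nra.
    apply Rinv_le_contravar; nra.
Qed.

Lemma Cmod_cis_mult (t : R) (z : C) : Cmod (cis t * z) = Cmod z.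
Proof. rewrite Cmod_mult, Cmod_cis. ring. Qed.

Lemma Cmod_opp2_mult (w : C) : Cmod (- (2) * w) = 2 * Cmod w.
Proof. rewrite Cmod_mult, Cmod_opp, Cmod_2. reflexivity. Qed.

Lemma kernelQ_lipschitz_phi (z : C) (x y : R) :
  Cmod z < 1 -> Cmod (kernelQ x z - kernelQ y z) <= 2 / (1 - Cmod z) * Rabs (x - y).
Proof.
  intros Hz. unfold kernelQ.
  replace (- (2) * Clog (1 - cis (- x) * z) - - (2) * Clog (1 - cis (- y) * z))%C with
    (- (2) * (Clog (1 - cis (- x) * z) - Clog (1 - cis (- y) * z)))%C by ring.
  rewrite Cmod_opp2_mult.
  assert (H := Clog_lipschitz (cis (- x) * z) (cis (- y) * z) (Cmod z) Hz).
  rewrite !Cmod_cis_mult in H. specialize (H (Rle_refl _) (Rle_refl _)).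
  replace (cis (- x) * z - cis (- y) * z)%C with ((cis (- x) - cis (- y)) * z)%C in H by ring.
  rewrite Cmod_mult in H.
  assert (H3 := cis_opp_lipschitz x y). pose proof (Cmod_ge_0 z).
  assert (Hi : 0 < / (1 - Cmod z)) by (apply Rinv_0_lt_compat; lra).
  pose proof (Rabs_pos (x - y)). pose proof (Cmod_ge_0 (cis (- x) - cis (- y))).
  assert (Cmod (cis (- x) - cis (- y)) * Cmod z <= Rabs (x - y)) by nra.
  unfold Rdiv. rewrite Rmult_assoc. apply Rmult_le_compat_l. lra.
  eapply Rle_trans. apply H. apply Rmult_le_compat_l; lra.
Qed.

Lemma kernelD_lipschitz_z (phi r : R) (w z : C) :
  r < 1 -> Cmod w <= r -> Cmod z <= r ->
  Cmod (kernelD phi w - kernelD phi z) <= 2 / ((1 - r) * (1 - r)) * Cmod (w - z).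
Proof.
  intros Hr Hw Hz.
  assert (Hx := herglotz_den_neq_0 phi z ltac:(lra)).
  assert (Hy := herglotz_den_neq_0 phi w ltac:(lra)).
  replace (kernelD phi w - kernelD phi z)%C with
    (2 * cis (- phi) * (cis (- phi) * (w - z)) / ((1 - cis (- phi) * w) * (1 - cis (- phi) * z)))%C
    by (unfold kernelD; field; split; assumption).
  rewrite Cmod_div by now apply Cmult_neq_0.
  rewrite !Cmod_mult, Cmod_2, Cmod_cis.
  assert (H1 := herglotz_den phi z). assert (H2 := herglotz_den phi w).
  pose proof (Cmod_ge_0 (w - z)).
  apply Rle_trans with (2 * Cmod (w - z) / ((1 - r) * (1 - r))).
  2: right; field; lra.
  unfold Rdiv. apply Rmult_le_compat; try nra.
  left. apply Rinv_0_lt_compat. nra.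
  apply Rinv_le_contravar; nra.
Qed.

Lemma kernelQ_taylor (phi r : R) (w z : C) :
  r < 1 -> Cmod w <= r -> Cmod z <= r ->
  Cmod (kernelQ phi w - kernelQ phi z - (w - z) * kernelD phi z) <=
  2 / ((1 - r) * (1 - r)) * Cmod (w - z) * Cmod (w - z).
Proof.
  intros Hr Hw Hz.
  assert (H := Clog_taylor (cis (- phi) * z) (cis (- phi) * w) r Hr).
  rewrite !Cmod_cis_mult in H. specialize (H Hz Hw).
  replace (cis (- phi) * w - cis (- phi) * z)%C with (cis (- phi) * (w - z))%C in H by ring.
  rewrite !Cmod_cis_mult in H.
  assert (Hx := herglotz_den_neq_0 phi z ltac:(lra)).
  replace (kernelQ phi w - kernelQ phi z - (w - z) * kernelD phi z)%C with
    (- (2) * (Clog (1 - cis (- phi) * w) - Clog (1 - cis (- phi) * z) +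
      cis (- phi) * (w - z) / (1 - cis (- phi) * z)))%C by (unfold kernelQ, kernelD; field; exact Hx).
  rewrite Cmod_opp2_mult. unfold Rdiv. rewrite !Rmult_assoc in *. lra.
Qed.

Definition cantor_D (rho : R) (z : C) : C := cantor_lim rho (fun phi => kernelD phi z).

Definition cantor_Q (rho : R) (z : C) : C := cantor_lim rho (fun phi => kernelQ phi z).

Lemma Cmod_near (w z : C) (d : R) : Cmod (w - z) < d -> Cmod w < Cmod z + d.
Proof. intros H. pose proof (Cmod_triangle_inv w z). lra. Qed.

Lemma cderiv_of_quadratic (f : C -> C) (z l : C) (d K : R) :
  0 < d -> 0 < K ->
  (forall w, Cmod (w - z) < d -> Cmod (f w - f z - (w - z) * l) <= K * Cmod (w - z) * Cmod (w - z)) ->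
  cderiv f z l.
Proof.
  intros Hd HK H eps Heps. exists (Rmin d (eps / K)). split.
  apply Rmin_pos. easy. now apply Rdiv_lt_0_compat.
  intros w Hw. pose proof (Rmin_l d (eps / K)). pose proof (Rmin_r d (eps / K)).
  rewrite (Cmult_comm l). eapply Rle_trans. apply H. lra.
  apply Rmult_le_compat_r. apply Cmod_ge_0.
  apply Rle_trans with (K * (eps / K)). apply Rmult_le_compat_l; lra. right. field. lra.
Qed.

(** No exchange of limit and derivative is needed: the quadratic remainder of [kernelQ] is uniform
    in the angle, so it survives averaging and the limit. *)
Lemma cderiv_cantor_Q (rho : R) (z : C) :
  0 < rho <= / 2 -> Cmod z < 1 -> cderiv (cantor_Q rho) z (cantor_D rho z).
Proof.
  (* A radius halfway to the unit circle contains all w close to z and keeps the constants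
     finite. *)
  intros Hr Hz. set (r := (1 + Cmod z) / 2). pose proof (Cmod_ge_0 z).
  assert (Hr1 : r < 1) by (unfold r; lra).
  apply cderiv_of_quadratic with ((1 - Cmod z) / 2) (2 / ((1 - r) * (1 - r))). lra.
  apply Rdiv_lt_0_compat. lra. nra.
  intros w Hw. apply Cmod_near in Hw.
  assert (Hw' : Cmod w <= r) by (unfold r; lra).
  eapply (cantor_lim_lin_bound rho).
  - easy.
  - intros x y. apply kernelQ_lipschitz_phi. lra.
  - intros x y. now apply kernelQ_lipschitz_phi.
  - intros x y. now apply kernelD_lipschitz_phi.
  - intros x. apply kernelQ_taylor; unfold r in *; lra.
Qed.

Lemma continuous_of_lipschitz (f : C -> C) (z : C) (d K : R) :
  0 < d -> 0 < K ->
  (forall w, Cmod (w - z) < d -> Cmod (f w - f z) <= K * Cmod (w - z)) ->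
  continuous_CC f z.
Proof.
  intros Hd HK H. apply C_continuous_eps. intros eps Heps.
  exists (Rmin d (eps / K)). split.
  apply Rmin_pos. easy. now apply Rdiv_lt_0_compat.
  intros w Hw. pose proof (Rmin_l d (eps / K)). pose proof (Rmin_r d (eps / K)).
  eapply Rle_lt_trans. apply H. lra.
  apply Rlt_le_trans with (K * (eps / K)). apply Rmult_lt_compat_l; lra. right. field. lra.
Qed.

Lemma continuous_cantor_D (rho : R) (z : C) :
  0 < rho <= / 2 -> Cmod z < 1 ->
  continuous_CC (cantor_D rho) z.
Proof.
  intros Hr Hz. set (r := (1 + Cmod z) / 2). pose proof (Cmod_ge_0 z).
  assert (Hr1 : r < 1) by (unfold r; lra).
  apply continuous_of_lipschitz with ((1 - Cmod z) / 2) (2 / ((1 - r) * (1 - r))). lra.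
  apply Rdiv_lt_0_compat. lra. nra.
  intros w Hw. apply Cmod_near in Hw.
  assert (Hw' : Cmod w <= r) by (unfold r; lra).
  replace (cantor_D rho w - cantor_D rho z)%C with
    (cantor_D rho w - cantor_D rho z - 0 * cantor_D rho z)%C by ring.
  eapply (cantor_lim_lin_bound rho).
  - easy.
  - intros x y. apply kernelD_lipschitz_phi. lra.
  - intros x y. now apply kernelD_lipschitz_phi.
  - intros x y. now apply kernelD_lipschitz_phi.
  - intros x. replace (kernelD x w - kernelD x z - 0 * kernelD x z)%C with (kernelD x w - kernelD x z)%C by ring.
    apply kernelD_lipschitz_z; unfold r in *; lra.
Qed.

(** Built from [cantor_D] so that its relation to the derivative of [cantor_Q] is immediate;
    [cantor_P_approx] identifies it as the limit of averaged Herglotz kernels. *)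
Definition cantor_P (rho : R) (z : C) : C := (1 + z * cantor_D rho z)%C.

Definition cantor_Pk (rho : R) (k : nat) (z : C) : C :=
  cantor_avgC rho k 1 (fun phi => herglotz phi z) 0.

Lemma cantor_Pk_D (rho : R) (k : nat) (z : C) :
  Cmod z < 1 -> cantor_Pk rho k z = (1 + z * cantor_avgC rho k 1 (fun phi => kernelD phi z) 0)%C.
Proof.
  intros Hz. unfold cantor_Pk.
  rewrite (cantor_avgC_ext _ _ _ _ (fun x => 1 * 1 + z * kernelD x z)%C).
  - rewrite cantor_avgC_lin, cantor_avgC_const. ring.
  - intros x. unfold herglotz, kernelD. field. now apply herglotz_den_neq_0.
Qed.

Lemma cantor_P_approx (rho : R) (z : C) (k : nat) :
  0 < rho <= / 2 -> Cmod z < 1 ->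
  Cmod (cantor_P rho z - cantor_Pk rho k z) <=
  16 / ((1 - Cmod z) * (1 - Cmod z)) * rho ^ k.
Proof.
  intros Hr Hz. rewrite cantor_Pk_D by easy. unfold cantor_P.
  replace (1 + z * cantor_D rho z - (1 + z * cantor_avgC rho k 1 (fun phi => kernelD phi z) 0))%C
    with (z * (cantor_D rho z - cantor_avgC rho k 1 (fun phi => kernelD phi z) 0))%C by ring.
  rewrite Cmod_mult.
  assert (H := cantor_lim_approx rho (fun phi => kernelD phi z) _ Hr
    (fun x y => kernelD_lipschitz_phi z x y Hz) k).
  fold (cantor_D rho z) in H. pose proof (Cmod_ge_0 z).
  pose proof (Cmod_ge_0 (cantor_D rho z - cantor_avgC rho k 1 (fun phi => kernelD phi z) 0)).
  eapply Rle_trans with (1 * _). apply Rmult_le_compat_r. easy. lra.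
  rewrite Rmult_1_l. eapply Rle_trans. apply H. right. field. lra.
Qed.

Lemma Re_herglotz (phi : R) (z : C) :
  Cmod z < 1 ->
  Re (herglotz phi z) =
  (1 - Cmod z * Cmod z) / (Cmod (1 - cis (- phi) * z) * Cmod (1 - cis (- phi) * z)).
Proof.
  intros Hz. assert (Hd := herglotz_den_neq_0 phi z Hz). unfold herglotz.
  rewrite <- (Cmod_cis_mult (- phi) z).
  generalize dependent (cis (- phi) * z)%C. intros w Hd.
  assert (Hw := proj1 (Cmod_gt_0 _) Hd).
  assert (H1 := Cmod_sq (1 - w)). assert (H2 := Cmod_sq w).
  rewrite H2. rewrite H1 in *. clear H2.
  assert (H3 : 0 < Re (1 - w) * Re (1 - w) + Im (1 - w) * Im (1 - w)) by (rewrite <- H1; nra).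
  destruct w as [a b]. unfold Re, Im in *; simpl in *. field. lra.
Qed.

Lemma Re_cantor_P_pos (rho : R) (z : C) :
  0 < rho <= / 2 -> Cmod z < 1 -> 0 < Re (cantor_P rho z).
Proof.
  intros Hr Hz. pose proof (Cmod_ge_0 z).
  (* A limit preserves only weak inequalities, so strict positivity is obtained from a positive
     bound independent of k: the minimum of the Poisson kernel over all angles. *)
  set (B := (1 - Cmod z * Cmod z) / ((1 + Cmod z) * (1 + Cmod z))).
  assert (HB : 0 < B) by (apply Rdiv_lt_0_compat; nra).
  apply Rlt_le_trans with B. easy.
  apply le_of_geometric with (rho := rho) (K := 16 / ((1 - Cmod z) * (1 - Cmod z))). easy.
  intros k.
  assert (H1 := cantor_P_approx rho z k Hr Hz).
  assert (H2 : B <= Re (cantor_Pk rho k z)).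
  { unfold cantor_Pk, cantor_avgC. unfold Re at 1; cbn [fst].
    rewrite <- (cantor_avg_const rho k 1 B 0) at 1.
    apply cantor_avg_le_pt. intros x _. rewrite Re_herglotz by easy. unfold B.
    assert (Hd := proj1 (Cmod_gt_0 _) (herglotz_den_neq_0 x z Hz)).
    assert (Hd2 := Cmod_triangle_minus 1 (cis (- x) * z)).
    rewrite Cmod_1, Cmod_cis_mult in Hd2.
    unfold Rdiv. apply Rmult_le_compat_l. nra. apply Rinv_le_contravar; nra. }
  assert (H3 := re_le_Cmod (cantor_P rho z - cantor_Pk rho k z)).
  replace (Re (cantor_P rho z - cantor_Pk rho k z)) with
    (Re (cantor_P rho z) - Re (cantor_Pk rho k z)) in H3 by (unfold Re; simpl; ring).
  apply Rabs_le_between in H3. lra.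
Qed.

(** * The logarithmic potential of the Cantor measure *)

Lemma cis_separation (a b : R) : 0 <= b - a <= / 4 -> (b - a) / 4 <= Cmod (cis b - cis a).
Proof.
  intros H. set (d := b - a) in *.
  assert (E : (cis b - cis a)%C = (cis a * (Cexp (Ci * RtoC d) - 1))%C).
  { rewrite Cexp_Ci. replace (cis b) with (cis (a + d)) by (f_equal; unfold d; ring).
    rewrite cis_plus. ring. }
  rewrite E, Cmod_cis_mult.
  assert (Hm : Cmod (Ci * RtoC d) = d) by (rewrite Cmod_mult, Cmod_Ci, Cmod_R, Rabs_pos_eq; lra).
  assert (T := Cexp_taylor (Ci * RtoC d)). rewrite Hm in T.
  assert (He : exp d <= 3).
  { apply Rle_trans with (exp 1). 2: apply exp_le_3. left. apply exp_increasing. lra. }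
  assert (G := Cmod_triangle_inv (Ci * RtoC d) (- (Cexp (Ci * RtoC d) - 1 - Ci * RtoC d))).
  replace (Ci * RtoC d - - (Cexp (Ci * RtoC d) - 1 - Ci * RtoC d))%C with (Cexp (Ci * RtoC d) - 1)%C
    in G by ring.
  rewrite Cmod_opp, Hm in G.
  (* What remains is d - 3 d^2 >= d / 4, which is where the hypothesis d <= 1/4 enters. *)
  assert (d * d * exp d <= d * d * 3) by (apply Rmult_le_compat_l; nra). nra.
Qed.

Lemma herglotz_den_dist (phi : R) (z : C) : Cmod (1 - cis (- phi) * z) = Cmod (cis phi - z).
Proof.
  rewrite <- (Cmod_cis_mult phi (1 - cis (- phi) * z)). f_equal.
  transitivity (cis phi - (cis (- phi) * cis phi) * z)%C. ring. rewrite cis_opp_mult. ring.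
Qed.

Lemma neg_ln_le (x y : R) : 0 < y -> y <= x -> - ln x <= - ln y.
Proof. intros H0 H. apply Ropp_le_contravar. now apply ln_le. Qed.

Lemma ln_pow_rho (rho : R) (m : nat) : 0 < rho -> ln (rho ^ m) = INR m * ln rho.
Proof. intros H. now apply ln_pow. Qed.

(* At every level [z] is far from at least one of the two halves, so that half has potential
   at most [ln 16 - m ln rho]; the bounds [ln 16 - (m + 1) ln rho] then reproduce themselves. *)
Lemma cantor_potential (rho : R) (z : C) (k m : nat) (phi : R) :
  0 < rho <= / 8 -> Cmod z < 1 -> (1 <= m)%nat ->
  cantor_avg rho k m (fun psi => - ln (Cmod (1 - cis (- psi) * z))) phi <=
  ln 16 - (INR m + 1) * ln rho + (/ 2) ^ k * (- ln (1 - Cmod z)).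
Proof.
  intros Hr Hz. revert m phi. induction k as [|k IH]; intros m phi Hm.
  (* The crude bound by - ln (1 - |z|) enters only here; each further level halves its weight, so it
     disappears as k grows. *)
  - simpl. pose proof (herglotz_den phi z).
    pose proof (neg_ln_le (Cmod (1 - cis (- phi) * z)) (1 - Cmod z) ltac:(lra) H).
    assert (0 < ln 16) by (rewrite <- ln_1; apply ln_increasing; lra).
    assert (ln rho < 0) by (rewrite <- ln_1; apply ln_increasing; lra).
    pose proof (pos_INR m). nra.
  - simpl cantor_avg.
    assert (H1 := IH (S m) phi ltac:(lia)). assert (H2 := IH (S m) (phi + rho ^ m) ltac:(lia)).
    rewrite S_INR in H1, H2.
    set (G := fun psi => - ln (Cmod (1 - cis (- psi) * z))) in *.
    assert (Hp : 0 < rho ^ m) by (apply pow_lt; lra).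
    assert (Hp1 : rho ^ m <= / 8).
    { destruct m as [|m]. lia. pose proof (pow_le_1_compat rho m ltac:(lra)). simpl. nra. }
    assert (far : forall psi, rho ^ m / 16 <= Cmod (cis psi - z) -> G psi <= ln 16 - INR m * ln rho).
    { intros psi Hpsi. unfold G. rewrite herglotz_den_dist.
      eapply Rle_trans. apply neg_ln_le. 2: apply Hpsi. lra.
      rewrite ln_div by lra. rewrite ln_pow_rho by lra. lra. }
    assert (Hfar : cantor_avg rho k (S m) G phi <= ln 16 - INR m * ln rho \/
      cantor_avg rho k (S m) G (phi + rho ^ m) <= ln 16 - INR m * ln rho).
    { destruct (classic (exists psi, cantor_pt rho k (S m) phi psi /\ Cmod (cis psi - z) < rho ^ m / 16))
        as [[psi [Hpsi Hlt]]|Hno].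
      - right. rewrite <- (cantor_avg_const rho k (S m) (ln 16 - INR m * ln rho) (phi + rho ^ m)).
        apply cantor_avg_le_pt. intros psi' Hpsi'. apply far.
        apply cantor_pt_bounds in Hpsi; [|lra]. apply cantor_pt_bounds in Hpsi'; [|lra].
        simpl in Hpsi, Hpsi'.
        assert (Hsep := cis_separation psi psi').
        (* The halves start rho^m apart and have length at most 2 rho^(m+1) <= rho^m / 4. By
           [cis_separation] their points are rho^m / 8 apart on the circle, so [z] cannot be within
           rho^m / 16 of both halves; this is the origin of ln 16. *)
        assert (Hd : rho ^ m / 2 <= psi' - psi <= 2 * rho ^ m) by nra.
        specialize (Hsep ltac:(lra)).
        assert (T := Cmod_triangle_minus (cis psi' - z) (cis psi - z)).
        replace (cis psi' - z - (cis psi - z))%C with (cis psi' - cis psi)%C in T by ring. lra.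
      - left. rewrite <- (cantor_avg_const rho k (S m) (ln 16 - INR m * ln rho) phi).
        apply cantor_avg_le_pt. intros psi Hpsi. apply far. apply Rnot_lt_le. intros Hlt.
        apply Hno. now exists psi. }
    (* The far half contributes - m ln rho and the other one - (m + 2) ln rho; their mean is - (m +
       1) ln rho. *)
    simpl pow. lra.
Qed.

(** The real part is twice the potential, bounded above by [cantor_potential] with m = 1 and below
    because |1 - w| <= 2 in the disk; the imaginary part is bounded by the branch [Clog]. *)
Lemma cantor_Q_bounded (rho : R) :
  0 < rho <= / 8 -> exists B, 0 < B /\ forall z, Cmod z < 1 -> Cmod (cantor_Q rho z) <= B.
Proof.
  intros Hr. set (B1 := 2 * (ln 16 - 2 * ln rho)).
  assert (Hl16 : 0 < ln 16) by (rewrite <- ln_1; apply ln_increasing; lra).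
  assert (Hl2 : 0 < ln 2) by (rewrite <- ln_1; apply ln_increasing; lra).
  assert (Hlr : ln rho < 0) by (rewrite <- ln_1; apply ln_increasing; lra).
  assert (HPI := PI_RGT_0).
  exists (B1 + 2 * ln 2 + PI). split. unfold B1. lra.
  intros z Hz.
  assert (Happ := fun k => cantor_lim_approx rho (fun phi => kernelQ phi z) _ ltac:(lra)
    (fun x y => kernelQ_lipschitz_phi z x y Hz) k).
  fold (cantor_Q rho z) in Happ.
  assert (HRe : forall k, - (2 * ln 2) <= Re (cantor_avgC rho k 1 (fun phi => kernelQ phi z) 0) <=
    B1 + 2 * (/ 2) ^ k * (- ln (1 - Cmod z))).
  { intros k. unfold cantor_avgC. unfold Re at 1 3; cbn [fst].
    assert (E : forall phi, Re (kernelQ phi z) = 2 * (- ln (Cmod (1 - cis (- phi) * z)))).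
    { intros phi. unfold kernelQ. rewrite <- Re_Clog. unfold Re; simpl. ring. }
    rewrite (cantor_avg_ext _ _ _ _ _ _ E).
    rewrite cantor_avg_scal. split.
    - assert (L : - ln 2 <= cantor_avg rho k 1 (fun psi => - ln (Cmod (1 - cis (- psi) * z))) 0).
      { rewrite <- (cantor_avg_const rho k 1 (- ln 2) 0). apply cantor_avg_le_pt.
        intros psi _. pose proof (herglotz_den psi z). apply neg_ln_le. lra.
        pose proof (Cmod_triangle_minus 1 (cis (- psi) * z)). rewrite Cmod_1, Cmod_cis_mult in H0. lra. }
      lra.
    - assert (U := cantor_potential rho z k 1 0 Hr Hz (le_n 1)). simpl INR in U. unfold B1. lra. }
  assert (HIm : forall k, Rabs (Im (cantor_avgC rho k 1 (fun phi => kernelQ phi z) 0)) <= PI).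
  { intros k. unfold cantor_avgC. unfold Im at 1; cbn [snd].
    assert (E : forall phi, Rabs (Im (kernelQ phi z)) <= PI).
    { intros phi. unfold kernelQ. pose proof (Im_Clog_bound (1 - cis (- phi) * z)).
      replace (Im (- (2) * Clog (1 - cis (- phi) * z))) with (-2 * Im (Clog (1 - cis (- phi) * z)))
        by (unfold Im; simpl; ring).
      rewrite Rabs_mult, Rabs_left by lra. lra. }
    apply Rabs_le. split.
    - rewrite <- (cantor_avg_const rho k 1 (- PI) 0). apply cantor_avg_le_pt.
      intros psi _. specialize (E psi). apply Rabs_le_between in E. lra.
    - rewrite <- (cantor_avg_const rho k 1 PI 0). apply cantor_avg_le_pt.
      intros psi _. specialize (E psi). apply Rabs_le_between in E. lra. }
  set (L := 8 * (2 / (1 - Cmod z))) in *.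
  assert (HL : 0 <= L) by (unfold L; apply Rmult_le_pos; [lra | apply Rdiv_le_0_compat; lra]).
  assert (Hlz : 0 <= - ln (1 - Cmod z)).
  { pose proof (Cmod_ge_0 z). rewrite <- Ropp_0, <- ln_1. apply neg_ln_le; lra. }
  (* The constant depends on [z], but it is multiplied by a quantity tending to 0, so the bound in
     the limit does not. The ratio 1/2 dominates both rho^k and the halving term of the
     potential. *)
  apply le_of_geometric with (rho := / 2) (K := L + L + 2 * (- ln (1 - Cmod z))). lra.
  intros k. specialize (Happ k). specialize (HRe k). specialize (HIm k).
  set (q := cantor_avgC rho k 1 (fun phi => kernelQ phi z) 0) in *.
  assert (Hp : rho ^ k <= (/ 2) ^ k) by (apply pow_incr; lra).
  assert (Hp0 : 0 < (/ 2) ^ k) by (apply pow_lt; lra).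
  assert (Happ' : Cmod (cantor_Q rho z - q) <= L * (/ 2) ^ k).
  { eapply Rle_trans. apply Happ. now apply Rmult_le_compat_l. }
  assert (HRe' : Rabs (Re q) <= B1 + 2 * ln 2 + 2 * (/ 2) ^ k * (- ln (1 - Cmod z))).
  { apply Rabs_le. assert (0 <= 2 * (/ 2) ^ k * (- ln (1 - Cmod z))) by (apply Rmult_le_pos; lra).
    unfold B1 in *. lra. }
  assert (T := Cmod_triangle (cantor_Q rho z - q) q).
  replace (cantor_Q rho z - q + q)%C with (cantor_Q rho z) in T by ring.
  assert (T2 := Cmod_le_sum q).
  assert (0 <= L * (/ 2) ^ k) by (apply Rmult_le_pos; lra). lra.
Qed.

(** * Lower bounds for the circle means of |P| *)

Lemma cantor_Pk_derive (rho : R) (k : nat) (z : C) :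
  Cmod z < 1 ->
  cderiv (cantor_Pk rho k) z (cantor_avgC rho k 1 (fun phi => dherglotz phi z) 0).
Proof.
  intros Hz. apply (cderiv_cantor_avgC rho k 1 herglotz). intros psi. now apply cderiv_herglotz.
Qed.

Lemma Re_cantor_Pk (rho : R) (k : nat) (z : C) :
  Re (cantor_Pk rho k z) = cantor_avg rho k 1 (fun phi => Re (herglotz phi z)) 0.
Proof. reflexivity. Qed.

Lemma Im_cantor_Pk (rho : R) (k : nat) (z : C) :
  Im (cantor_Pk rho k z) = cantor_avg rho k 1 (fun phi => Im (herglotz phi z)) 0.
Proof. reflexivity. Qed.

Lemma Re_herglotz_pos (phi : R) (z : C) : Cmod z < 1 -> 0 < Re (herglotz phi z).
Proof.
  intros Hz. rewrite Re_herglotz by easy. pose proof (herglotz_den phi z). pose proof (Cmod_ge_0 z).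
  apply Rdiv_lt_0_compat; nra.
Qed.

Lemma Re_cantor_Pk_pos (rho : R) (k : nat) (z : C) : Cmod z < 1 -> 0 < Re (cantor_Pk rho k z).
Proof.
  intros Hz.
  assert (H : forall m phi, 0 < cantor_avg rho k m (fun phi => Re (herglotz phi z)) phi).
  { induction k as [|k IH]; intros m phi. now apply Re_herglotz_pos.
    pose proof (IH (S m) phi). pose proof (IH (S m) (phi + rho ^ m)). cbn [cantor_avg]. lra. }
  apply H.
Qed.

Lemma cantor_Pk_0 (rho : R) (k : nat) : cantor_Pk rho k 0 = 1.
Proof. rewrite cantor_Pk_D by (rewrite Cmod_0; lra). ring. Qed.

(* [psi] lies in a Cantor cylinder of mass [2^-n], whose length is comparable to [rho^n]. *)
Lemma Re_cantor_Pk_lower (rho R0 psi : R) (n k : nat) :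
  0 < rho <= / 2 -> 0 < R0 < 1 -> rho ^ n <= 1 - R0 -> (n <= k)%nat -> cantor_pt rho k 1 0 psi ->
  (/ 2) ^ n * (/ (4 * (1 - R0))) <= Re (cantor_Pk rho k (RtoC R0 * cis psi)).
Proof.
  intros Hr HR Hn Hk Hpsi. rewrite Re_cantor_Pk.
  assert (Hmod : Cmod (RtoC R0 * cis psi) = R0) by (apply Cmod_circle; lra).
  apply cantor_avg_lower with psi; try easy.
  - intros x. left. apply Re_herglotz_pos. lra.
  - intros x Hx. rewrite Re_herglotz by lra. rewrite Hmod, herglotz_den_dist.
    assert (Hd : 1 - R0 <= Cmod (cis x - RtoC R0 * cis psi)).
    { rewrite <- herglotz_den_dist. pose proof (herglotz_den x (RtoC R0 * cis psi)). lra. }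
    (* As the digits start at exponent 1, the distance from x to psi is at most 2 rho^(1 + n) <=
       rho^n <= 1 - R0. *)
    assert (Hu : Cmod (cis x - RtoC R0 * cis psi) <= 2 * (1 - R0)).
    { replace (cis x - RtoC R0 * cis psi)%C with ((cis x - cis psi) + RtoC (1 - R0) * cis psi)%C
        by (rewrite RtoC_minus; ring).
      eapply Rle_trans. apply Cmod_triangle. rewrite Cmod_circle by lra.
      pose proof (cis_lipschitz x psi). simpl in Hx.
      assert (0 < rho ^ n) by (apply pow_lt; lra). nra. }
    apply Rle_trans with ((1 - R0 * R0) / ((2 * (1 - R0)) * (2 * (1 - R0)))).
    + replace ((1 - R0 * R0) / (2 * (1 - R0) * (2 * (1 - R0)))) with ((1 + R0) * / (4 * (1 - R0)))
        by (field; lra).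
      assert (0 < / (4 * (1 - R0))) by (apply Rinv_0_lt_compat; lra). nra.
    + unfold Rdiv. apply Rmult_le_compat_l. nra. apply Rinv_le_contravar; nra.
Qed.

(** The duality argument is run at a finite level: there the average commutes with the circle
    integral as a finite sum, and the logarithm is that of [cantor_Pk] itself. The bound does not
    depend on k as long as n <= k. *)
Lemma circle_mean_Pk_lower (rho r : R) (n k : nat) :
  0 < rho <= / 2 -> 0 < r < 1 -> rho ^ n <= 1 - r * r -> (n <= k)%nat ->
  4 * (- ln (1 - r * r) - INR n * ln 2 - ln 4) <=
  RInt (fun t => Cmod (cantor_Pk rho k (RtoC r * cis t))) 0 (2 * PI).
Proof.
  intros Hr Hr1 Hn Hk. assert (HPI := PI_RGT_0).
  set (h := fun z => Clog (cantor_Pk rho k z)).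
  set (dh := fun z => (/ cantor_Pk rho k z * cantor_avgC rho k 1 (fun phi => dherglotz phi z) 0)%C).
  assert (Hh : forall z, Cmod z < 1 -> cderiv h z (dh z)).
  { intros z Hz. apply (cderiv_comp (cantor_Pk rho k) Clog). now apply cantor_Pk_derive.
    apply cderiv_Clog. now apply Re_cantor_Pk_pos. }
  assert (Hdh : forall z, Cmod z < 1 -> continuous_CC dh z).
  { intros z Hz. apply continuous_Cmult.
    - apply (continuous_comp (V := C_UniformSpace) (cantor_Pk rho k) Cinv).
      eapply cderiv_continuous. now apply cantor_Pk_derive.
      apply continuous_Cinv. intros H0. pose proof (Re_cantor_Pk_pos rho k z Hz).
      rewrite H0 in H. unfold Re in H; simpl in H. lra.
    - apply continuous_C_pair; apply (continuous_cantor_avg C_UniformSpace); intros psi.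
      + apply continuous_Re_comp. now apply continuous_dherglotz.
      + apply continuous_Im_comp. now apply continuous_dherglotz. }
  set (z := fun t => (RtoC r * cis t)%C).
  assert (Hz : forall t, Cmod (z t) < 1) by (intros; unfold z; rewrite Cmod_circle; lra).
  assert (Hcz : forall t, continuous_RC (fun s => h (z s)) t).
  { intros t. apply (continuous_comp (V := C_UniformSpace) z h). apply continuous_circle.
    eapply cderiv_continuous, Hh, Hz. }
  assert (Hcp : forall t, continuous_RC
    (fun s => cantor_Pk rho k (z s)) t).
  { intros t. apply (continuous_comp (V := C_UniformSpace) z). apply continuous_circle.
    eapply cderiv_continuous, cantor_Pk_derive, Hz. }
  assert (Hch : forall phi t, continuous_RC
    (fun s => herglotz phi (z s)) t).
  { intros phi t. apply (continuous_comp (V := C_UniformSpace) z). apply continuous_circle.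
    eapply cderiv_continuous, cderiv_herglotz, Hz. }
  assert (I1 : RInt (fun t => Im (cantor_Pk rho k (z t)) * Im (h (z t))) 0 (2 * PI) =
    cantor_avg rho k 1 (fun phi => 2 * PI * (Re (h (RtoC (r * r) * cis phi)%C))) 0).
  { rewrite (RInt_ext _ (fun t => cantor_avg rho k 1
      (fun phi => Im (herglotz phi (z t)) * Im (h (z t))) 0)).
    - rewrite (RInt_cantor_avg rho k 1 (fun phi t => Im (herglotz phi (z t)) * Im (h (z t)))).
      + apply cantor_avg_ext. intros phi.
        apply eq_trans with (1 := RInt_Im_herglotz h dh phi r Hr1 Hh Hdh).
        assert (Eh : h 0 = 0) by (unfold h; rewrite cantor_Pk_0; apply Clog_1).
        rewrite Eh. change (Re 0) with 0. now rewrite Rminus_0_r.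
      + intros phi t. apply (continuous_mult (K := R_AbsRing)); apply continuous_Im_comp.
        apply Hch. apply Hcz.
    - intros t _. rewrite Im_cantor_Pk, Rmult_comm.
      rewrite <- cantor_avg_scal. apply cantor_avg_ext. intros; ring. }
  assert (I2 : RInt (fun t => Im (cantor_Pk rho k (z t)) * Im (h (z t))) 0 (2 * PI) <=
    RInt (fun t => scal (PI / 2) (Cmod (cantor_Pk rho k (z t)))) 0 (2 * PI)).
  { apply RInt_le. lra.
    - apply ex_RInt_continuous_all. intros t. apply (continuous_mult (K := R_AbsRing)); apply continuous_Im_comp.
      apply Hcp. apply Hcz.
    - apply (ex_RInt_scal (V := R_NormedModule)). apply ex_RInt_continuous_all. intros t.
      apply (continuous_comp (V := C_UniformSpace) (fun t => cantor_Pk rho k (z t)) Cmod).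
      apply Hcp. apply continuous_Cmod.
    - intros t _. change (Im (cantor_Pk rho k (z t)) * Im (h (z t)) <= PI / 2 * Cmod (cantor_Pk rho k (z t))).
      eapply Rle_trans. apply Rle_abs. rewrite Rabs_mult, Rmult_comm.
      apply Rmult_le_compat; try apply Rabs_pos. apply Im_Clog_bound. apply im_le_Cmod. }
  rewrite (RInt_scal (V := R_CompleteNormedModule)) in I2.
  2: { apply ex_RInt_continuous_all. intros t.
       apply (continuous_comp (V := C_UniformSpace) (fun t => cantor_Pk rho k (z t)) Cmod).
       apply Hcp. apply continuous_Cmod. }
  set (J := RInt (fun t => Cmod (cantor_Pk rho k (z t))) 0 (2 * PI)) in *.
  change (scal (PI / 2) J) with (PI / 2 * J) in I2.
  rewrite I1, cantor_avg_scal in I2.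
  set (B := - ln (1 - r * r) - INR n * ln 2 - ln 4).
  assert (I3 : B <= cantor_avg rho k 1 (fun phi => Re (h (RtoC (r * r) * cis phi)%C)) 0).
  { rewrite <- (cantor_avg_const rho k 1 B 0). apply cantor_avg_le_pt.
    intros psi Hpsi. unfold h. rewrite Re_Clog.
    assert (Hrr : 0 < r * r < 1) by nra.
    assert (Hlow := Re_cantor_Pk_lower rho (r * r) psi n k Hr Hrr Hn Hk Hpsi).
    assert (Hp2 : 0 < (/ 2) ^ n) by (apply pow_lt; lra).
    assert (Hi : 0 < / (4 * (1 - r * r))) by (apply Rinv_0_lt_compat; lra).
    apply Rle_trans with (ln ((/ 2) ^ n * / (4 * (1 - r * r)))).
    - rewrite ln_mult, ln_pow, !ln_Rinv, ln_mult by lra. unfold B. lra.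
    - apply ln_le. nra.
      eapply Rle_trans. apply Hlow. eapply Rle_trans. apply Rle_abs. apply re_le_Cmod. }
  apply Rmult_le_reg_l with (PI / 2). lra.
  (* The factor 4 is the quotient of 2 pi, from Cauchy's formula, by the bound pi / 2 on |Im h|. *)
  replace (PI / 2 * (4 * B)) with (2 * PI * B) by field.
  eapply Rle_trans. 2: apply I2. apply Rmult_le_compat_l; lra.
Qed.

Lemma continuous_cantor_P (rho : R) (z : C) :
  0 < rho <= / 2 -> Cmod z < 1 ->
  continuous_CC (cantor_P rho) z.
Proof.
  intros Hr Hz. apply continuous_Cplus. apply continuous_const.
  apply continuous_Cmult. apply continuous_id. now apply continuous_cantor_D.
Qed.

Lemma continuous_Cmod_cantor_P_circle (rho r t : R) :
  0 < rho <= / 2 -> 0 < r < 1 ->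
  continuous_RR
    (fun t => Cmod (cantor_P rho (RtoC r * cis t))) t.
Proof.
  intros Hr Hr1.
  apply (continuous_comp (V := C_UniformSpace) (fun t => cantor_P rho (RtoC r * cis t)%C) Cmod).
  2: apply continuous_Cmod.
  apply (continuous_comp (V := C_UniformSpace) (fun t => (RtoC r * cis t)%C)).
  apply continuous_circle. apply continuous_cantor_P. easy. rewrite Cmod_circle; lra.
Qed.

Lemma circle_mean_P_lower_n (rho r : R) (n : nat) :
  0 < rho <= / 2 -> 0 < r < 1 -> rho ^ n <= 1 - r * r ->
  4 * (- ln (1 - r * r) - INR n * ln 2 - ln 4) <=
  RInt (fun t => Cmod (cantor_P rho (RtoC r * cis t))) 0 (2 * PI).
Proof.
  intros Hr Hr1 Hn. assert (HPI := PI_RGT_0).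
  set (K := 16 / ((1 - r) * (1 - r))).
  assert (HK : 0 < K) by (apply Rdiv_lt_0_compat; nra).
  apply le_of_geometric with (rho := rho) (K := 2 * PI * K). easy.
  intros k0.
  (* The shift by n ensures n <= k, while the error is still at most K rho^k0. *)
  set (k := (k0 + n)%nat).
  assert (H1 := circle_mean_Pk_lower rho r n k Hr Hr1 Hn ltac:(unfold k; lia)).
  eapply Rle_trans. apply H1.
  assert (Hex : ex_RInt (fun t => Cmod (cantor_P rho (RtoC r * cis t))) 0 (2 * PI)).
  { apply ex_RInt_continuous_all. intros t. now apply continuous_Cmod_cantor_P_circle. }
  apply Rle_trans with (RInt (fun t => plus (Cmod (cantor_P rho (RtoC r * cis t))) (K * rho ^ k0)) 0 (2 * PI)).
  - apply RInt_le. lra.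
    + apply ex_RInt_continuous_all. intros t.
      apply (continuous_comp (V := C_UniformSpace) (fun t => cantor_Pk rho k (RtoC r * cis t)%C) Cmod).
      2: apply continuous_Cmod.
      apply (continuous_comp (V := C_UniformSpace) (fun t => (RtoC r * cis t)%C)).
      apply continuous_circle. eapply cderiv_continuous, cantor_Pk_derive. rewrite Cmod_circle; lra.
    + apply (ex_RInt_plus (V := R_NormedModule)). exact Hex. apply ex_RInt_const.
    + intros t _. assert (Hm : Cmod (RtoC r * cis t) = r) by (apply Cmod_circle; lra).
      assert (A1 := cantor_P_approx rho (RtoC r * cis t) k Hr ltac:(lra)). rewrite Hm in A1.
      assert (A2 := Cmod_triangle_inv (cantor_Pk rho k (RtoC r * cis t)) (cantor_P rho (RtoC r * cis t))).
      rewrite Cmod_minus_sym in A2.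
      change (Cmod (cantor_Pk rho k (RtoC r * cis t)) <= Cmod (cantor_P rho (RtoC r * cis t)) + K * rho ^ k0).
      assert (K * rho ^ k <= K * rho ^ k0).
      { apply Rmult_le_compat_l. lra. unfold k. rewrite pow_add.
        pose proof (pow_le_1_compat rho k0 ltac:(lra)). pose proof (pow_le_1_compat rho n ltac:(lra)). nra. }
      fold K in A1. lra.
  - rewrite (RInt_plus (V := R_CompleteNormedModule)), RInt_const; try easy.
    2: apply ex_RInt_const.
    right. apply Rplus_eq_compat_l. change ((2 * PI - 0) * (K * rho ^ k0) = 2 * PI * K * rho ^ k0). ring.
Qed.

Lemma pow_bracket (rho x : R) :
  0 < rho <= / 2 -> 0 < x < 1 ->
  exists n, rho ^ n <= x /\ INR n <= 1 + ln x / ln rho.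
Proof.
  intros Hr Hx.
  assert (Hlr : ln rho < 0) by (rewrite <- ln_1; apply ln_increasing; lra).
  assert (Hlx : ln x < 0) by (rewrite <- ln_1; apply ln_increasing; lra).
  destruct (nfloor_ex (ln x / ln rho)) as [n Hn].
  { replace (ln x / ln rho) with ((- ln x) / (- ln rho)) by (field; lra).
    apply Rdiv_le_0_compat; lra. }
  (* The floor is rounded up: rho^n <= x needs n at least ln x / ln rho. *)
  exists (S n). rewrite S_INR. split. 2: lra.
  assert (H : ln (rho ^ S n) <= ln x).
  { rewrite ln_pow, S_INR by lra.
    replace (ln x) with (ln x / ln rho * ln rho) by (field; lra). nra. }
  apply Rnot_lt_le. intros Hc. apply ln_increasing in Hc; lra.
Qed.

(** The depth n is the least that resolves the scale 1 - r^2, up to rounding. The loss 4 ln 2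
    collects ln 2 from the rounding, ln 4, and ln 2 from 1 - r^2 <= 2 (1 - r). *)
Lemma circle_mean_P_lower (rho r : R) :
  0 < rho <= / 2 -> 0 < r < 1 ->
  4 * ((1 + ln 2 / ln rho) * (- ln (1 - r)) - 4 * ln 2) <=
  RInt (fun t => Cmod (cantor_P rho (RtoC r * cis t))) 0 (2 * PI).
Proof.
  intros Hr Hr1.
  destruct (pow_bracket rho (1 - r * r) Hr ltac:(nra)) as [n [Hn1 Hn2]].
  eapply Rle_trans. 2: apply (circle_mean_P_lower_n rho r n Hr Hr1 Hn1).
  assert (Hlr : ln rho <= - ln 2) by (rewrite <- ln_Rinv by lra; apply ln_le; lra).
  assert (Hl2 : 0 < ln 2) by (rewrite <- ln_1; apply ln_increasing; lra).
  assert (H4 : ln 4 = 2 * ln 2) by (replace 4 with (2 * 2) by ring; rewrite ln_mult; lra).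
  assert (Hx : ln (1 - r * r) <= ln 2 + ln (1 - r)).
  { rewrite <- ln_mult by lra. apply ln_le; nra. }
  (* The dimension of the Cantor set. *)
  set (al := - (ln 2 / ln rho)).
  assert (Hal : 0 <= al <= 1).
  { unfold al. replace (- (ln 2 / ln rho)) with (ln 2 / - ln rho) by (field; lra).
    split. apply Rdiv_le_0_compat; lra. apply Rle_div_l; lra. }
  assert (E : INR n * ln 2 <= ln 2 + al * (- ln (1 - r * r))).
  { replace (ln 2 + al * (- ln (1 - r * r))) with ((1 + ln (1 - r * r) / ln rho) * ln 2)
      by (unfold al; field; lra).
    apply Rmult_le_compat_r; lra. }
  replace (1 + ln 2 / ln rho) with (1 - al) by (unfold al; ring).
  nra.
Qed.

(** * A criterion for spirallikeness *)

(** A quarter-turn rotation brings every nonzero w into the right half-plane, where [Clog] inverts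
    [Cexp]. *)
Lemma Cexp_surj (w : C) : w <> 0 -> exists z, Cexp z = w.
Proof.
  intros Hw.
  assert (rot : forall t, 0 < Re (cis (- t) * w) -> exists z, Cexp z = w).
  { intros t Ht. exists (Clog (cis (- t) * w) + Ci * RtoC t)%C.
    rewrite Cexp_plus, Cexp_Clog, Cexp_Ci by easy.
    transitivity ((cis (- t) * cis t) * w)%C. ring. rewrite cis_opp_mult. ring. }
  destruct (Rtotal_order 0 (Re w)) as [H|[H|H]].
  - apply (rot 0). replace (- 0) with 0 by ring. now rewrite cis_0, Cmult_1_l.
  - destruct (Rtotal_order 0 (Im w)) as [H1|[H1|H1]].
    + apply (rot (PI / 2)). unfold cis. rewrite cos_neg, sin_neg, cos_PI2, sin_PI2.
      unfold Re, Im in *; simpl. lra.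
    + exfalso. apply Hw. destruct w as [x y]. unfold Re, Im in *; simpl in *. now subst.
    + apply (rot (- (PI / 2))). unfold cis. rewrite Ropp_involutive, cos_PI2, sin_PI2.
      unfold Re, Im in *; simpl. lra.
  - apply (rot PI). unfold cis. rewrite cos_neg, sin_neg, cos_PI, sin_PI.
    unfold Re, Im in *; simpl. lra.
Qed.

Lemma Cexp_eq (a b : C) : Cexp a = Cexp b -> exists d, a = (b + Ci * RtoC d)%C /\ cis d = 1.
Proof.
  intros H. assert (HRe : Re a = Re b).
  { assert (E := f_equal Cmod H). rewrite !Cmod_Cexp in E. now apply exp_inv. }
  exists (Im a - Im b). split.
  - destruct a as [x y], b as [u v]. unfold Re, Im in *; simpl in *. subst.
    unfold Cplus, Cmult; simpl. f_equal; ring.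
  - replace (cis (Im a - Im b)) with (Cexp (a - b)).
    + unfold Cminus. rewrite Cexp_plus, Cexp_opp, H. field. apply Cexp_neq_0.
    + rewrite <- Cexp_Ci. f_equal. destruct a as [x y], b as [u v]. unfold Re, Im in *; simpl in *. subst.
      unfold Cminus, Cplus, Cmult, Copp; simpl. f_equal; ring.
Qed.

Lemma Cmod_Cexp_lt_1 (z : C) : Re z < 0 -> Cmod (Cexp z) < 1.
Proof. intros H. rewrite Cmod_Cexp, <- exp_0. now apply exp_increasing. Qed.

Lemma Cmod_pair_le (x y : R) : Cmod (x, y) <= Rabs x + Rabs y.
Proof. apply (Cmod_le_sum (x, y)). Qed.

(** * Level lines of [Im G] in logarithmic coordinates *)

Section Spirallike.

Variables (lam M : R) (g dg : C -> C).
Hypothesis Hlam : - (PI / 2) < lam < PI / 2.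
Hypothesis Hg : forall z, Cmod z < 1 -> cderiv g z (dg z).
Hypothesis HM : forall z, Cmod z < 1 -> Cmod (g z) <= M.
Hypothesis Hpos : forall z, Cmod z < 1 -> 0 < Re (cis (- lam) * (1 + z * dg z)).

Let f (z : C) : C := (z * Cexp (g z))%C.
(* [f] in logarithmic coordinates, rotated so that spirals become horizontal half-lines. *)
Let G (z : C) : C := (cis (- lam) * (z + g (Cexp z)))%C.

Lemma spiral_cos : 0 < cos lam.
Proof. now apply cos_gt_0. Qed.

Lemma spiral_fG (z : C) : f (Cexp z) = Cexp (cis lam * G z).
Proof.
  unfold f, G. rewrite <- Cexp_plus. f_equal.
  transitivity ((cis (- lam) * cis lam) * (z + g (Cexp z)))%C. 2: ring. rewrite cis_opp_mult. ring.
Qed.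

Lemma spiral_dG (z : C) :
  Re z < 0 -> cderiv G z (cis (- lam) * (1 + Cexp z * dg (Cexp z)))%C.
Proof.
  intros Hz. apply cderiv_scal. apply cderiv_plus. apply cderiv_id.
  apply (cderiv_eq _ _ (dg (Cexp z) * Cexp z)%C). ring.
  apply (cderiv_comp Cexp g). apply cderiv_Cexp. apply Hg. now apply Cmod_Cexp_lt_1.
Qed.

(** The Noshiro-Warschawski argument: [Hpos] says that G' has positive real part on the convex left
    half-plane, hence so have the difference quotients. Injectivity and the two monotonicity lemmas
    below all follow from this factorization. *)
Lemma spiral_quotient (a b : C) :
  Re a < 0 -> Re b < 0 -> exists A, 0 < Re A /\ (G b - G a = (b - a) * A)%C.
Proof.
  intros Ha Hb. destruct (classic (b - a = 0)%C) as [E|E].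
  - exists 1. split. unfold Re; simpl; lra.
    replace b with a. ring. rewrite <- (Cplus_0_r a), <- E. ring.
  - exists ((G b - G a) / (b - a))%C. split. 2: field; exact E.
    set (phi := fun t => Re ( / (b - a) * G (a + RtoC t * (b - a)))).
    set (dG := fun z => (cis (- lam) * (1 + Cexp z * dg (Cexp z)))%C).
    assert (Hseg : forall t, 0 <= t <= 1 -> Re (a + RtoC t * (b - a)) < 0).
    { intros t Ht.
      replace (Re (a + RtoC t * (b - a))) with ((1 - t) * Re a + t * Re b)
        by (unfold Re; simpl; ring). nra. }
    assert (Hd : forall t, 0 <= t <= 1 -> is_derive phi t (Re (dG (a + RtoC t * (b - a))%C))).
    { intros t Ht.
      assert (H1 := cderiv_comp_RC G _ t _ _ (is_derive_RC_line a (b - a) t) (spiral_dG _ (Hseg t Ht))).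
      assert (H2 := cderiv_comp_RC (fun w => / (b - a) * w)%C _ t _ _ H1
        (cderiv_scal _ _ _ _ (cderiv_id _))).
      destruct H2 as [H2 _].
      replace (dG (a + RtoC t * (b - a))%C) with
        (/ (b - a) * 1 * (dG (a + RtoC t * (b - a))%C * (b - a)))%C by (field; exact E).
      exact H2. }
    destruct (MVT_gen phi 0 1 (fun t => Re (dG (a + RtoC t * (b - a))%C))) as [c [Hc Hm]].
    + intros x Hx. rewrite Rmin_left, Rmax_right in Hx by lra. apply Hd. lra.
    + intros x Hx. rewrite Rmin_left, Rmax_right in Hx by lra.
      apply continuity_pt_filterlim. apply (ex_derive_continuous phi x).
      eexists. apply Hd. lra.
    + rewrite Rmin_left, Rmax_right in Hc by lra.
      replace (Re ((G b - G a) / (b - a))) with (phi 1 - phi 0).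
      * rewrite Hm. replace (1 - 0) with 1 by ring. rewrite Rmult_1_r. apply Hpos.
        apply Cmod_Cexp_lt_1. now apply Hseg.
      * unfold phi. replace (a + 1 * (b - a))%C with b by ring.
        replace (a + 0 * (b - a))%C with a by ring.
        replace ((G b - G a) / (b - a))%C with (/ (b - a) * G b - / (b - a) * G a)%C
          by (field; exact E). unfold Re; simpl. ring.
Qed.

Lemma spiral_inj (a b : C) : Re a < 0 -> Re b < 0 -> G a = G b -> a = b.
Proof.
  intros Ha Hb H. destruct (spiral_quotient a b Ha Hb) as [A [HA E]].
  assert (HA0 : A <> 0) by (intros H0; rewrite H0 in HA; unfold Re in HA; simpl in HA; lra).
  replace a with (b - (b - a) * A * / A)%C by (field; exact HA0). rewrite <- E, H. ring.
Qed.

Lemma spiral_vert (x y1 y2 : R) : x < 0 -> y1 < y2 -> Im (G (x, y1)) < Im (G (x, y2)).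
Proof.
  intros Hx Hy. destruct (spiral_quotient (x, y1) (x, y2) Hx Hx) as [A [HA E]].
  assert (H := f_equal Im E). unfold Re, Im in *; simpl in *. nra.
Qed.

(** With s = G b - G a real, multiplication of s = (b - a) A by conj A gives s Re A = Re (b - a)
    |A|^2 for the real parts. *)
Lemma spiral_horiz (a b : C) :
  Re a < 0 -> Re b < 0 -> Im (G a) = Im (G b) -> Re a < Re b -> Re (G a) < Re (G b).
Proof.
  intros Ha Hb HI HR. destruct (spiral_quotient a b Ha Hb) as [A [HA E]].
  set (s := Re (G b) - Re (G a)).
  assert (E' : RtoC s = ((b - a) * A)%C).
  { rewrite <- E. unfold s. destruct (G a), (G b). unfold Re, Im in *; simpl in *. subst.
    unfold RtoC, Cminus, Cplus, Copp; simpl. f_equal; ring. }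
  assert (E2 := f_equal (fun w => Re (w * Cconj A)) E'). cbv beta in E2.
  replace (Re (RtoC s * Cconj A)) with (s * Re A) in E2 by (unfold Re, Cconj; simpl; ring).
  replace (Re ((b - a) * A * Cconj A)) with ((Re b - Re a) * (Re A * Re A + Im A * Im A)) in E2
    by (unfold Re, Im, Cconj; simpl; ring).
  assert (HA2 : 0 < Re A * Re A + Im A * Im A) by nra.
  assert (HP := Rmult_lt_0_compat (Re b - Re a) _ ltac:(lra) HA2).
  assert (0 < s) by (apply Rnot_le_lt; intros Hs; nra).
  unfold s in H. lra.
Qed.

Lemma spiral_continuous (z : C) :
  Re z < 0 -> continuous_CC G z.
Proof. intros Hz. eapply cderiv_continuous. now apply spiral_dG. Qed.

Lemma spiral_M_nonneg : 0 <= M.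
Proof. eapply Rle_trans. apply Cmod_ge_0. apply (HM 0). rewrite Cmod_0. lra. Qed.

(** Boundedness of [g] keeps [G] within [M] of a rotation; since cos lam > 0, every value of Im G is
    attained on each vertical line, without any study of boundary behaviour. *)
Lemma spiral_Im_bound (x y : R) :
  x < 0 -> Rabs (Im (G (x, y)) - (y * cos lam - x * sin lam)) <= M.
Proof.
  intros Hx.
  replace (Im (G (x, y)) - (y * cos lam - x * sin lam)) with
    (Im (cis (- lam) * g (Cexp (x, y)))).
  - eapply Rle_trans. apply im_le_Cmod. rewrite Cmod_cis_mult. apply HM.
    now apply Cmod_Cexp_lt_1.
  - unfold G. generalize (g (Cexp (x, y))). intros [p q].
    unfold cis, Im; simpl. rewrite cos_neg, sin_neg. ring.
Qed.

Lemma spiral_Re_bound (z : C) :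
  Re z < 0 -> Rabs (Re (cis lam * G z) - Re z) <= M.
Proof.
  intros Hz.
  replace (cis lam * G z)%C with (z + g (Cexp z))%C.
  - replace (Re (z + g (Cexp z)) - Re z) with (Re (g (Cexp z))) by (unfold Re; simpl; ring).
    eapply Rle_trans. apply re_le_Cmod. apply HM. now apply Cmod_Cexp_lt_1.
  - unfold G. transitivity ((cis (- lam) * cis lam) * (z + g (Cexp z)))%C. 2: ring.
    rewrite cis_opp_mult. ring.
Qed.

(** A sigma type, with the condition on x inside it, so that [Y] is a total function. By
    [spiral_vert] the level line Im G = v meets each vertical line once, hence is the graph of x ->
    Y x v. *)
Lemma spiral_Y_sig (x v : R) : {y : R | x < 0 -> Im (G (x, y)) = v}.
Proof.
  destruct (Rlt_dec x 0) as [Hx|Hx]. 2: exists 0; lra.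
  set (h := fun y => Im (G (x, y))).
  assert (Hc : continuity h).
  { intros y. apply continuity_pt_filterlim.
    apply (continuous_Im_comp (T := R_UniformSpace) (fun y => G (x, y)) y).
    apply (continuous_comp (V := C_UniformSpace) (fun y => (x, y)) G).
    apply continuous_C_pair; simpl. apply continuous_const. apply continuous_id.
    now apply spiral_continuous. }
  assert (Hcos := spiral_cos). assert (HM0 := spiral_M_nonneg).
  (* The heights at which [spiral_Im_bound] forces Im G below and above v. *)
  set (y1 := (v + x * sin lam - M) / cos lam). set (y2 := (v + x * sin lam + M) / cos lam).
  assert (H1 : h y1 <= v).
  { assert (B := spiral_Im_bound x y1 Hx). fold (h y1) in B. apply Rabs_le_between in B.
    replace (y1 * cos lam) with (v + x * sin lam - M) in B by (unfold y1; field; lra). lra. }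
  assert (H2 : v <= h y2).
  { assert (B := spiral_Im_bound x y2 Hx). fold (h y2) in B. apply Rabs_le_between in B.
    replace (y2 * cos lam) with (v + x * sin lam + M) in B by (unfold y2; field; lra). lra. }
  destruct (IVT_gen h y1 y2 v Hc) as [y [_ Hy]].
  - rewrite Rmin_left, Rmax_right; lra.
  - exists y. intros _. exact Hy.
Qed.

Let Y (x v : R) : R := proj1_sig (spiral_Y_sig x v).
Let U (x v : R) : R := Re (G (x, Y x v)).

Lemma spiral_Y (x v : R) : x < 0 -> Im (G (x, Y x v)) = v.
Proof. intros Hx. exact (proj2_sig (spiral_Y_sig x v) Hx). Qed.

Lemma spiral_Y_unique (x y : R) : x < 0 -> Y x (Im (G (x, y))) = y.
Proof.
  intros Hx. assert (H := spiral_Y x (Im (G (x, y))) Hx).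
  destruct (Rtotal_order (Y x (Im (G (x, y)))) y) as [L|[L|L]]; try easy;
    apply (spiral_vert x _ _ Hx) in L; lra.
Qed.

Lemma spiral_GU (x v : R) : x < 0 -> G (x, Y x v) = (U x v, v).
Proof.
  intros Hx. assert (H := spiral_Y x v Hx). unfold U. revert H.
  destruct (G (x, Y x v)) as [p q]. unfold Re, Im; simpl. now intros ->.
Qed.

Lemma spiral_G_eps (x y eps : R) :
  x < 0 -> 0 < eps -> exists del, 0 < del /\
    forall x' y', Rabs (x' - x) < del -> Rabs (y' - y) < del -> Cmod (G (x', y') - G (x, y)) < eps.
Proof.
  intros Hx He.
  destruct (proj1 (C_continuous_eps _ _) (spiral_continuous (x, y) Hx) eps He) as [d [Hd H]].
  exists (d / 2). split. lra. intros x' y' H1 H2. apply H.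
  replace ((x', y') - (x, y))%C with ((x' - x, y' - y) : C)
    by (unfold Cminus, Cplus, Copp; simpl; f_equal; ring).
  eapply Rle_lt_trans. apply Cmod_pair_le. lra.
Qed.

(** An implicit function argument by monotonicity alone: Im G lies strictly below v at height Y -
    eps / 2 and strictly above it at Y + eps / 2, and this persists under small changes of x and
    v. *)
Lemma spiral_Y_continuous (x v eps : R) :
  x < 0 -> 0 < eps -> exists del, 0 < del /\
    forall x' v', x' < 0 -> Rabs (x' - x) < del -> Rabs (v' - v) < del ->
      Rabs (Y x' v' - Y x v) < eps.
Proof.
  intros Hx He. set (y := Y x v).
  assert (H1 := spiral_vert x (y - eps / 2) y Hx ltac:(lra)).
  assert (H2 := spiral_vert x y (y + eps / 2) Hx ltac:(lra)).
  assert (Hy : Im (G (x, y)) = v) by now apply spiral_Y.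
  (* Half of the smaller gap: one [eta] for the change of x, one for that of v. *)
  set (eta := Rmin (v - Im (G (x, y - eps / 2))) (Im (G (x, y + eps / 2)) - v) / 2).
  assert (Heta : 0 < eta).
  { unfold eta. apply Rdiv_lt_0_compat. apply Rmin_pos; lra. lra. }
  assert (Heta1 : 2 * eta <= v - Im (G (x, y - eps / 2))).
  { unfold eta. replace (2 * (Rmin (v - Im (G (x, y - eps / 2))) (Im (G (x, y + eps / 2)) - v) / 2))
      with (Rmin (v - Im (G (x, y - eps / 2))) (Im (G (x, y + eps / 2)) - v)) by field. apply Rmin_l. }
  assert (Heta2 : 2 * eta <= Im (G (x, y + eps / 2)) - v).
  { unfold eta. replace (2 * (Rmin (v - Im (G (x, y - eps / 2))) (Im (G (x, y + eps / 2)) - v) / 2))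
      with (Rmin (v - Im (G (x, y - eps / 2))) (Im (G (x, y + eps / 2)) - v)) by field. apply Rmin_r. }
  destruct (spiral_G_eps x (y - eps / 2) eta Hx Heta) as [d1 [Hd1 G1]].
  destruct (spiral_G_eps x (y + eps / 2) eta Hx Heta) as [d2 [Hd2 G2]].
  exists (Rmin eta (Rmin d1 d2)). split. apply Rmin_pos. easy. now apply Rmin_pos.
  intros x' v' Hx' H3 H4.
  pose proof (Rmin_l eta (Rmin d1 d2)). pose proof (Rmin_r eta (Rmin d1 d2)).
  pose proof (Rmin_l d1 d2). pose proof (Rmin_r d1 d2).
  specialize (G1 x' (y - eps / 2) ltac:(lra)).
  replace (y - eps / 2 - (y - eps / 2)) with 0 in G1 by ring. rewrite Rabs_R0 in G1.
  specialize (G2 x' (y + eps / 2) ltac:(lra)).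
  replace (y + eps / 2 - (y + eps / 2)) with 0 in G2 by ring. rewrite Rabs_R0 in G2.
  specialize (G1 Hd1). specialize (G2 Hd2).
  assert (I1 := im_le_Cmod (G (x', y - eps / 2) - G (x, y - eps / 2))).
  assert (I2 := im_le_Cmod (G (x', y + eps / 2) - G (x, y + eps / 2))).
  change (Im (G (x', y - eps / 2) - G (x, y - eps / 2))) with
    (Im (G (x', y - eps / 2)) - Im (G (x, y - eps / 2))) in I1.
  change (Im (G (x', y + eps / 2) - G (x, y + eps / 2))) with
    (Im (G (x', y + eps / 2)) - Im (G (x, y + eps / 2))) in I2.
  apply Rabs_le_between in I1. apply Rabs_le_between in I2. apply Rabs_def2 in H4.
  assert (Hy' := spiral_Y x' v' Hx').
  apply Rabs_def1.
  - apply Rnot_le_lt. intros Hc.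
    assert (C1 := spiral_vert x' (y + eps / 2) (Y x' v') Hx' ltac:(lra)). lra.
  - apply Rnot_le_lt. intros Hc.
    assert (C1 := spiral_vert x' (Y x' v') (y - eps / 2) Hx' ltac:(lra)). lra.
Qed.

Lemma spiral_U_continuous (x v eps : R) :
  x < 0 -> 0 < eps -> exists del, 0 < del /\
    forall x' v', x' < 0 -> Rabs (x' - x) < del -> Rabs (v' - v) < del ->
      Rabs (U x' v' - U x v) < eps.
Proof.
  intros Hx He.
  destruct (spiral_G_eps x (Y x v) eps Hx He) as [d [Hd H]].
  destruct (spiral_Y_continuous x v d Hx Hd) as [e [He' H']].
  exists (Rmin d e). split. now apply Rmin_pos.
  intros x' v' Hx' H1 H2. pose proof (Rmin_l d e). pose proof (Rmin_r d e).
  eapply Rle_lt_trans. apply (re_le_Cmod (G (x', Y x' v') - G (x, Y x v))).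
  apply H. lra. apply H'; try easy; lra.
Qed.

Lemma spiral_solve (x1 x2 u v : R) :
  x1 < x2 -> x2 < 0 -> U x1 v < u -> u < U x2 v -> exists z, Re z < 0 /\ G z = (u, v).
Proof.
  intros H12 H2 Hu1 Hu2.
  destruct (IVT_interv (fun x => U x v - u) x1 x2) as [x [Hx E]]; try lra.
  - intros x Hx. apply continuity_pt_minus. 2: apply continuity_pt_const; now intros ? ?.
    assert (Hx0 : x < 0) by lra.
    intros eps Heps. destruct (spiral_U_continuous x v eps Hx0 Heps) as [d [Hd H]].
    (* The entry - x keeps x' negative, where [Y] solves its equation. *)
    exists (Rmin d (- x)). split. apply Rmin_pos; lra.
    intros x' [_ Hx']. simpl in Hx' |- *. unfold R_dist in *.
    pose proof (Rmin_l d (- x)). pose proof (Rmin_r d (- x)).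
    apply H. pose proof (Rle_abs (x' - x)). lra. lra.
    replace (v - v) with 0 by ring. now rewrite Rabs_R0.
  - exists (x, Y x v). split. unfold Re; simpl; lra.
    rewrite spiral_GU by lra. f_equal. lra.
Qed.

Lemma spiral_Re_G (w : C) : Re (cis lam * w) = cos lam * Re w - sin lam * Im w.
Proof. unfold cis, Re, Im; simpl. ring. Qed.

(** On the level v, cos lam U - sin lam v stays within [M] of x, so U tends to minus infinity with
    x. *)
Lemma spiral_low (u v x0 : R) : x0 < 0 -> exists x, x < x0 /\ U x v < u.
Proof.
  intros Hx0. assert (Hcos := spiral_cos).
  set (x := Rmin (x0 - 1) (u * cos lam - v * sin lam - M - 1)).
  exists x. pose proof (Rmin_l (x0 - 1) (u * cos lam - v * sin lam - M - 1)).
  pose proof (Rmin_r (x0 - 1) (u * cos lam - v * sin lam - M - 1)). fold x in H, H0.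
  assert (Hx : x < 0) by lra.
  split. lra.
  assert (B := spiral_Re_bound (x, Y x v) Hx). rewrite spiral_Re_G, spiral_GU in B by easy.
  change (Re (U x v, v)) with (U x v) in B. change (Im (U x v, v)) with v in B.
  change (Re (x, Y x v)) with x in B.
  apply Rabs_le_between in B. apply Rmult_lt_reg_l with (cos lam). easy. nra.
Qed.

(** Spirallikeness in these coordinates: the image of [G] contains the half-line to the left of each
    of its points, since along a level line Re G takes all values between that point and minus
    infinity. *)
Lemma spiral_down (z : C) (u : R) :
  Re z < 0 -> u <= Re (G z) -> exists w, Re w < 0 /\ G w = (u, Im (G z)).
Proof.
  intros Hz Hu. destruct (Rle_lt_or_eq_dec _ _ Hu) as [H|H].
  - set (v := Im (G z)). destruct (spiral_low u v (Re z) Hz) as [x1 [Hx1 Hu1]].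
    apply (spiral_solve x1 (Re z) u v Hx1 Hz Hu1).
    assert (E : Y (Re z) v = Im z).
    { assert (E := spiral_Y_unique (Re z) (Im z) Hz). unfold v. now destruct z. }
    unfold U. rewrite E. now destruct z.
  - exists z. split. easy. rewrite H. now destruct (G z).
Qed.

(** Replaces the open mapping theorem. Moving right along the level line to x2 = Re z / 2 raises Re
    G strictly above u; by continuity this still holds on nearby levels, and [spiral_low] bounds
    them on the other side. *)
Lemma spiral_open (z : C) :
  Re z < 0 -> exists del, 0 < del /\
    forall w, Cmod (w - G z) < del -> exists z', Re z' < 0 /\ G z' = w.
Proof.
  intros Hz. set (u := Re (G z)). set (v := Im (G z)). set (x2 := Re z / 2).
  assert (Hx2 : x2 < 0) by (unfold x2; lra).
  assert (Hgap : u < U x2 v).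
  { apply spiral_horiz; try easy. now rewrite spiral_Y. unfold x2, Re; simpl. unfold Re in Hz. lra. }
  destruct (spiral_U_continuous x2 v ((U x2 v - u) / 2) Hx2 ltac:(lra)) as [d [Hd H]].
  exists (Rmin d ((U x2 v - u) / 2)). split. apply Rmin_pos; lra.
  intros w Hw. pose proof (Rmin_l d ((U x2 v - u) / 2)). pose proof (Rmin_r d ((U x2 v - u) / 2)).
  assert (R1 := re_le_Cmod (w - G z)). assert (R2 := im_le_Cmod (w - G z)).
  change (Re (w - G z)) with (Re w - u) in R1. change (Im (w - G z)) with (Im w - v) in R2.
  specialize (H x2 (Im w) Hx2). replace (x2 - x2) with 0 in H by ring. rewrite Rabs_R0 in H.
  specialize (H Hd ltac:(lra)). apply Rabs_def2 in H. apply Rabs_le_between in R1.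
  destruct (spiral_low (Re w) (Im w) x2 Hx2) as [x1 [Hx1 Hu1]].
  destruct (spiral_solve x1 x2 (Re w) (Im w) Hx1 Hx2 Hu1 ltac:(lra)) as [z' [Hz' E]].
  exists z'. split. easy. rewrite E. now destruct w.
Qed.

(** On the line Re z = -1, Re (cis lam * G) is at least - 1 - M. This half-plane becomes a punctured
    disc about 0 in the image of [f]. *)
Lemma spiral_half_plane (w : C) :
  Re (cis lam * w) < - (1) - M -> exists z, Re z < 0 /\ G z = w.
Proof.
  intros Hw. assert (Hcos := spiral_cos). assert (Hm1 : -1 < 0) by lra.
  assert (B := spiral_Re_bound (-1, Y (-1) (Im w)) Hm1).
  rewrite spiral_Re_G, spiral_GU in B by easy.
  change (Re (U (-1) (Im w), Im w)) with (U (-1) (Im w)) in B.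
  change (Im (U (-1) (Im w), Im w)) with (Im w) in B.
  change (Re (-1, Y (-1) (Im w))) with (-1) in B.
  rewrite spiral_Re_G in Hw. apply Rabs_le_between in B.
  destruct (spiral_low (Re w) (Im w) (-1) Hm1) as [x1 [Hx1 Hu1]].
  destruct (spiral_solve x1 (-1) (Re w) (Im w) Hx1 Hm1 Hu1) as [z [Hz E]].
  - apply Rmult_lt_reg_l with (cos lam). easy. lra.
  - exists z. split. easy. rewrite E. now destruct w.
Qed.

Lemma spiral_f_0 : f 0 = 0.
Proof. unfold f. ring. Qed.

Lemma spiral_cis_cancel (w : C) : (cis lam * (cis (- lam) * w))%C = w.
Proof. transitivity ((cis (- lam) * cis lam) * w)%C. ring. rewrite cis_opp_mult. ring. Qed.

Lemma spiral_image_Cexp (z : C) : Re z < 0 -> image f unit_disk (Cexp (cis lam * G z)).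
Proof.
  intros Hz. exists (Cexp z). split. now apply Cmod_Cexp_lt_1. apply spiral_fG.
Qed.

Lemma spiral_disk_log (z : C) : Cmod z < 1 -> z <> 0 -> exists w, Re w < 0 /\ z = Cexp w.
Proof.
  intros Hz Hz0. destruct (Cexp_surj z Hz0) as [w Hw]. exists w. split. 2: easy.
  rewrite <- Hw, Cmod_Cexp, <- exp_0 in Hz. now apply exp_lt_inv.
Qed.

Lemma spiral_df (z : C) : Cmod z < 1 -> cderiv f z (Cexp (g z) * (1 + z * dg z))%C.
Proof.
  intros Hz. eapply cderiv_eq.
  2: { apply cderiv_mult. apply cderiv_id. apply (cderiv_comp g Cexp). now apply Hg. apply cderiv_Cexp. }
  cbv beta. ring.
Qed.

Lemma spiral_f_eq_0 (z : C) : f z = 0 -> z = 0.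
Proof.
  unfold f. intros H. destruct (classic (z = 0)) as [E|E]. easy. exfalso.
  apply (Cmult_neq_0 z (Cexp (g z))); try easy. apply Cexp_neq_0.
Qed.

(** The logarithms of equal values differ by some i d with cis d = 1. Replacing b by b + i d changes
    neither Cexp b nor g (Cexp b) and absorbs the difference, so injectivity of [G] applies. *)
Lemma spiral_injective : injective_on unit_disk f.
Proof.
  intros z1 z2 H1 H2 E. unfold unit_disk in *.
  destruct (classic (z1 = 0)) as [Z1|Z1].
  { subst. rewrite spiral_f_0 in E. symmetry. now apply spiral_f_eq_0. }
  destruct (classic (z2 = 0)) as [Z2|Z2].
  { subst. rewrite spiral_f_0 in E. now apply spiral_f_eq_0. }
  destruct (spiral_disk_log z1 H1 Z1) as [a [Ha ->]]. destruct (spiral_disk_log z2 H2 Z2) as [b [Hb ->]].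
  rewrite !spiral_fG in E. destruct (Cexp_eq _ _ E) as [d [Ed Hd]].
  set (b' := (b + Ci * RtoC d)%C).
  assert (Eb : Cexp b' = Cexp b) by (unfold b'; rewrite Cexp_plus, Cexp_Ci, Hd; ring).
  assert (EG : G a = G b').
  { unfold G at 2. rewrite Eb. unfold b'.
    transitivity (cis (- lam) * (cis lam * G a))%C.
    transitivity ((cis (- lam) * cis lam) * G a)%C. rewrite cis_opp_mult. ring. ring.
    rewrite Ed. unfold G.
    rewrite (spiral_cis_cancel (b + g (Cexp b))). ring. }
  rewrite <- Eb. f_equal. apply spiral_inj; try easy.
  unfold b', Re in *; simpl in *. lra.
Qed.

Lemma spiral_open_image : open (T := C_UniformSpace) (image f unit_disk).
Proof.
  apply open_C_eps. intros w0 [z [Hz <-]].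
  destruct (classic (z = 0)) as [Z|Z].
  (* Logarithms of nonzero points of this disc have real part below - 1 - M, as [spiral_half_plane]
     requires. *)
  - subst. rewrite spiral_f_0. exists (exp (- (1) - M)). split. apply exp_pos.
    intros w Hw. replace (w - 0)%C with w in Hw by ring.
    destruct (classic (w = 0)) as [W|W].
    + exists 0. split. exact Hz. rewrite W. apply spiral_f_0.
    + destruct (Cexp_surj w W) as [a Ha]. rewrite <- Ha, Cmod_Cexp in Hw. apply exp_lt_inv in Hw.
      destruct (spiral_half_plane (cis (- lam) * a)%C) as [z [Hz' E]].
      * now rewrite spiral_cis_cancel.
      * rewrite <- Ha, <- (spiral_cis_cancel a), <- E. now apply spiral_image_Cexp.
  - destruct (spiral_disk_log z Hz Z) as [a [Ha ->]].
    destruct (spiral_open a Ha) as [d [Hd H]]. rewrite spiral_fG.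
    set (w0 := Cexp (cis lam * G a)).
    assert (Hw0 : w0 <> 0) by apply Cexp_neq_0.
    assert (Hm := proj1 (Cmod_gt_0 _) Hw0).
    assert (H1 : 0 < Re 1) by (unfold Re; simpl; lra).
    (* Near w0 the logarithm of w is taken relative to w0, so that a small Clog (w / w0) is the
       displacement from G a. *)
    destruct (proj1 (C_continuous_eps _ _) (continuous_Clog 1 H1) d Hd) as [r [Hr Hc]].
    exists (Cmod w0 * Rmin r 1). split.
    apply Rmult_lt_0_compat. easy. apply Rmin_pos; lra.
    intros w Hw.
    assert (Hq : Cmod (w / w0 - 1) < Rmin r 1).
    { replace (w / w0 - 1)%C with ((w - w0) / w0)%C by (field; easy).
      rewrite Cmod_div by easy. apply Rlt_div_l; lra. }
    pose proof (Rmin_l r 1). pose proof (Rmin_r r 1).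
    specialize (Hc (w / w0)%C ltac:(lra)). rewrite Clog_1 in Hc.
    assert (Hre : 0 < Re (w / w0)).
    { assert (R1 := re_le_Cmod (w / w0 - 1)).
      change (Re (w / w0 - 1)) with (Re (w / w0) - 1) in R1. apply Rabs_le_between in R1. lra. }
    destruct (H (G a + cis (- lam) * Clog (w / w0))%C) as [z' [Hz' E]].
    { replace (G a + cis (- lam) * Clog (w / w0) - G a)%C with (cis (- lam) * (Clog (w / w0) - 0))%C
        by ring. now rewrite Cmod_cis_mult. }
    assert (Ew : w = Cexp (cis lam * G z')).
    { rewrite E.
      replace (cis lam * (G a + cis (- lam) * Clog (w / w0)))%C with
        (cis lam * G a + cis lam * (cis (- lam) * Clog (w / w0)))%C by ring.
      rewrite spiral_cis_cancel, Cexp_plus, Cexp_Clog by easy. fold w0. field. easy. }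
    rewrite Ew. now apply spiral_image_Cexp.
Qed.

(** Each point of the image is joined to 0 by the image of a radius; along it runs the supremum
    argument for the connectedness of [0, 1]. *)
Lemma spiral_connected_aux (V1 V2 : C -> Prop) (z : C) :
  open (T := C_UniformSpace) V1 -> open (T := C_UniformSpace) V2 ->
  (forall w, image f unit_disk w -> V1 w \/ V2 w) ->
  unit_disk z -> V1 0 -> V2 (f z) ->
  exists w, image f unit_disk w /\ V1 w /\ V2 w.
Proof.
  intros HU HV Hcov Hz H0 H1. unfold unit_disk in Hz.
  set (gam := fun t => f (RtoC t * z)%C).
  assert (Hin : forall t, 0 <= t <= 1 -> Cmod (RtoC t * z) < 1).
  { intros t Ht. rewrite Cmod_mult, Cmod_R, Rabs_pos_eq by easy. pose proof (Cmod_ge_0 z). nra. }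
  assert (Him : forall t, 0 <= t <= 1 -> image f unit_disk (gam t)).
  { intros t Ht. exists (RtoC t * z)%C. split. now apply Hin. reflexivity. }
  assert (Hloc : forall (W : C -> Prop) t, open (T := C_UniformSpace) W -> 0 <= t <= 1 -> W (gam t) ->
    exists d, 0 < d /\ forall s, Rabs (s - t) < d -> W (gam s)).
  { intros W t HW Ht Hwt.
    destruct (proj1 (open_C_eps W) HW _ Hwt) as [e [He HWe]].
    assert (Hc : continuous_RC gam t).
    { apply (continuous_comp (V := C_UniformSpace) (fun t => RtoC t * z)%C f).
      apply continuous_Cmult. 2: apply continuous_const.
      apply continuous_C_pair; simpl. apply continuous_id. apply continuous_const.
      eapply cderiv_continuous, spiral_df. now apply Hin. }
    assert (Hs : 0 < e / sqrt 2) by (apply Rdiv_lt_0_compat; [easy | apply Rlt_sqrt2_0]).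
    destruct (proj1 (filterlim_locally gam (gam t)) Hc (mkposreal _ Hs)) as [d Hd].
    exists d. split. apply cond_pos. intros s Hst. apply HWe.
    specialize (Hd s Hst). apply C_NormedModule_mixin_compat2 in Hd. simpl in Hd.
    replace (sqrt 2 * (e / sqrt 2)) with e in Hd. exact Hd.
    field. apply Rgt_not_eq, Rlt_sqrt2_0. }
  assert (G0 : gam 0 = 0) by (unfold gam, f; ring).
  assert (G1 : gam 1 = f z) by (unfold gam; now rewrite Cmult_1_l).
  set (S := fun t => 0 <= t <= 1 /\ forall s, 0 <= s <= t -> V1 (gam s)).
  destruct (completeness S) as [m [Hub Hlub]].
  { exists 1. intros t [Ht _]. lra. }
  { exists 0. split. lra. intros s Hs. replace s with 0 by lra. now rewrite G0. }
  assert (Hm0 : 0 <= m).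
  { apply Hub. split. lra. intros s Hs. replace s with 0 by lra. now rewrite G0. }
  assert (Hm1 : m <= 1) by (apply Hlub; intros t [Ht _]; lra).
  assert (Hnear : forall d, 0 < d -> exists t, S t /\ m - d < t).
  { intros d Hd. apply NNPP. intros Hno. assert (m <= m - d).
    { apply Hlub. intros t Ht. apply Rnot_lt_le. intros Hc. apply Hno. now exists t. }
    lra. }
  (* If gam m is in [V2], points of [S] just before m lie in both sets; otherwise it is in [V1] and
     [S] reaches beyond its supremum m. *)
  destruct (classic (V2 (gam m))) as [Vm|Vm].
  - destruct (Hloc V2 m HV ltac:(lra) Vm) as [d [Hd Hv]].
    destruct (Hnear d Hd) as [t [[Ht Us] Htm]].
    assert (t <= m) by (apply Hub; now split).
    exists (gam t). split. now apply Him. split. apply Us. lra.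
    apply Hv. apply Rabs_def1; lra.
  - assert (Um : V1 (gam m)) by (destruct (Hcov _ (Him m ltac:(lra))); easy).
    destruct (Hloc V1 m HU ltac:(lra) Um) as [d [Hd Hu]].
    destruct (Hnear d Hd) as [t [[Ht Us] Htm]].
    assert (Hm : m < 1).
    { destruct (Rle_lt_or_eq_dec _ _ Hm1) as [L|L]. easy. exfalso. apply Vm. now rewrite L, G1. }
    set (m' := Rmin 1 (m + d / 2)).
    assert (Hm'1 : m' <= 1) by apply Rmin_l. assert (Hm'2 : m' <= m + d / 2) by apply Rmin_r.
    assert (Hm' : m < m') by (apply Rmin_glb_lt; lra).
    assert (m' <= m); [|lra]. apply Hub. split. lra. intros s Hs.
    destruct (Rle_dec s t) as [L|L]. apply Us; lra. apply Hu. apply Rabs_def1; lra.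
Qed.

Lemma spirallike_of_derivative : spirallike lam f.
Proof.
  split; [|split; [|split]].
  - intros z Hz. eexists. apply cderiv_is_derive. now apply spiral_df.
  - apply spiral_f_0.
  - apply spiral_injective.
  - assert (H00 : image f unit_disk 0).
    { exists 0. split. unfold unit_disk. rewrite Cmod_0. lra. apply spiral_f_0. }
    split; [split; [|split]|split].
    + now exists 0.
    + apply spiral_open_image.
    + intros U1 V1 HU HV Hcov [a [Ha Ua]] [b [Hb Vb]].
      destruct (Hcov 0 H00) as [H0|H0].
      * destruct Hb as [z [Hz <-]]. now apply (spiral_connected_aux U1 V1 z).
      * destruct Ha as [z [Hz <-]].
        destruct (spiral_connected_aux V1 U1 z) as [w [W1 [W2 W3]]]; try easy.
        intros w Hw. destruct (Hcov w Hw); tauto. now exists w.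
    + exact H00.
    + intros w [z [Hz <-]] u [[t [Ht ->]] | ->]. 2: exact H00.
      destruct (classic (z = 0)) as [Z|Z].
      { subst. rewrite spiral_f_0, Cmult_0_l. exact H00. }
      destruct (spiral_disk_log z Hz Z) as [a [Ha ->]].
      (* Multiplying by Cexp (t cis lam) translates G a by the real number t <= 0. *)
      destruct (spiral_down a (Re (G a) + t) Ha ltac:(lra)) as [b [Hb E]].
      replace (f (Cexp a) * Cexp (RtoC t * Cexp (Ci * RtoC lam)))%C with (Cexp (cis lam * G b)).
      now apply spiral_image_Cexp.
      rewrite spiral_fG, <- Cexp_plus, Cexp_Ci, E. f_equal.
      replace ((Re (G a) + t)%R, Im (G a)) with (G a + RtoC t)%C.
      ring. destruct (G a). unfold Cplus, RtoC, Re, Im; simpl. f_equal; ring.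
Qed.

End Spirallike.

(** * The extremal functions *)

(** The map z -> z^N runs N times round its image circle, so circle means are unchanged by the
    substitution. *)
Lemma RInt_periodic_mult (g : R -> R) (N : nat) :
  (forall t, continuous_RR g t) ->
  (forall t, g (t + 2 * PI) = g t) -> (1 <= N)%nat ->
  RInt (fun t => g (INR N * t)) 0 (2 * PI) = RInt g 0 (2 * PI).
Proof.
  intros Hc Hp HN.
  assert (Hex : forall a b, ex_RInt g a b) by (intros; now apply ex_RInt_continuous_all).
  assert (Hn : forall n t, g (t + INR n * (2 * PI)) = g t).
  { induction n as [|n IH]; intros t. f_equal. simpl. ring.
    rewrite S_INR. replace (t + (INR n + 1) * (2 * PI)) with (t + INR n * (2 * PI) + 2 * PI) by ring.
    now rewrite Hp, IH. }
  assert (Hsum : forall n, RInt g 0 (INR n * (2 * PI)) = INR n * RInt g 0 (2 * PI)).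
  { induction n as [|n IH].
    - simpl. rewrite Rmult_0_l, Rmult_0_l. apply (RInt_point (V := R_CompleteNormedModule)).
    - rewrite S_INR, <- (RInt_Chasles (V := R_CompleteNormedModule) g 0 (INR n * (2 * PI))) by apply Hex.
      rewrite IH. change (INR n * RInt g 0 (2 * PI) +
        RInt g (INR n * (2 * PI)) ((INR n + 1) * (2 * PI)) = (INR n + 1) * RInt g 0 (2 * PI)).
      assert (E := RInt_comp_lin (V := R_CompleteNormedModule) g 1 (INR n * (2 * PI)) 0 (2 * PI) (Hex _ _)).
      replace (1 * 0 + INR n * (2 * PI)) with (INR n * (2 * PI)) in E by ring.
      replace (1 * (2 * PI) + INR n * (2 * PI)) with ((INR n + 1) * (2 * PI)) in E by ring.
      rewrite (RInt_ext _ g) in E. rewrite <- E. ring.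
      intros t _. change (1 * g (1 * t + INR n * (2 * PI)) = g t). now rewrite Hn, !Rmult_1_l. }
  assert (HN0 : 0 < INR N) by (apply lt_0_INR; lia).
  assert (E := RInt_comp_lin (V := R_CompleteNormedModule) g (INR N) 0 0 (2 * PI) (Hex _ _)).
  replace (INR N * 0 + 0) with 0 in E by ring. rewrite Rplus_0_r, Hsum in E.
  rewrite (RInt_scal (V := R_CompleteNormedModule)) in E.
  - rewrite (RInt_ext _ (fun t => g (INR N * t))) in E by (intros; now rewrite Rplus_0_r).
    apply Rmult_eq_reg_l with (INR N). exact E. lra.
  - apply ex_RInt_continuous_all. intros t. apply (continuous_comp (fun t => INR N * t + 0) g).
    apply (ex_derive_continuous (fun t => INR N * t + 0)). now auto_derive. apply Hc.
Qed.

(** The upper bound and the value at [z0] together exclude the infinite least upper bounds, which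
    [real] would send to 0. *)
Lemma max_modulus_bounds (r a b : R) (f : C -> C) (z0 : C) :
  Cmod z0 = r -> a <= Cmod (f z0) -> (forall z, Cmod z = r -> Cmod (f z) <= b) ->
  a <= max_modulus r f <= b.
Proof.
  intros Hz Ha Hb. unfold max_modulus.
  set (E := fun m : R => exists z : C, Cmod z = r /\ m = Cmod (f z)).
  destruct (Lub_Rbar_correct E) as [H1 H2].
  assert (Hub : is_ub_Rbar E b) by (intros m [z [Hm ->]]; apply Hb, Hm).
  specialize (H2 b Hub).
  specialize (H1 (Cmod (f z0)) (ex_intro _ z0 (conj Hz eq_refl))).
  destruct (Lub_Rbar E) as [x| |]; simpl in *; try easy. lra.
Qed.

Lemma LimInf_ge {T : Type} (F : (T -> Prop) -> Prop) (u : T -> R) (m : R) (P : T -> Prop) :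
  F P -> (forall x, P x -> m <= u x) -> Rbar_le (Finite m) (LimInf F u).
Proof.
  intros HF Hm. unfold LimInf.
  set (g := Rbar_glb (fun y : Rbar => exists x : T, P x /\ y = Finite (u x))).
  apply Rbar_le_trans with g.
  - apply (proj2 (proj2_sig (Rbar_ex_glb _))). intros y [x [Hx ->]]. now apply Hm.
  - apply (proj1 (proj2_sig (Rbar_ex_lub _))). now exists P.
Qed.

Lemma one_minus_pow_le (r : R) (n : nat) : 0 < r < 1 -> 1 - r ^ n <= INR n * (1 - r).
Proof.
  intros Hr. induction n as [|n IH]. simpl; lra.
  rewrite S_INR. pose proof (pow_le_1_compat r n ltac:(lra)). simpl. nra.
Qed.

Section Extremal.

Variables (lam rho B : R) (N : nat).
Hypothesis Hlam : - (PI / 2) < lam < PI / 2.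
Hypothesis Hrho : 0 < rho <= / 2.
Hypothesis HB : forall z, Cmod z < 1 -> Cmod (cantor_Q rho z) <= B.
Hypothesis HN : (1 <= N)%nat.

Let c : C := (cis lam * RtoC (cos lam))%C.
(** The factor 1 / N cancels the N of the chain rule: [extremal_dg] then yields P(z^N) without a
    factor N, while [extremal_g] itself is at most B / N. *)
Definition extremal_g (z : C) : C := (c * (/ RtoC (INR N) * cantor_Q rho (z ^ N)))%C.
Definition extremal_dg (z : C) : C := (c * (cantor_D rho (z ^ N) * z ^ (N - 1)))%C.
Definition extremal_f (z : C) : C := (z * Cexp (extremal_g z))%C.

Lemma extremal_N_pos : 0 < INR N.
Proof. apply lt_0_INR. lia. Qed.

Lemma extremal_cos : 0 < cos lam <= 1.
Proof. split. now apply cos_gt_0. apply COS_bound. Qed.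

Lemma extremal_pow_disk (z : C) : Cmod z < 1 -> Cmod (z ^ N) < 1.
Proof.
  intros Hz. rewrite Cmod_pow. pose proof (Cmod_ge_0 z).
  destruct N as [|n]. lia. simpl.
  assert (Cmod z ^ n <= 1) by (rewrite <- (pow1 n); apply pow_incr; lra).
  assert (0 <= Cmod z ^ n) by now apply pow_le. nra.
Qed.

Lemma extremal_g_derive (z : C) : Cmod z < 1 -> cderiv extremal_g z (extremal_dg z).
Proof.
  intros Hz. pose proof extremal_N_pos.
  assert (HN0 : RtoC (INR N) <> 0) by (intros H0; apply RtoC_inj in H0; lra).
  eapply cderiv_eq.
  2: { apply cderiv_scal, cderiv_scal. apply (cderiv_comp (fun w => w ^ N)%C (cantor_Q rho)).
       apply cderiv_pow. apply cderiv_cantor_Q. easy. now apply extremal_pow_disk. }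
  unfold extremal_dg. cbv beta. field. exact HN0.
Qed.

Lemma extremal_g_bound (z : C) : Cmod z < 1 -> Cmod (extremal_g z) <= B / INR N.
Proof.
  intros Hz. pose proof extremal_N_pos. pose proof extremal_cos.
  unfold extremal_g, c. rewrite !Cmod_mult, Cmod_cis, Cmod_R.
  rewrite <- RtoC_inv, Cmod_R.
  rewrite (Rabs_pos_eq (cos lam)) by lra. rewrite Rabs_pos_eq by (left; now apply Rinv_0_lt_compat).
  assert (H1 := HB _ (extremal_pow_disk z Hz)).
  assert (0 < / INR N) by now apply Rinv_0_lt_compat. pose proof (Cmod_ge_0 (cantor_Q rho (z ^ N))).
  unfold Rdiv. rewrite (Rmult_comm B). rewrite Rmult_1_l.
  rewrite <- (Rmult_1_l (/ INR N * B)). apply Rmult_le_compat; nra.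
  now apply Rgt_not_eq.
Qed.

Lemma extremal_ratio (z : C) :
  (cis (- lam) * (1 + z * extremal_dg z))%C =
  (RtoC (cos lam) * cantor_P rho (z ^ N) - Ci * RtoC (sin lam))%C.
Proof.
  unfold extremal_dg, cantor_P, c.
  assert (EN : (z ^ N)%C = (z * z ^ (N - 1))%C)
    by (rewrite <- Cpow_S; f_equal; lia).
  transitivity (cis (- lam) + (cis (- lam) * cis lam) * RtoC (cos lam) *
    (z * z ^ (N - 1) * cantor_D rho (z ^ N)))%C. ring.
  rewrite <- EN, cis_opp_mult.
  replace (cis (- lam)) with (RtoC (cos lam) - Ci * RtoC (sin lam))%C. ring.
  unfold cis. rewrite cos_neg, sin_neg. unfold RtoC, Cminus, Cplus, Copp, Cmult, Ci; simpl.
  f_equal; ring.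
Qed.

Lemma extremal_spirallike : spirallike lam extremal_f.
Proof.
  apply (spirallike_of_derivative lam (B / INR N) extremal_g extremal_dg Hlam).
  - apply extremal_g_derive.
  - apply extremal_g_bound.
  - intros z Hz. rewrite extremal_ratio.
    assert (H := Re_cantor_P_pos rho (z ^ N) Hrho (extremal_pow_disk z Hz)). pose proof extremal_cos.
    replace (Re (RtoC (cos lam) * cantor_P rho (z ^ N) - Ci * RtoC (sin lam))) with
      (cos lam * Re (cantor_P rho (z ^ N))) by (unfold Re; simpl; ring).
    apply Rmult_lt_0_compat; lra.
Qed.

Lemma extremal_df (z : C) : Cmod z < 1 -> C_derive extremal_f z = (Cexp (extremal_g z) * (1 + z * extremal_dg z))%C.
Proof.
  intros Hz. apply is_C_derive_unique, cderiv_is_derive.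
  eapply cderiv_eq.
  2: { apply cderiv_mult. apply cderiv_id. apply (cderiv_comp extremal_g Cexp).
       now apply extremal_g_derive. apply cderiv_Cexp. }
  cbv beta. ring.
Qed.

Lemma Cmod_Cexp_bounds (w : C) (M : R) :
  Cmod w <= M -> exp (- M) <= Cmod (Cexp w) <= exp M.
Proof.
  intros H. rewrite Cmod_Cexp. assert (H1 := re_le_Cmod w).
  assert (H2 : Rabs (Re w) <= M) by lra. apply Rabs_le_between in H2.
  split.
  - destruct (Rle_lt_or_eq_dec (- M) (Re w)) as [L|L]; [lra| |].
    left; now apply exp_increasing. right; now rewrite L.
  - destruct (Rle_lt_or_eq_dec (Re w) M) as [L|L]; [lra| |].
    left; now apply exp_increasing. right; now rewrite L.
Qed.

Lemma extremal_df_lower (z : C) :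
  Cmod z < 1 ->
  exp (- (B / INR N)) * (cos lam * Cmod (cantor_P rho (z ^ N)) - 1) <= Cmod (C_derive extremal_f z).
Proof.
  intros Hz. rewrite extremal_df by easy. rewrite Cmod_mult.
  destruct (Cmod_Cexp_bounds _ _ (extremal_g_bound z Hz)) as [H1 _].
  assert (H2 : cos lam * Cmod (cantor_P rho (z ^ N)) - 1 <= Cmod (1 + z * extremal_dg z)).
  { rewrite <- (Cmod_cis_mult (- lam) (1 + z * extremal_dg z)), extremal_ratio. pose proof extremal_cos.
    assert (T := Cmod_triangle_inv (RtoC (cos lam) * cantor_P rho (z ^ N)) (Ci * RtoC (sin lam))).
    rewrite !Cmod_mult, Cmod_Ci, !Cmod_R, (Rabs_pos_eq (cos lam)) in T by lra.
    assert (Rabs (sin lam) <= 1) by (apply Rabs_le; apply SIN_bound). lra. }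
  pose proof (exp_pos (- (B / INR N))).
  apply Rle_trans with (exp (- (B / INR N)) * Cmod (1 + z * extremal_dg z)).
  apply Rmult_le_compat_l; lra. apply Rmult_le_compat_r. apply Cmod_ge_0. easy.
Qed.

Lemma extremal_dg_continuous (z : C) :
  Cmod z < 1 -> continuous_CC extremal_dg z.
Proof.
  intros Hz. apply continuous_Cmult. apply continuous_const.
  apply continuous_Cmult.
  - apply (continuous_comp (V := C_UniformSpace) (fun w => w ^ N)%C (cantor_D rho)).
    eapply cderiv_continuous, cderiv_pow. apply continuous_cantor_D. easy. now apply extremal_pow_disk.
  - apply (cderiv_continuous (fun w => w ^ (N - 1))%C) with (1 := cderiv_pow _ _).
Qed.

Lemma circle_pow (r t : R) (n : nat) :
  ((RtoC r * cis t) ^ n)%C = (RtoC (r ^ n) * cis (INR n * t))%C.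
Proof.
  rewrite Cpow_mult_l, <- RtoC_pow. f_equal. rewrite <- !Cexp_Ci, Cexp_pow. f_equal.
  rewrite RtoC_mult. ring.
Qed.

Lemma extremal_length_lower (r : R) :
  0 < r < 1 ->
  r * exp (- (B / INR N)) *
    (cos lam * RInt (fun t => Cmod (cantor_P rho (RtoC (r ^ N) * cis t))) 0 (2 * PI) - 2 * PI) <=
  curve_length r extremal_f.
Proof.
  intros Hr. unfold curve_length. assert (HPI := PI_RGT_0).
  assert (Hm : forall t, Cmod (RtoC r * cis t) < 1) by (intros; rewrite Cmod_circle; lra).
  assert (HrN : 0 < r ^ N < 1).
  { split. apply pow_lt; lra. assert (H := extremal_pow_disk (RtoC r)). rewrite Cmod_pow, Cmod_R, Rabs_pos_eq in H by lra. lra. }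
  set (K := r * exp (- (B / INR N))).
  set (g0 := fun t => Cmod (cantor_P rho (RtoC (r ^ N) * cis t))).
  assert (Hg0 : forall t, continuous_RR g0 t)
    by (intros; now apply continuous_Cmod_cantor_P_circle).
  assert (Hgp : forall t, g0 (t + 2 * PI) = g0 t) by (intros; unfold g0; now rewrite cis_2PI).
  assert (HgN : forall t, continuous_RR (fun t => g0 (INR N * t)) t).
  { intros t. apply (continuous_comp (fun t => INR N * t) g0). 2: apply Hg0.
    apply (ex_derive_continuous (fun t => INR N * t)). now auto_derive. }
  assert (EL : RInt (fun t => r * Cmod (C_derive extremal_f (RtoC r * Cexp (Ci * RtoC t)))) 0 (2 * PI) =
    RInt (fun t => r * Cmod (Cexp (extremal_g (RtoC r * cis t)) *
      (1 + (RtoC r * cis t) * extremal_dg (RtoC r * cis t)))) 0 (2 * PI)).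
  { apply RInt_ext. intros t _. rewrite Cexp_Ci, extremal_df by apply Hm. reflexivity. }
  rewrite EL. fold g0.
  apply Rle_trans with (RInt (fun t => minus (scal (K * cos lam) (g0 (INR N * t))) K) 0 (2 * PI)).
  - rewrite (RInt_minus (V := R_CompleteNormedModule)), (RInt_scal (V := R_CompleteNormedModule)), RInt_const.
    + rewrite (RInt_periodic_mult g0 N Hg0 Hgp HN).
      change (K * (cos lam * RInt g0 0 (2 * PI) - 2 * PI) <=
        K * cos lam * RInt g0 0 (2 * PI) - (2 * PI - 0) * K). lra.
    + now apply ex_RInt_continuous_all.
    + apply (ex_RInt_scal (V := R_NormedModule)). now apply ex_RInt_continuous_all.
    + apply ex_RInt_const.
  - apply RInt_le. lra.
    + apply (ex_RInt_minus (V := R_NormedModule)). 2: apply ex_RInt_const.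
      apply (ex_RInt_scal (V := R_NormedModule)). now apply ex_RInt_continuous_all.
    + apply ex_RInt_continuous_all. intros t.
      apply (continuous_mult (K := R_AbsRing) (fun _ => r)). apply continuous_const.
      apply (continuous_comp (V := C_UniformSpace) (fun t => Cexp (extremal_g (RtoC r * cis t)%C) *
        (1 + (RtoC r * cis t) * extremal_dg (RtoC r * cis t)%C))%C Cmod). 2: apply continuous_Cmod.
      apply continuous_Cmult.
      * apply (continuous_comp (V := C_UniformSpace) (fun t => extremal_g (RtoC r * cis t)%C) Cexp).
        apply (continuous_comp (V := C_UniformSpace) (fun t => RtoC r * cis t)%C extremal_g).
        apply continuous_circle. eapply cderiv_continuous, extremal_g_derive, Hm.
        eapply cderiv_continuous, cderiv_Cexp.
      * apply continuous_Cplus. apply continuous_const. apply continuous_Cmult. apply continuous_circle.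
        apply (continuous_comp (V := C_UniformSpace) (fun t => RtoC r * cis t)%C extremal_dg).
        apply continuous_circle. apply extremal_dg_continuous, Hm.
    + intros t _. change (K * cos lam * g0 (INR N * t) - K <= r *
        Cmod (Cexp (extremal_g (RtoC r * cis t)) * (1 + (RtoC r * cis t) * extremal_dg (RtoC r * cis t)))).
      assert (H := extremal_df_lower _ (Hm t)). rewrite extremal_df, circle_pow in H by apply Hm.
      fold (g0 (INR N * t)) in H. unfold K.
      apply Rle_trans with (r * (exp (- (B / INR N)) * (cos lam * g0 (INR N * t) - 1))). lra.
      apply Rmult_le_compat_l. lra. exact H.
Qed.

Lemma extremal_max_modulus (r : R) :
  0 < r < 1 -> 0 < max_modulus r extremal_f <= r * exp (B / INR N).
Proof.
  intros Hr.
  assert (Hb : forall z, Cmod z = r ->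
    r * exp (- (B / INR N)) <= Cmod (extremal_f z) <= r * exp (B / INR N)).
  { intros z Hz. unfold extremal_f. rewrite Cmod_mult, Hz.
    assert (H := Cmod_Cexp_bounds _ _ (extremal_g_bound z ltac:(lra))).
    split; apply Rmult_le_compat_l; lra. }
  assert (Hz0 : Cmod r = r) by (rewrite Cmod_R; apply Rabs_pos_eq; lra).
  assert (H := max_modulus_bounds r _ (r * exp (B / INR N)) extremal_f r Hz0 (proj1 (Hb r Hz0))
    (fun z Hz => proj2 (Hb z Hz))).
  pose proof (exp_pos (- (B / INR N))). split. 2: lra.
  apply Rlt_le_trans with (2 := proj1 H). apply Rmult_lt_0_compat; lra.
Qed.

End Extremal.

Lemma exp_opp_ge (x : R) : 1 - x <= exp (- x).
Proof.
  destruct (Req_dec x 0) as [->|H]. rewrite Ropp_0, exp_0. lra.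
  pose proof (exp_ineq1 (- x)). lra.
Qed.

Lemma cantor_ratio_exists (eps : R) :
  0 < eps -> exists rho, 0 < rho <= / 8 /\ - (eps / 16) <= ln 2 / ln rho <= 0.
Proof.
  (* The term 3 gives exp (- K) <= 1/8, and 16 / eps makes the dimension ln 2 / K at most eps /
     16. *)
  intros He. set (K := 3 + 16 / eps).
  assert (H16 : 0 < 16 / eps) by (apply Rdiv_lt_0_compat; lra).
  exists (exp (- K)). rewrite ln_exp.
  assert (Hl2 : 0 < ln 2 < 1).
  { split. rewrite <- ln_1. apply ln_increasing; lra. rewrite <- (ln_exp 1).
    apply ln_increasing. lra. pose proof (exp_ineq1 1). lra. }
  split; split.
  - apply exp_pos.
  - rewrite exp_Ropp. apply Rinv_le_contravar. lra.
    apply Rle_trans with (exp 3). 2: left; apply exp_increasing; unfold K; lra.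
    replace 3 with (1 + 1 + 1) by ring. rewrite !exp_plus. pose proof (exp_ineq1 1).
    assert (2 * 2 <= exp 1 * exp 1) by nra. nra.
  - replace (ln 2 / - K) with (- (ln 2 / K)) by (field; unfold K; lra).
    apply Ropp_le_contravar. apply Rle_div_l. unfold K; lra.
    unfold K. replace (eps / 16 * (3 + 16 / eps)) with (1 + 3 * eps / 16) by (field; lra). lra.
  - replace (ln 2 / - K) with (- (ln 2 / K)) by (field; unfold K; lra).
    assert (0 <= ln 2 / K) by (apply Rdiv_le_0_compat; unfold K; lra). lra.
Qed.

Theorem theorem1p2 (lam : R) (Hlam : - (PI / 2) < lam < PI / 2)
    (eps : R) (Heps : 0 < eps < 4) :
  exists f : C -> C,
    spirallike lam f /\
    Rbar_le (Finite ((4 - eps) * cos lam))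
      (LimInf (at_left 1)
        (fun r : R =>
           curve_length r f /
           (max_modulus r f * ln ((1 + r) / (1 - r))))).
Proof.
  assert (Hcos : 0 < cos lam <= 1) by (split; [now apply cos_gt_0 | apply COS_bound]).
  assert (HPI := PI_RGT_0).
  destruct (cantor_ratio_exists eps (proj1 Heps)) as [rho [Hrho Hal]].
  assert (Hrho2 : 0 < rho <= / 2) by lra.
  destruct (cantor_Q_bounded rho Hrho) as [B [HB0 HB]].
  (* Of the total loss eps, a quarter goes to the dimension of the Cantor set, a half to the
     additive constants, and a quarter to the oscillation of |f / z|, as 4 [del] = eps / 4. *)
  set (del := eps / 16).
  destruct (nfloor_ex (2 * B / del)) as [n [_ Hn]].
  { apply Rdiv_le_0_compat; unfold del; lra. }
  set (N := S n). assert (HN : (1 <= N)%nat) by (unfold N; lia).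
  assert (HN0 : 0 < INR N) by (apply lt_0_INR; lia).
  assert (HM : 2 * (B / INR N) <= del).
  { replace (2 * (B / INR N)) with (2 * B / INR N) by (field; lra).
    apply Rle_div_l. easy. unfold N. rewrite S_INR.
    assert (Hd : 0 < del) by (unfold del; lra).
    apply Rlt_div_l in Hn; lra. }
  set (M := B / INR N) in *.
  exists (extremal_f lam rho N). split.
  { now apply (extremal_spirallike lam rho B N). }
  assert (Hl2 : 0 < ln 2) by (rewrite <- ln_1; apply ln_increasing; lra).
  assert (HlN : 0 <= ln (INR N)).
  { rewrite <- ln_1. apply ln_le. lra. change 1 with (INR 1). now apply le_INR. }
  (* All terms independent of r: the passage from 1 - r^N to (1 + r) / (1 - r), the loss in
     [circle_mean_P_lower], and 2 pi from |sin lam| <= 1. *)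
  set (Cst := 4 * (ln 2 + ln (INR N)) + 16 * ln 2 + 2 * PI).
  assert (HCst : 0 < Cst) by (unfold Cst; lra).
  (* From this size of the logarithm on, [Cst] is at most eps / 2 * cos lam times it. *)
  set (l0 := 2 * Cst / (eps * cos lam)).
  assert (Hl0 : 0 < l0) by (apply Rdiv_lt_0_compat; [lra | apply Rmult_lt_0_compat; lra]).
  assert (Hd0 : 0 < Rmin (/ 2) (exp (- l0))) by (apply Rmin_pos; [lra | apply exp_pos]).
  (* The entry exp (- l0) makes the logarithm at least [l0]; the entry 1/2 keeps r positive. *)
  apply LimInf_ge with (fun r => 1 - Rmin (/ 2) (exp (- l0)) < r < 1).
  { exists (mkposreal _ Hd0). intros r Hr Hr1.
    assert (Hr' : Rabs (r - 1) < Rmin (/ 2) (exp (- l0))) by exact Hr.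
    apply Rabs_def2 in Hr'. lra. }
  intros r Hr.
  pose proof (Rmin_l (/ 2) (exp (- l0))). pose proof (Rmin_r (/ 2) (exp (- l0))).
  assert (Hr01 : 0 < r < 1) by lra.
  assert (HL := extremal_length_lower lam rho B N Hlam Hrho2 HB HN r Hr01).
  destruct (extremal_max_modulus lam rho B N Hlam Hrho2 HB HN r Hr01) as [HM1 HM2].
  fold M in HL, HM2.
  assert (HrN : 0 < r ^ N < 1).
  { assert (Q := extremal_pow_disk N HN r). rewrite Cmod_pow, Cmod_R, Rabs_pos_eq in Q by lra.
    split. apply pow_lt; lra. lra. }
  assert (HI := circle_mean_P_lower rho (r ^ N) Hrho2 HrN).
  set (I := RInt (fun t => Cmod (cantor_P rho (RtoC (r ^ N) * cis t))) 0 (2 * PI)) in *.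
  set (l := ln ((1 + r) / (1 - r))) in *.
  assert (Hl : l0 <= l).
  { unfold l. rewrite <- (ln_exp l0). apply ln_le. apply exp_pos.
    apply Rle_trans with (/ (1 - r)).
    - rewrite <- (Ropp_involutive l0), exp_Ropp. apply Rinv_le_contravar; lra.
    - unfold Rdiv. assert (0 < / (1 - r)) by (apply Rinv_0_lt_compat; lra). nra. }
  assert (Hlow : l - ln 2 - ln (INR N) <= - ln (1 - r ^ N)).
  { assert (E : l <= ln 2 - ln (1 - r)).
    { unfold l. rewrite ln_div by lra. assert (ln (1 + r) <= ln 2) by (apply ln_le; lra). lra. }
    assert (E2 : ln (1 - r ^ N) <= ln (INR N) + ln (1 - r)).
    { rewrite <- ln_mult by lra. apply ln_le. lra. now apply one_minus_pow_le. }
    lra. }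
  (* Minus the dimension here, hence nonpositive. *)
  set (al := ln 2 / ln rho) in *.
  assert (HI2 : (4 - eps / 4) * l - (4 * (ln 2 + ln (INR N)) + 16 * ln 2) <= I).
  { eapply Rle_trans. 2: apply HI.
    assert (E : (1 + al) * (l - ln 2 - ln (INR N)) <= (1 + al) * (- ln (1 - r ^ N))).
    { apply Rmult_le_compat_l; lra. }
    assert (E2 : - (eps / 16) * l <= al * l) by (apply Rmult_le_compat_r; lra).
    assert (E3 : al * (ln 2 + ln (INR N)) <= 0) by nra. lra. }
  assert (HT : cos lam * ((4 - eps / 4) * l) - Cst <= cos lam * I - 2 * PI).
  { assert (cos lam * ((4 - eps / 4) * l - (4 * (ln 2 + ln (INR N)) + 16 * ln 2)) <= cos lam * I)
      by (apply Rmult_le_compat_l; lra).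
    assert (cos lam * (4 * (ln 2 + ln (INR N)) + 16 * ln 2) <= 1 * (4 * (ln 2 + ln (INR N)) + 16 * ln 2))
      by (apply Rmult_le_compat_r; lra).
    unfold Cst. lra. }
  set (T := cos lam * I - 2 * PI) in *.
  assert (HC2 : Cst <= eps / 2 * cos lam * l).
  { replace Cst with (eps / 2 * cos lam * l0) by (unfold l0; field; lra).
    apply Rmult_le_compat_l. nra. easy. }
  assert (Hcl : 0 < cos lam * l) by nra.
  assert (HT2 : (4 - 3 / 4 * eps) * (cos lam * l) <= T) by nra.
  assert (HT0 : 0 <= T) by nra.
  assert (Hkey : (4 - eps) * cos lam * l * exp M <= exp (- M) * T).
  { assert (Hx : 1 - del <= exp (- M) * exp (- M)).
    { rewrite <- exp_plus. replace (- M + - M) with (- (2 * M)) by ring.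
      pose proof (exp_opp_ge (2 * M)). lra. }
    assert (HxM := exp_pos M).
    assert (E1 : exp (- M) = exp M * (exp (- M) * exp (- M))).
    { rewrite <- Rmult_assoc, <- exp_plus. replace (M + - M) with 0 by ring. rewrite exp_0. ring. }
    rewrite E1.
    apply Rle_trans with (exp M * ((1 - del) * T)).
    2: { rewrite Rmult_assoc. apply Rmult_le_compat_l. lra. apply Rmult_le_compat_r; lra. }
    rewrite Rmult_comm. apply Rmult_le_compat_l. lra.
    apply Rle_trans with ((1 - del) * ((4 - 3 / 4 * eps) * (cos lam * l))).
    - unfold del. replace ((4 - eps) * cos lam * l) with ((4 - eps) * (cos lam * l)) by ring.
      assert (4 - eps <= (1 - eps / 16) * (4 - 3 / 4 * eps)) by nra.
      rewrite <- (Rmult_assoc (1 - eps / 16)). apply Rmult_le_compat_r; lra.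
    - apply Rmult_le_compat_l. unfold del; lra. exact HT2. }
  assert (Hl' : 0 < l) by lra.
  assert (Hden : 0 < max_modulus r (extremal_f lam rho N) * l) by now apply Rmult_lt_0_compat.
  apply (Rle_div_r ((4 - eps) * cos lam)). easy.
  apply Rle_trans with ((4 - eps) * cos lam * (r * exp M * l)).
  - apply Rmult_le_compat_l. nra. apply Rmult_le_compat_r; lra.
  - apply Rle_trans with (2 := HL).
    replace ((4 - eps) * cos lam * (r * exp M * l)) with (r * ((4 - eps) * cos lam * l * exp M)) by ring.
    rewrite (Rmult_assoc r). apply Rmult_le_compat_l; lra.
Qed.
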